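(* Let $\mathcal H=\mathcal H_+\oplus\mathcal H_-$ carry the direct sum of the two chiral representations of $\mathcal A(S^4_q)$ described in the context, let $D|l,m_1,m_2;j\rangle_\pm=(l+\frac32)|l,m_1,m_2;j\rangle_\mp$, and let $J$ be the antilinear isometry on $\mathcal H$ given by $$J|l,m_1,m_2;j\rangle_\pm=i^{2l+1}(-1)^{j+m_1}|l,-m_1,-m_2;j\rangle_\pm .$$ Then $$[a,JbJ]\in\mathrm{OP}^{-\infty},\qquad[[D,a],JbJ]\in\mathrm{OP}^{-\infty},\qquad\forall\,a,b\in\mathcal A(S^4_q).$$
   Context: Fix $0<q<1$; $[x]=(q^x-q^{-x})/(q-q^{-1})$. $\mathcal A(S^4_q)$ is the unital $*$-algebra generated by $x_0=x_0^*,x_1,x_1^*,x_2,x_2^*$ with relations $x_ix_j=q^2x_jx_i$ ($0\le i<j\le2$), $x_i^*x_j=q^2x_jx_i^*$ ($i\ne j$), $[x_1^*,x_1]=(1-q^4)x_0^2$, $[x_2^*,x_2]=x_1^*x_1-q^4x_1x_1^*$, $x_0^2+x_1x_1^*+x_2x_2^*=1$. Chiral representations: $\mathcal H_\pm$ are Hilbert spaces with orthonormal bases $|l,m_1,m_2;j\rangle_\pm$, where $l\in\mathbb N+\frac12$, $j=\frac12,\frac32,\dots,l$, $j-|m_1|\in\mathbb N$, $l+\frac12-j-|m_2|\in\mathbb N$. In any coefficient with indices $(l,j,m_2)$, $\epsilon=\pm\frac12$ is determined by $l+\epsilon-j-m_2\in2\mathbb N$. Terms with vectors outside the index set are omitted.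 The $*$-representation of $\mathcal A(S^4_q)$ on $\mathcal H_\pm$ is $$\begin{aligned} x_0|l,m_1,m_2;j\rangle_\pm&=A^+_{j,m_1}\big(C^+_{l,j,m_2}|l+1,m_1,m_2;j+1\rangle_\pm\mp C^0_{l,j,m_2}|l,m_1,m_2;j+1\rangle_\pm+C^-_{l,j,m_2}|l-1,m_1,m_2;j+1\rangle_\pm\big)\\ &+A^0_{j,m_1}\big(H^+_{l,j,m_2}|l+1,m_1,m_2;j\rangle_\pm\pm H^0_{l,j,m_2}|l,m_1,m_2;j\rangle_\pm+H^+_{l-1,j,m_2}|l-1,m_1,m_2;j\rangle_\pm\big)\\ &+A^+_{j-1,m_1}\big(C^-_{l+1,j-1,m_2}|l+1,m_1,m_2;j-1\rangle_\pm\mp C^0_{l,j-1,m_2}|l,m_1,m_2;j-1\rangle_\pm+C^+_{l-1,j-1,m_2}|l-1,m_1,m_2;j-1\rangle_\pm\big),\\ x_1|l,m_1,m_2;j\rangle_\pm&=B^+_{j,m_1}\big(C^+_{l,j,m_2}|l+1,m_1+1,m_2;j+1\rangle_\pm\mp C^0_{l,j,m_2}|l,m_1+1,m_2;j+1\rangle_\pm+C^-_{l,j,m_2}|l-1,m_1+1,m_2;j+1\rangle_\pm\big)\\ &+B^0_{j,m_1}\big(H^+_{l,j,m_2}|l+1,m_1+1,m_2;j\rangle_\pm\pm H^0_{l,j,m_2}|l,m_1+1,m_2;j\rangle_\pm+H^+_{l-1,j,m_2}|l-1,m_1+1,m_2;j\rangle_\pm\big)\\ &+B^-_{j,m_1}\big(C^-_{l+1,j-1,m_2}|l+1,m_1+1,m_2;j-1\rangle_\pm\mp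 C^0_{l,j-1,m_2}|l,m_1+1,m_2;j-1\rangle_\pm+C^+_{l-1,j-1,m_2}|l-1,m_1+1,m_2;j-1\rangle_\pm\big),\\ x_2|l,m_1,m_2;j\rangle_\pm&=D^+_{l,j,m_2}|l+1,m_1,m_2+1;j\rangle_\pm\pm D^0_{l,j,m_2}|l,m_1,m_2+1;j\rangle_\pm+D^-_{l,j,m_2}|l-1,m_1,m_2+1;j\rangle_\pm, \end{aligned}$$ with coefficients $$\begin{aligned} A^+_{j,m_1}&=q^{m_1-1}\tfrac{\sqrt{[j+m_1+1][j-m_1+1]}}{[2j+2]},\quad A^0_{j,m_1}=q^{-2}\tfrac{q^{j+m_1+1}[2][j-m_1]-[2j]}{[2j][2j+2]},\\ B^+_{j,m_1}&=q^{-j+m_1-1/2}\tfrac{\sqrt{[j+m_1+1][j+m_1+2]}}{[2j+2]},\quad B^0_{j,m_1}=(1+q^2)q^{m_1-1/2}\tfrac{\sqrt{[j-m_1][j+m_1+1]}}{[2j][2j+2]},\quad B^-_{j,m_1}=-q^{j+m_1+1/2}\tfrac{\sqrt{[j-m_1][j-m_1-1]}}{[2j]},\\ C^+_{l,j,m_2}&=-q^{m_2-1-\epsilon}\tfrac{\sqrt{[l+j+m_2+3+\epsilon][l+j-m_2+3-\epsilon]}}{[2l+4]},\\ C^0_{l,j,m_2}&=[4\epsilon]\,q^{2\epsilon l+m_2-1+3\epsilon}\tfrac{\sqrt{[l+\frac12+j-2\epsilon m_2+2][l+\frac12-j-2\epsilon m_2]}}{[2l+2][2l+4]},\\ C^-_{l,j,m_2}&=-q^{m_2-1+\epsilon}\tfrac{\sqrt{[l-j+m_2-\epsilon][l-j-m_2+\epsilon]}}{[2l+2]},\\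 H^+_{l,j,m_2}&=q^{m_2-1+\epsilon(2j+1)}\tfrac{\sqrt{[l+2\epsilon j-m_2+2+\epsilon][l-2\epsilon j+m_2+2-\epsilon]}}{[2l+4]},\\ H^0_{l,j,m_2}&=\tfrac{[l-\epsilon(2j+1)-m_2+1][l-\epsilon(2j+1)+m_2+2]-q^{-2}[l+\epsilon(2j+1)-m_2+2][l+\epsilon(2j+1)+m_2+1]}{[2l+2][2l+4]},\\ D^+_{l,j,m_2}&=q^{-l+m_2-3/2}\tfrac{\sqrt{[l+j+m_2+3+\epsilon][l-j+m_2+2-\epsilon]}}{[2l+4]},\\ D^0_{l,j,m_2}&=[2]q^{m_2+1/2}\tfrac{\sqrt{[l-2\epsilon j-m_2+1-\epsilon][l-2\epsilon j+m_2+2-\epsilon]}}{[2l+2][2l+4]},\\ D^-_{l,j,m_2}&=-q^{l+m_2+3/2}\tfrac{\sqrt{[l-j-m_2+\epsilon][l+j-m_2+1-\epsilon]}}{[2l+2]}. \end{aligned}$$ With $\delta(T)=[|D|,T]$ and $\mathrm{OP}^0=\bigcap_{j\ge0}\mathrm{dom}\,\delta^j$, the ideal of smoothing operators is $\mathrm{OP}^{-\infty}=\{T\text{ bounded on }\mathcal H:\ |D|^kT\in\mathrm{OP}^0\ \forall k\in\mathbb N\}$. *)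

(* Defs.v *)
From HB Require Import structures.
From mathcomp Require Import all_boot all_order all_algebra.
From mathcomp Require Import all_classical all_reals all_analysis.
From mathcomp Require Import complex lra.

Set Implicit Arguments.
Unset Strict Implicit.
Unset Printing Implicit Defensive.
Import Order.TTheory GRing.Theory Num.Theory.
Local Open Scope classical_set_scope.
Local Open Scope ring_scope.

(** * The Hilbert space ell^2(T) *)

(** Sums over [T] are unconditional: the positive and the negative parts are
    summed separately, which gives the usual value for absolutely summable
    families (the only ones occurring below). *)
Definition real_sum {R : realType} {T : choiceType} (f : T -> R) : R :=
  fine (\esum_(t in [set: T]) (Num.max (f t) 0)%:E) -
  fine (\esum_(t in [set: T]) (Num.max (- f t) 0)%:E).

Definition complex_sum {R : realType} {T : choiceType} (f : T -> R[i]) : R[i] :=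
  Complex (real_sum (fun t => complex.Re (f t)))
          (real_sum (fun t => complex.Im (f t))).

Definition square_summable {R : realType} {T : choiceType} : {pred T -> R[i]} :=
  fun f => `[< (\esum_(t in [set: T]) (Normc.normc (f t) ^+ 2)%:E < +oo)%E >].

Lemma square_summable_le (R : realType) (T : choiceType) (f : T -> R[i])
    (g : T -> R) :
    (forall t, Normc.normc (f t) ^+ 2 <= g t) ->
    (\esum_(t in [set: T]) (g t)%:E < +oo)%E -> f \in square_summable.
Proof.
move=> fg gfin; apply/asboolP; apply: le_lt_trans gfin.
by apply: le_esum => t _; rewrite lee_fin.
Qed.

Lemma square_summable_submod (R : realType) (T : choiceType) :
  subsemimod_closed (@square_summable R T).
Proof.
have normsq0 (x : R[i]) : 0 <= Normc.normc x ^+ 2 by rewrite sqr_ge0.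
split; first split.
- apply/asboolP; rewrite esum1 ?ltry// => t _.
  by rewrite [X in Normc.normc X]/(0 : R[i]) Normc.normc0 expr0n.
- move=> u v /asboolP hu /asboolP hv.
  pose g (w : T -> R[i]) t := Normc.normc (w t) ^+ 2.
  apply: (@square_summable_le _ _ _ (fun t => (g u t + g u t) + (g v t + g v t))).
    move=> t; rewrite /g [X in Normc.normc X]/(u t + v t).
    have := sqr_ge0 (Normc.normc (u t) - Normc.normc (v t)).
    have n0 (x : R[i]) : 0 <= Normc.normc x.
      by case: x => a b /=; exact: sqrtr_ge0.
    have : Normc.normc (u t + v t) ^+ 2 <=
           (Normc.normc (u t) + Normc.normc (v t)) ^+ 2.
      by rewrite lerXn2r ?nnegrE ?addr_ge0 ?le_normcD.
    rewrite sqrrD sqrrB => h1 h2; apply: (le_trans h1).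
    by rewrite -subr_ge0; apply: le_trans h2 _; rewrite mulr2n; lra.
  under eq_esum do rewrite !EFinD.
  have g0 w t : (0 <= (g w t)%:E)%E by rewrite lee_fin /g.
  by rewrite !esumD ?lte_add_pinfty// => t _; rewrite adde_ge0.
- move=> a u /asboolP hu; apply/asboolP.
  set f := fun t => (Normc.normc (u t) ^+ 2)%:E in hu.
  have f0 t : (0 <= f t)%E by rewrite lee_fin.
  apply: (@le_lt_trans _ _ ((Normc.normc a ^+ 2)%:E * \esum_(t in [set: T]) f t)%E).
    apply: ge_ereal_sup => _ [F [Ffin FT] <-].
    have -> : \sum_(t \in F) (Normc.normc ((a *: u) t) ^+ 2)%:E =
              ((Normc.normc a ^+ 2)%:E * \sum_(t \in F) f t)%E.
      rewrite ge0_mule_fsumr//; apply: eq_fsbigr => t _.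
      by rewrite [X in Normc.normc X]/(a * u t) Normc.normcM exprMn EFinM.
    rewrite lee_wpmul2l ?lee_fin//.
    by apply: ereal_sup_ubound; exists F.
  by apply: lte_mul_pinfty; rewrite ?lee_fin.
Qed.

HB.instance Definition _ (R : realType) (T : choiceType) :=
  GRing.isSubmodClosed.Build R[i] (T -> R[i]) (@square_summable R T)
    (@square_summable_submod R T).

(** Vectors of ell^2(T), i.e. of the Hilbert space with an orthonormal basis
    labelled by [T], given by their coordinates. *)
Record ell2 (R : realType) (T : choiceType) := Ell2 {
  coord :> T -> R[i];
  coordP : coord \in square_summable }.

HB.instance Definition _ (R : realType) (T : choiceType) :=
  [isSub for @coord R T].
HB.instance Definition _ (R : realType) (T : choiceType) :=
  [Choice of ell2 R T by <:].
HB.instance Definition _ (R : realType) (T : choiceType) :=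
  [SubChoice_isSubLmodule of ell2 R T by <:].

(** * Operators *)
Section Operators.
Variables (R : realType) (T : choiceType).
Notation H := (ell2 R T).
Implicit Types (u v w : H) (S A B : H -> H).

Definition inner u v : R[i] := complex_sum (fun t => (u t)^* * v t).

Definition l2norm v : R :=
  Num.sqrt (fine (\esum_(t in [set: T]) (Normc.normc (v t) ^+ 2)%:E)).

Definition bounded_operator A : Prop :=
  (forall (c : R[i]) u v, A (c *: u + v) = c *: A u + A v) /\
  (exists M : R, forall v, l2norm (A v) <= M * l2norm v).

Definition antilinear_isometry A : Prop :=
  (forall (c : R[i]) u v, A (c *: u + v) = c^* *: A u + A v) /\
  (forall v, l2norm (A v) = l2norm v).

Definition commutator A B : H -> H := fun v => A (B v) - B (A v).

(** A possibly unbounded operator [P] is given by its graph: [P v w] means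
    that [v] is in the domain of [P] and that [P] maps [v] to [w]. *)
Definition graph := H -> H -> Prop.
Implicit Type P : graph.

Definition graph_comp (P Q : graph) : graph :=
  fun v w => exists2 u, Q v u & P u w.

Definition adjoint P : graph :=
  fun v w => forall x y, P x y -> inner y v = inner x w.

Definition self_adjoint P : Prop := forall v w, P v w <-> adjoint P v w.

(** [absP] is |P|, the positive square root of P^* P. *)
Definition absolute_value P (absP : graph) : Prop :=
  [/\ self_adjoint absP,
      (forall v w, absP v w -> 0 <= inner v w) &
      (forall v w, graph_comp absP absP v w <-> graph_comp (adjoint P) P v w)].

Fixpoint graph_pow P (n : nat) : graph :=
  if n is n'.+1 then graph_comp P (graph_pow P n') else fun v w => v = w.

(** [A] preserves the domain of [P], and [P, A], defined on that domain, is
    bounded with (unique, if [P] is densely defined) bounded extension [S]. *)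
Definition bounded_commutator P A S : Prop :=
  bounded_operator S /\ (forall v w, P v w -> P (A v) (S v + A w)).

(** [A] is in the domain of the n-th power of delta = [absD, -], an unbounded
    derivation of the algebra of bounded operators. *)
Fixpoint dom_delta (absD : graph) (n : nat) A : Prop :=
  if n is n'.+1 then
    bounded_operator A /\
    exists2 S, bounded_commutator absD A S & dom_delta absD n' S
  else bounded_operator A.

Definition OP0 (absD : graph) A : Prop := forall n, dom_delta absD n A.

Definition smoothing (absD : graph) A : Prop :=
  bounded_operator A /\
  forall k : nat, exists2 S, (forall v, graph_pow absD k (A v) (S v)) & OP0 absD S.

End Operators.

(** * The *-algebra of the orthogonal quantum 4-sphere *)
Section QuantumSphere.
Variables (R : realType) (q : R).
Local Notation "r %:C" := (real_complex_def (Phant _) r) : ring_scope.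

Record star_axioms (A : algType R[i]) (star : A -> A) : Prop := {
  starK : forall a, star (star a) = a;
  starZD : forall (c : R[i]) a b, star (c *: a + b) = c^* *: star a + star b;
  starM : forall a b, star (a * b) = star b * star a }.

Definition sphere_relations (A : algType R[i]) (star : A -> A) (x : 'I_3 -> A) :
    Prop :=
  star (x 0) = x 0 /\
  (forall i j : 'I_3, (i < j)%N -> x i * x j = (q ^+ 2)%:C *: (x j * x i)) /\
  (forall i j : 'I_3, i != j ->
    star (x i) * x j = (q ^+ 2)%:C *: (x j * star (x i))) /\
  star (x 1) * x 1 - x 1 * star (x 1) = (1 - q ^+ 4)%:C *: x 0 ^+ 2 /\
  star (x 2) * x 2 - x 2 * star (x 2) =
    star (x 1) * x 1 - (q ^+ 4)%:C *: (x 1 * star (x 1)) /\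
  x 0 ^+ 2 + x 1 * star (x 1) + x 2 * star (x 2) = 1.

(** [A] is the unital *-algebra generated by [x 0], [x 1], [x 2] subject to
    [sphere_relations] only. *)
Record is_quantum_sphere (A : algType R[i]) (star : A -> A) (x : 'I_3 -> A) :
    Prop := {
  sphere_star : star_axioms star;
  sphere_rel : sphere_relations star x;
  sphere_gen : forall P : A -> Prop,
    P 1 -> (forall i, P (x i)) ->
    (forall (c : R[i]) a b, P a -> P b -> P (c *: a + b)) ->
    (forall a b, P a -> P b -> P (a * b)) ->
    (forall a, P a -> P (star a)) -> forall a, P a;
  sphere_univ : forall (B : algType R[i]) (starB : B -> B) (y : 'I_3 -> B),
    star_axioms starB -> sphere_relations starB y ->
    exists f : {lrmorphism A -> B},
      (forall a, f (star a) = starB (f a)) /\ (forall i, f (x i) = y i) }.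

Record star_representation (T : choiceType) (A : algType R[i]) (star : A -> A)
    (pi : A -> ell2 R T -> ell2 R T) : Prop := {
  rep_bounded : forall a, bounded_operator (pi a);
  rep1 : forall v, pi 1 v = v;
  repM : forall a b v, pi (a * b) v = pi a (pi b v);
  repZD : forall (c : R[i]) a b v, pi (c *: a + b) v = c *: pi a v + pi b v;
  rep_star : forall a u v, inner (pi (star a) u) v = inner u (pi a v) }.

End QuantumSphere.

(** * The Hilbert space of the chiral representations *)

Definition is_label (l m1 m2 j : rat) : bool :=
  [&& l - 2^-1 \is a Num.nat, j - 2^-1 \is a Num.nat, j <= l,
      j - `|m1| \is a Num.nat & l + 2^-1 - j - `|m2| \is a Num.nat].

Record label := Label {
  label_val :> rat * rat * rat * rat;
  labelP : let: (l, m1, m2, j) := label_val in is_label l m1 m2 j }.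

HB.instance Definition _ := [isSub for label_val].
HB.instance Definition _ := [Choice of label by <:].

(** The direct sum of H_+ ([true]) and H_- ([false]). *)
Definition spinor_space (R : realType) := ell2 R (bool * label)%type.

Definition ket_fun {R : realType} (s : bool) (l m1 m2 j : rat)
    (t : bool * label) : R[i] :=
  ((t.1 == s) && (label_val t.2 == (l, m1, m2, j)))%:R.

Lemma ket_fun_square_summable (R : realType) s l m1 m2 j :
  @ket_fun R s l m1 m2 j \in square_summable.
Proof.
have f0 (t : bool * label) :
    (0 <= (Normc.normc (@ket_fun R s l m1 m2 j t) ^+ 2)%:E)%E.
  by rewrite lee_fin sqr_ge0.
apply/asboolP.
have [[t0 ht0]|no] := pselect (exists t0 : bool * label,
    (t0.1 == s) && (label_val t0.2 == (l, m1, m2, j))).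
  rewrite (@esumID R _ [set t0] [set: bool * label] _ (fun t _ => f0 t)) !setTI esum_set1// esum1 ?adde0 ?ltry// => t tt0.
  rewrite /ket_fun; case: (boolP (_ && _)) => [|_]; last by rewrite Normc.normc0 expr0n.
  move: ht0 => /andP[/eqP h1 /eqP h2] /andP[/eqP h3 /eqP h4]; case: tt0.
  by apply: injective_projections; [rewrite h3|apply: val_inj; exact: etrans h4 (esym h2)].
rewrite esum1 ?ltry// => t _; rewrite /ket_fun; case: (boolP (_ && _)) => [ht|_].
  by case: no; exists t.
by rewrite Normc.normc0 expr0n.
Qed.

(** The basis vector |l, m1, m2; j>_s if (l, m1, m2, j) is in the index set,
    and 0 otherwise: terms with vectors outside the index set are omitted. *)
Definition ket {R : realType} (s : bool) (l m1 m2 j : rat) : spinor_space R :=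
  Ell2 (@ket_fun_square_summable R s l m1 m2 j).

Section Representation.
Variables (R : realType) (q : R).
Implicit Types (s : bool) (l j m x : rat).
Local Notation "r %:C" := (real_complex_def (Phant _) r) : ring_scope.

Definition qpow x : R := q `^ ratr x.
Definition qnum x : R := (qpow x - qpow (- x)) / (q - q^-1).

Definition eps l j m2 : rat :=
  if (l + 2^-1 - j - m2) / 2 \is a Num.nat then 2^-1 else - 2^-1.

Definition coefAp j m1 : R :=
  qpow (m1 - 1) * Num.sqrt (qnum (j + m1 + 1) * qnum (j - m1 + 1))
  / qnum (2 * j + 2).

Definition coefA0 j m1 : R :=
  qpow (-2) * ((qpow (j + m1 + 1) * qnum 2 * qnum (j - m1) - qnum (2 * j))
               / (qnum (2 * j) * qnum (2 * j + 2))).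

Definition coefBp j m1 : R :=
  qpow (- j + m1 - 2^-1) * Num.sqrt (qnum (j + m1 + 1) * qnum (j + m1 + 2))
  / qnum (2 * j + 2).

Definition coefB0 j m1 : R :=
  (1 + q ^+ 2) * qpow (m1 - 2^-1) * Num.sqrt (qnum (j - m1) * qnum (j + m1 + 1))
  / (qnum (2 * j) * qnum (2 * j + 2)).

Definition coefBm j m1 : R :=
  - qpow (j + m1 + 2^-1) * Num.sqrt (qnum (j - m1) * qnum (j - m1 - 1))
  / qnum (2 * j).

Definition coefCp l j m2 : R :=
  let e := eps l j m2 in
  - qpow (m2 - 1 - e)
  * Num.sqrt (qnum (l + j + m2 + 3 + e) * qnum (l + j - m2 + 3 - e))
  / qnum (2 * l + 4).

Definition coefC0 l j m2 : R :=
  let e := eps l j m2 in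
  qnum (4 * e) * qpow (2 * e * l + m2 - 1 + 3 * e)
  * Num.sqrt (qnum (l + 2^-1 + j - 2 * e * m2 + 2)
              * qnum (l + 2^-1 - j - 2 * e * m2))
  / (qnum (2 * l + 2) * qnum (2 * l + 4)).

Definition coefCm l j m2 : R :=
  let e := eps l j m2 in
  - qpow (m2 - 1 + e)
  * Num.sqrt (qnum (l - j + m2 - e) * qnum (l - j - m2 + e))
  / qnum (2 * l + 2).

Definition coefHp l j m2 : R :=
  let e := eps l j m2 in
  qpow (m2 - 1 + e * (2 * j + 1))
  * Num.sqrt (qnum (l + 2 * e * j - m2 + 2 + e)
              * qnum (l - 2 * e * j + m2 + 2 - e))
  / qnum (2 * l + 4).

Definition coefH0 l j m2 : R :=
  let e := eps l j m2 in
  (qnum (l - e * (2 * j + 1) - m2 + 1) * qnum (l - e * (2 * j + 1) + m2 + 2)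
   - qpow (-2) * (qnum (l + e * (2 * j + 1) - m2 + 2)
                  * qnum (l + e * (2 * j + 1) + m2 + 1)))
  / (qnum (2 * l + 2) * qnum (2 * l + 4)).

Definition coefDp l j m2 : R :=
  let e := eps l j m2 in
  qpow (- l + m2 - 3 / 2)
  * Num.sqrt (qnum (l + j + m2 + 3 + e) * qnum (l - j + m2 + 2 - e))
  / qnum (2 * l + 4).

Definition coefD0 l j m2 : R :=
  let e := eps l j m2 in
  qnum 2 * qpow (m2 + 2^-1)
  * Num.sqrt (qnum (l - 2 * e * j - m2 + 1 - e)
              * qnum (l - 2 * e * j + m2 + 2 - e))
  / (qnum (2 * l + 2) * qnum (2 * l + 4)).

Definition coefDm l j m2 : R :=
  let e := eps l j m2 in
  - qpow (l + m2 + 3 / 2)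
  * Num.sqrt (qnum (l - j - m2 + e) * qnum (l + j - m2 + 1 - e))
  / qnum (2 * l + 2).

Definition sgn s : R := if s then 1 else -1.

Definition x0_ket s l m1 m2 j : spinor_space R :=
  (coefAp j m1)%:C *:
    ((coefCp l j m2)%:C *: ket s (l + 1) m1 m2 (j + 1)
     - (sgn s * coefC0 l j m2)%:C *: ket s l m1 m2 (j + 1)
     + (coefCm l j m2)%:C *: ket s (l - 1) m1 m2 (j + 1))
  + (coefA0 j m1)%:C *:
    ((coefHp l j m2)%:C *: ket s (l + 1) m1 m2 j
     + (sgn s * coefH0 l j m2)%:C *: ket s l m1 m2 j
     + (coefHp (l - 1) j m2)%:C *: ket s (l - 1) m1 m2 j)
  + (coefAp (j - 1) m1)%:C *:
    ((coefCm (l + 1) (j - 1) m2)%:C *: ket s (l + 1) m1 m2 (j - 1)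
     - (sgn s * coefC0 l (j - 1) m2)%:C *: ket s l m1 m2 (j - 1)
     + (coefCp (l - 1) (j - 1) m2)%:C *: ket s (l - 1) m1 m2 (j - 1)).

Definition x1_ket s l m1 m2 j : spinor_space R :=
  (coefBp j m1)%:C *:
    ((coefCp l j m2)%:C *: ket s (l + 1) (m1 + 1) m2 (j + 1)
     - (sgn s * coefC0 l j m2)%:C *: ket s l (m1 + 1) m2 (j + 1)
     + (coefCm l j m2)%:C *: ket s (l - 1) (m1 + 1) m2 (j + 1))
  + (coefB0 j m1)%:C *:
    ((coefHp l j m2)%:C *: ket s (l + 1) (m1 + 1) m2 j
     + (sgn s * coefH0 l j m2)%:C *: ket s l (m1 + 1) m2 j
     + (coefHp (l - 1) j m2)%:C *: ket s (l - 1) (m1 + 1) m2 j)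
  + (coefBm j m1)%:C *:
    ((coefCm (l + 1) (j - 1) m2)%:C *: ket s (l + 1) (m1 + 1) m2 (j - 1)
     - (sgn s * coefC0 l (j - 1) m2)%:C *: ket s l (m1 + 1) m2 (j - 1)
     + (coefCp (l - 1) (j - 1) m2)%:C *: ket s (l - 1) (m1 + 1) m2 (j - 1)).

Definition x2_ket s l m1 m2 j : spinor_space R :=
  (coefDp l j m2)%:C *: ket s (l + 1) m1 (m2 + 1) j
  + (sgn s * coefD0 l j m2)%:C *: ket s l m1 (m2 + 1) j
  + (coefDm l j m2)%:C *: ket s (l - 1) m1 (m2 + 1) j.

(** [pi] is the direct sum of the two chiral representations. *)
Definition chiral_representation (A : algType R[i]) (star : A -> A)
    (x : 'I_3 -> A) (pi : A -> spinor_space R -> spinor_space R) : Prop :=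
  star_representation star pi /\
  forall s l m1 m2 j, is_label l m1 m2 j ->
    [/\ pi (x 0) (ket s l m1 m2 j) = x0_ket s l m1 m2 j,
        pi (x 1) (ket s l m1 m2 j) = x1_ket s l m1 m2 j &
        pi (x 2) (ket s l m1 m2 j) = x2_ket s l m1 m2 j].

End Representation.

(** * Dirac operator and real structure *)

Definition Dirac_eigenvalue {R : realType} (k : label) : R[i] :=
  let: (l, _, _, _) := label_val k in ratr (l + 3 / 2).

(** D |l, m1, m2; j>_s = (l + 3/2) |l, m1, m2; j>_{-s}, on its domain as a
    self-adjoint operator: all [v] for which the coordinates below are square
    summable. *)
Definition Dirac {R : realType} : graph R (bool * label)%type :=
  fun v w => forall (s : bool) (k : label),
    w (s, k) = Dirac_eigenvalue k * v (~~ s, k).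

(** 2l+1 and j+m1 are natural numbers when [is_label l m1 m2 j]. *)
Definition real_structure {R : realType} (J : spinor_space R -> spinor_space R) :
    Prop :=
  antilinear_isometry J /\
  forall s l m1 m2 j, is_label l m1 m2 j ->
    J (ket s l m1 m2 j) =
    ('i ^+ Num.truncn (2 * l + 1) * (-1) ^+ Num.truncn (j + m1)) *:
      ket s l (- m1) (- m2) j.

(** * Existence of |D| *)

Lemma esum_only (R : realType) (T : choiceType) (t0 : T) (f : T -> \bar R) :
  (forall t, (0 <= f t)%E) -> (forall t, t != t0 -> f t = 0%E) ->
  \esum_(t in [set: T]) f t = f t0.
Proof.
move=> f0 fz; rewrite (@esumID R _ [set t0] [set: T] _ (fun t _ => f0 t)).
rewrite !setTI esum_set1// [X in (_ + X)%E]esum1 ?adde0// => t /= /eqP.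
exact: fz.
Qed.

Lemma real_sum_only (R : realType) (T : choiceType) (t0 : T) (f : T -> R) :
  (forall t, t != t0 -> f t = 0) -> real_sum f = f t0.
Proof.
move=> fz; rewrite /real_sum.
rewrite (@esum_only _ _ t0) => [|t|t /fz ->]; last by rewrite maxxx.
rewrite (@esum_only _ _ t0) => [|t|t /fz ->]; last by rewrite oppr0 maxxx.
all: rewrite ?lee_fin ?le_max ?lexx ?orbT//=.
by case: (leP (f t0) 0); case: (leP (- f t0) 0); lra.
Qed.

Lemma real_sum_reindex (R : realType) (T : choiceType) (g : T -> T) (f : T -> R) :
  involutive g -> real_sum (fun t => f (g t)) = real_sum f.
Proof.
move=> gK.
have bg : set_bij [set: T] [set: T] g.
  split=> //; [by move=> x y _ _; exact: (can_inj gK)|].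
  by move=> x _; exists (g x).
by rewrite /real_sum; congr (fine _ - fine _);
  rewrite [RHS](@reindex_esum R _ _ _ _ _ _ bg).
Qed.

Lemma complex_sum_only (R : realType) (T : choiceType) (t0 : T) (f : T -> R[i]) :
  (forall t, t != t0 -> f t = 0) -> complex_sum f = f t0.
Proof.
move=> fz; rewrite /complex_sum !(@real_sum_only _ _ t0); first by case: (f t0).
all: by move=> t /fz ->.
Qed.

Lemma complex_sum_reindex (R : realType) (T : choiceType) (g : T -> T)
    (f : T -> R[i]) :
  involutive g -> complex_sum (fun t => f (g t)) = complex_sum f.
Proof.
move=> gK; congr Complex.
  exact: (@real_sum_reindex R T g (fun t => complex.Re (f t))).
exact: (@real_sum_reindex R T g (fun t => complex.Im (f t))).
Qed.

(** [Dirac_diag true] is D and [Dirac_diag false] is |D|. *)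
Definition Dirac_diag {R : realType} (e : bool) : graph R (bool * label)%type :=
  fun v w => forall s k, w (s, k) = Dirac_eigenvalue k * v (e (+) s, k).

Lemma Dirac_eigenvalue_ge0 (R : realType) k : 0 <= Dirac_eigenvalue k :> R[i].
Proof.
rewrite /Dirac_eigenvalue; case: k => [[[[l m1] m2] j]] /= /and5P[h _ _ _ _].
by rewrite ler0q; move: h => /(@natr_ge0 rat _); lra.
Qed.

Lemma inner_ket (R : realType) (c : R[i]) (s : bool) (k : label) (w : spinor_space R) :
  let: (l, m1, m2, j) := label_val k in
  inner (c *: ket s l m1 m2 j) w = c^* * w (s, k).
Proof.
case E : (label_val k) => [[[l m1] m2] j].
have cE t : (c *: ket s l m1 m2 j : spinor_space R) t = c * ket_fun s l m1 m2 j t by [].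
rewrite /inner (@complex_sum_only _ _ (s, k)) => [|t]; rewrite cE /ket_fun.
  by rewrite E !eqxx mulr1.
move=> tn; rewrite (_ : _ && _ = false) ?mulr0n ?mulr0 ?conjC0 ?mul0r//.
apply/negbTE; apply: contra tn => /andP[/eqP h1 /eqP h2].
by apply/eqP/injective_projections => //; apply: val_inj; exact: etrans h2 (esym E).
Qed.

Lemma Dirac_diag_ket (R : realType) e (s : bool) (k : label) :
  let: (l, m1, m2, j) := label_val k in
  Dirac_diag e (ket s l m1 m2 j) (Dirac_eigenvalue k *: ket (e (+) s) l m1 m2 j : spinor_space R).
Proof.
case E : (label_val k) => [[[l m1] m2] j] s' k'.
rewrite [LHS]/(Dirac_eigenvalue k * (@ket_fun R _ _ _ _ _ _)).
rewrite [X in _ = _ * X]/(@ket_fun R _ _ _ _ _ _) /ket_fun /=.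
rewrite -[mulc _ _]/(_ * _ : R[i]).
have [ek|_] := eqVneq (label_val k') (l, m1, m2, j);
  last by rewrite !andbF !mulr0n !mulr0.
have -> : k' = k by apply: val_inj; rewrite /= ek E.
by rewrite !andbT; case: e s s' => [] [] [].
Qed.

Lemma Dirac_diag_self_adjoint (R : realType) e : self_adjoint (@Dirac_diag R e).
Proof.
move=> v w; split.
- move=> hvw x y hxy; rewrite /inner.
  have gK : involutive (fun t : bool * label => (e (+) t.1, t.2)).
    by case=> s k /=; rewrite addKb.
  rewrite -(complex_sum_reindex _ gK); congr complex_sum; apply/funext => -[s k] /=.
  rewrite hxy hvw addKb rmorphM /= mulrCA mulrA; congr (_ * _).
  by congr (_ * _); apply/eqP; rewrite -CrealE ger0_real// Dirac_eigenvalue_ge0.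
- move=> h s k; have := @Dirac_diag_ket R e s k; have := @inner_ket R 1 s k w.
  have := @inner_ket R (Dirac_eigenvalue k) (e (+) s) k v.
  case E : (label_val k) => [[[l m1] m2] j] h1 h2 /h.
  rewrite h1 -[X in inner X w]scale1r h2 conjC1 mul1r => <-.
  by congr (_ * _); apply/eqP; rewrite -CrealE ger0_real// ?Dirac_eigenvalue_ge0.
Qed.

Lemma flip_square_summable (R : realType) (v : spinor_space R) :
  (fun t => v (~~ t.1, t.2)) \in @square_summable R (bool * label)%type.
Proof.
have /asboolP := coordP v => h; apply/asboolP; move: h.
have bg : set_bij [set: bool * label] [set: bool * label] (fun t => (~~ t.1, t.2)).
  split=> //; first by move=> [x k] [y k'] _ _ /= [] /(can_inj negbK) -> ->.
  by move=> [s k] _; exists (~~ s, k); rewrite //= negbK.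
by rewrite (@reindex_esum R _ _ _ _ _ _ bg).
Qed.

Lemma absolute_value_Dirac (R : realType) : absolute_value (@Dirac R) (Dirac_diag false).
Proof.
rewrite -[Dirac]/(Dirac_diag true); split; first exact: Dirac_diag_self_adjoint.
- move=> v w h; rewrite /inner /complex_sum.
  have e t : exists2 r : R, (v t)^* * w t = r%:C%C & 0 <= r.
    case: t => s k; rewrite h /= mulrCA [X in _ * X]mulrC.
    have : 0 <= Dirac_eigenvalue k * (v (s, k) * (v (s, k))^* ) by rewrite mulr_ge0 ?Dirac_eigenvalue_ge0 ?mul_conjC_ge0.
    case: (_ * _) => a b; rewrite lecE /= => /andP[/eqP -> a0].
    by exists a.
  rewrite lecE /=; apply/andP; split.
    apply/eqP; rewrite /real_sum !esum1 ?subrr// => t _; have [r -> _] := e t;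
    by rewrite /= ?oppr0 maxxx.
  rewrite /real_sum [X in _ - fine X]esum1 ?subr0; last first.
    by move=> t _; have [r -> r0] := e t; rewrite /= max_r// oppr_le0.
  by rewrite fine_ge0// esum_ge0// => t _; rewrite lee_fin le_max lexx orbT.
- move=> v w; split=> -[u h1 h2].
    exists (Ell2 (flip_square_summable u)).
      by move=> s k; exact: (h1 (~~ s) k).
    apply/Dirac_diag_self_adjoint => s k; rewrite h2; congr (_ * _).
    by rewrite /= negbK.
  exists (Ell2 (flip_square_summable u)).
    by move=> s k; have := h1 (~~ s) k; rewrite /= negbK.
  by move/Dirac_diag_self_adjoint : h2 => h2 s k; rewrite (h2 s k).
Qed.

(* Main.v *)
(* Write the labels in the coordinates d = l + 1/2 - j + m2, a = j + m1,
   b = j - m1, c = l + 1/2 - j - m2, which are natural numbers with sum 2l + 1.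
   Up to terms of order q^(2l), every generator of the algebra is a finite sum of
   weighted shifts of the following kind: for some k, the weight depends on the
   first k of the coordinates (d, a, b, c) only and is of order q to the power of
   their sum, while the shift moves the first k + 1 coordinates only. Such sums
   form a *-algebra. Conjugation by J reverses the coordinates, so J b J is of the
   same kind with respect to the order (c, b, a, d). The commutator of a shift
   of level k for the first order with a shift of level k' for the second one is
   of order q^(2l): for k + k' >= 4 the two weights together decay in all four
   coordinates, and for k + k' <= 3 the shifts commute except near the boundary
   of a common coordinate. As all shifts move the labels by a bounded amount and
   q^(2l) beats every power of l, the commutator is smoothing. Finally D is |D|
   followed by the exchange of the two chiralities, whose commutator with the
   algebra is smoothing, and [|D|, .] multiplies each shift by the constant by
   which it changes l; hence [D, a] is a sum of shifts of the same kind. *)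
Require Import Defs.
From mathcomp Require Import all_boot all_order all_algebra.
From mathcomp Require Import all_classical all_reals all_analysis.
From mathcomp Require Import complex ring lra zify.

Set Implicit Arguments.
Unset Strict Implicit.
Unset Printing Implicit Defensive.
Import Order.TTheory GRing.Theory Num.Theory.
Local Open Scope classical_set_scope.
Local Open Scope ring_scope.

(** * Square-summable families *)

(** The order (d, a, b, c) is read off the leading terms: D^+ tends to 1 and moves d, B^+ C^+ is of
    order q^d and moves a, B^- C^+ is of order q^(d + 2a) and moves b, D^- is of order q^(2d + a +
    b) and moves c. Apart from A^0 and H^0, each coefficient is a constant times a power of q times
    factors sqrt(1 - q^(2n)) and 1 / (1 - q^(2n)), where n is a sum of coordinates up to a bounded
    amount. Such a factor is 1 + O(q^n); inserting the factors in order of the coordinates they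
    involve telescopes a coefficient into weights of increasing level and a remainder of order
    q^(2l). The obstacle is the boundary of the index set. Shifts of Z^4 compose freely, but a
    product of operators loses the paths whose middle point is not a label. This disturbs products
    as well as commutators; in both cases the defect sits where one more coordinate is bounded,
    which makes up for the missing decay in it. Since [absD] is any absolute value of D, it must
    also be identified with the diagonal operator. *)

Section Ell2.
Variables (R : realType) (T : choiceType).
Implicit Types (f g : T -> R) (u v w : ell2 R T).
Notation normc := Normc.normc.

Lemma normc_ge0 (x : R[i]) : 0 <= normc x.
Proof. by case: x => a b /=; exact: sqrtr_ge0. Qed.

Lemma normc_sqr (x : R[i]) :
  normc x ^+ 2 = complex.Re x ^+ 2 + complex.Im x ^+ 2.
Proof. by case: x => a b /=; rewrite sqr_sqrtr// addr_ge0 ?sqr_ge0. Qed.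

Definition abs_summable f := (\esum_(t in [set: T]) (`|f t|%R)%:E < +oo)%E.

Lemma le_abs_summable f g :
  (forall t, `|f t| <= g t) -> (\esum_(t in [set: T]) (g t)%:E < +oo)%E ->
  abs_summable f.
Proof.
by move=> fg; apply: le_lt_trans; apply: le_esum => t _; rewrite lee_fin.
Qed.

Lemma pos_part_fin f : abs_summable f ->
  \esum_(t in [set: T]) (Num.max (f t) 0)%:E \is a fin_num.
Proof.
move=> fs; rewrite ge0_fin_numE; last first.
  by apply: esum_ge0 => t _; rewrite lee_fin le_max lexx orbT.
apply: le_lt_trans fs; apply: le_esum => t _.
by rewrite lee_fin ge_max ler_norm normr_ge0.
Qed.

Lemma abs_summableN f : abs_summable f -> abs_summable (fun t => - f t).
Proof.
by apply: le_lt_trans; apply: le_esum => t _; rewrite normrN.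
Qed.

Lemma abs_summableD f g : abs_summable f -> abs_summable g ->
  abs_summable (fun t => f t + g t).
Proof.
move=> fs gs.
apply: (@le_abs_summable _ (fun t => `|f t| + `|g t|)) => [t|].
  exact: ler_normD.
under eq_esum do rewrite EFinD.
by rewrite esumD ?lte_add_pinfty// => t _; rewrite lee_fin.
Qed.

(** [fine] is additive on finite values only, so the identity (f+g)^+ + f^- + g^- = (f+g)^- + f^+ +
    g^+ is summed in the extended reals, with additions only, and then made real. *)
Lemma real_sumD f g : abs_summable f -> abs_summable g ->
  real_sum (fun t => f t + g t) = real_sum f + real_sum g.
Proof.
move=> fs gs; have fgs := abs_summableD fs gs.
have P h : abs_summable h -> [/\
    \esum_(t in [set: T]) (Num.max (h t) 0)%:E \is a fin_num &
    \esum_(t in [set: T]) (Num.max (- h t) 0)%:E \is a fin_num].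
  by move=> hs; split; apply: pos_part_fin => //; exact: abs_summableN.
have [f1 f2] := P _ fs; have [g1 g2] := P _ gs; have [h1 h2] := P _ fgs.
have m0 (h : T -> R) t : (0 <= (Num.max (h t) 0)%:E)%E.
  by rewrite lee_fin le_max lexx orbT.
have E : (\esum_(t in [set: T]) (Num.max (f t + g t) 0)%:E +
          (\esum_(t in [set: T]) (Num.max (- f t) 0)%:E +
           \esum_(t in [set: T]) (Num.max (- g t) 0)%:E) =
          \esum_(t in [set: T]) (Num.max (- (f t + g t)) 0)%:E +
          (\esum_(t in [set: T]) (Num.max (f t) 0)%:E +
           \esum_(t in [set: T]) (Num.max (g t) 0)%:E))%E.
  rewrite -!esumD; do ?by move=> t _; rewrite -?EFinD lee_fin ?addr_ge0 ?le_max ?lexx ?orbT.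
  apply: eq_esum => t _; rewrite -!EFinD; congr (_%:E).
    have mx (x : R) : Num.max x 0 = x + Num.max (- x) 0.
      by case: (leP x 0); case: (leP (- x) 0); lra.
    by rewrite (mx (f t)) (mx (g t)) (mx (f t + g t)); ring.
have := congr1 fine E.
rewrite !fineD ?fin_numD ?f1 ?f2 ?g1 ?g2 ?h1 ?h2// /real_sum.
lra.
Qed.

Lemma real_sumN f : real_sum (fun t => - f t) = - real_sum f.
Proof.
rewrite /real_sum opprB; congr (_ - fine _).
by apply: eq_esum => t _; rewrite opprK.
Qed.

Lemma ge0_esumZ (c : R) f : 0 <= c -> (forall t, 0 <= f t) ->
  (\esum_(t in [set: T]) (c * f t)%:E =
   c%:E * \esum_(t in [set: T]) (f t)%:E)%E.
Proof.
have H (k : R) (h : T -> R) : 0 <= k -> (forall t, 0 <= h t) ->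
    (\esum_(t in [set: T]) (k * h t)%:E <=
     k%:E * \esum_(t in [set: T]) (h t)%:E)%E.
  move=> k0 h0; apply: ge_ereal_sup => _ [F [Ffin FT] <-].
  have -> : (\sum_(t \in F) (k * h t)%:E = k%:E * \sum_(t \in F) (h t)%:E)%E.
    by rewrite ge0_mule_fsumr// => i; rewrite lee_fin.
  by rewrite lee_wpmul2l ?lee_fin//; apply: ereal_sup_ubound; exists F.
move=> c0 f0; apply/eqP; rewrite eq_le H//=.
have [->|cn0] := eqVneq c 0.
  by rewrite mul0e; apply: esum_ge0 => t _; rewrite mul0r.
have cp : 0 < c by rewrite lt_def cn0.
rewrite -[leRHS]mul1e -(mulfV cn0) EFinM -muleA lee_wpmul2l ?lee_fin//.
(* The reverse inequality is [H] for the factor c^-1 and the family c f. *)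
apply: le_trans (H c^-1 (fun t => c * f t) _ _).
- by apply: le_esum => t _; rewrite mulrA mulVf// mul1r.
- by rewrite invr_ge0.
- by move=> t; rewrite mulr_ge0.
Qed.

Lemma real_sumZ (c : R) f : real_sum (fun t => c * f t) = c * real_sum f.
Proof.
have H (k : R) (h : T -> R) : 0 <= k -> real_sum (fun t => k * h t) = k * real_sum h.
  move=> k0; rewrite /real_sum.
  have E (h' : T -> R) : \esum_(t in [set: T]) (Num.max (k * h' t) 0)%:E =
      (k%:E * \esum_(t in [set: T]) (Num.max (h' t) 0)%:E)%E.
    rewrite -ge0_esumZ//; last by move=> t; rewrite le_max lexx orbT.
    by apply: eq_esum => t _; rewrite maxr_pMr// mulr0.
  (* [fine] sends both infinities to 0, hence commutes with scaling even when the sum diverges. *)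
  have F (x : \bar R) : fine (k%:E * x) = k * fine x.
    by case: x => [r| |]//=; rewrite mulr0 /mule/=; do !case: ifP.
  under [X in _ - fine X]eq_esum do rewrite -mulrN.
  by rewrite (E h) (E (fun t => - h t)) !F mulrBr.
have [c0|c0] := leP 0 c; first exact: H.
rewrite -[c]opprK mulNr -H ?oppr_ge0 ?ltW// -real_sumN.
by congr real_sum; apply/funext => t; rewrite !mulNr opprK.
Qed.

Lemma inner_summable u v (p : R[i] -> R) :
  (forall x y, `|p (x^* * y)| <= normc x ^+ 2 + normc y ^+ 2) ->
  abs_summable (fun t => p ((u t)^* * v t)).
Proof.
move=> hp.
apply: (@le_abs_summable _ (fun t => normc (u t) ^+ 2 + normc (v t) ^+ 2)) => //.
under eq_esum do rewrite EFinD.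
rewrite esumD; do ?by move=> t _; rewrite lee_fin sqr_ge0.
have /asboolP hu := coordP u; have /asboolP hv := coordP v.
exact: lte_add_pinfty.
Qed.

Lemma Re_inner_summable u v :
  abs_summable (fun t => complex.Re ((u t)^* * v t)).
Proof.
apply: inner_summable => -[a b] [c d]; rewrite !normc_sqr /= ler_norml.
have := sqr_ge0 (a - c); have := sqr_ge0 (b - d).
have := sqr_ge0 (a + c); have := sqr_ge0 (b + d).
have := sqr_ge0 a; have := sqr_ge0 b; have := sqr_ge0 c; have := sqr_ge0 d.
by move=> *; apply/andP; split; lra.
Qed.

Lemma Im_inner_summable u v :
  abs_summable (fun t => complex.Im ((u t)^* * v t)).
Proof.
apply: inner_summable => -[a b] [c d]; rewrite !normc_sqr /= ler_norml.
have := sqr_ge0 (a - d); have := sqr_ge0 (b - c).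
have := sqr_ge0 (a + d); have := sqr_ge0 (b + c).
have := sqr_ge0 a; have := sqr_ge0 b; have := sqr_ge0 c; have := sqr_ge0 d.
by move=> *; apply/andP; split; lra.
Qed.

Lemma ReD (x y : R[i]) : complex.Re (x + y) = complex.Re x + complex.Re y.
Proof. by case: x; case: y. Qed.

Lemma ImD (x y : R[i]) : complex.Im (x + y) = complex.Im x + complex.Im y.
Proof. by case: x; case: y. Qed.

Lemma innerDr u v w : inner u (v + w) = inner u v + inner u w.
Proof.
rewrite /inner /complex_sum -[RHS]/(Complex (_ + _) (_ + _)); congr Complex.
  rewrite -(real_sumD (Re_inner_summable u v) (Re_inner_summable u w)).
  congr real_sum; apply/funext => t.
  by rewrite -ReD -mulrDr.
rewrite -(real_sumD (Im_inner_summable u v) (Im_inner_summable u w)).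
congr real_sum; apply/funext => t.
by rewrite -ImD -mulrDr.
Qed.

Lemma innerDl u v w : inner (u + v) w = inner u w + inner v w.
Proof.
rewrite /inner /complex_sum -[RHS]/(Complex (_ + _) (_ + _)); congr Complex.
  rewrite -(real_sumD (Re_inner_summable u w) (Re_inner_summable v w)).
  congr real_sum; apply/funext => t.
  by rewrite -ReD -mulrDl -rmorphD.
rewrite -(real_sumD (Im_inner_summable u w) (Im_inner_summable v w)).
congr real_sum; apply/funext => t.
by rewrite -ImD -mulrDl -rmorphD.
Qed.

(** Scalars are real here: this covers the eigenvalues of D and the coefficients of the
    generators. *)
Lemma innerZr (c : R) u v : inner u (Complex c 0 *: v) = Complex c 0 * inner u v.
Proof.
have E t : (u t)^* * (Complex c 0 *: v : ell2 R T) t = Complex c 0 * ((u t)^* * v t).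
  by rewrite -[LHS]/(_ * (Complex c 0 * v t)) mulrCA.
have ReZ (x : R[i]) : complex.Re (Complex c 0 * x) = c * complex.Re x.
  by case: x => a b /=; rewrite mul0r subr0.
have ImZ (x : R[i]) : complex.Im (Complex c 0 * x) = c * complex.Im x.
  by case: x => a b /=; rewrite mul0r addr0.
rewrite /inner /complex_sum; apply/eqP; rewrite eq_complex ReZ ImZ /=.
by rewrite -!real_sumZ; apply/andP; split; apply/eqP;
  congr real_sum; apply/funext => t; rewrite E ?ReZ ?ImZ.
Qed.

Lemma innerZl (c : R) u v : inner (Complex c 0 *: u) v = Complex c 0 * inner u v.
Proof.
rewrite -innerZr /inner; congr complex_sum; apply/funext => t.
rewrite -[LHS]/((Complex c 0 * u t)^* * v t) -[RHS]/(_ * (Complex c 0 * v t)).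
rewrite rmorphM [X in X * _ * _](_ : _ = Complex c 0) -?mulrA 1?mulrCA//.
by apply/eqP; rewrite eq_complex /= oppr0 !eqxx.
Qed.

Definition normsq (f : T -> R[i]) : \bar R :=
  \esum_(t in [set: T]) (normc (f t) ^+ 2)%:E.

Lemma normsq_ge0 (f : T -> R[i]) : (0 <= normsq f)%E.
Proof. by apply: esum_ge0 => t _; rewrite lee_fin sqr_ge0. Qed.

Lemma normsq_fin u : normsq u \is a fin_num.
Proof. by rewrite ge0_fin_numE ?normsq_ge0//; have /asboolP := coordP u. Qed.

(** The effect of changing one coordinate, in additive form because the families may have infinite
    norm. [JE] compares norms by it. *)
Lemma normsq_update (f g : T -> R[i]) t0 : (forall t, t != t0 -> f t = g t) ->
  (normsq f + (normc (g t0) ^+ 2)%:E = normsq g + (normc (f t0) ^+ 2)%:E)%E.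
Proof.
move=> fg; have h (h : T -> R[i]) t : (0 <= (normc (h t) ^+ 2)%:E)%E.
  by rewrite lee_fin sqr_ge0.
rewrite /normsq !(esumID [set t0] [set: T])// !setTI !esum_set1//.
rewrite (@eq_esum _ _ (~` [set t0]) (fun t => (normc (f t) ^+ 2)%:E)
  (fun t => (normc (g t) ^+ 2)%:E)); last by move=> t /= /eqP /fg ->.
by rewrite addeAC [RHS]addeAC; congr (_ + _)%E; rewrite addeC.
Qed.

Lemma le_normsq (f : T -> R[i]) t0 : ((normc (f t0) ^+ 2)%:E <= normsq f)%E.
Proof.
have h t : (0 <= (normc (f t) ^+ 2)%:E)%E by rewrite lee_fin sqr_ge0.
rewrite /normsq (esumID [set t0])// setTI esum_set1// leeDl//.
by apply: esum_ge0.
Qed.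

(** A positive operator has no negative eigenvalue: the hypotheses say that - c ||u||^2 is
    nonnegative. *)
Lemma inner_self_le0 u w (c : R) : 0 < c ->
  (forall t, w t = - (Complex c 0 * u t)) -> 0 <= inner u w ->
  forall t, u t = 0.
Proof.
move=> c0 wu; rewrite /inner /complex_sum lecE /= => /andP[_].
have -> : real_sum (fun t => complex.Re ((u t)^* * w t)) =
    real_sum (fun t => (- c) * normc (u t) ^+ 2).
  congr real_sum; apply/funext => t; rewrite wu normc_sqr.
  by case: (u t) => a b /=; lra.
rewrite real_sumZ => h.
have E : real_sum (fun t => normc (u t) ^+ 2) = fine (normsq u).
  rewrite /real_sum [X in _ - fine X]esum1 ?subr0; last first.
    by move=> t _; rewrite max_r// oppr_le0 sqr_ge0.
  by congr fine; apply: eq_esum => t _; rewrite max_l// sqr_ge0.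
have {}h : fine (normsq u) <= 0 by rewrite -E -(pmulr_lle0 _ c0); lra.
move=> t; apply/Normc.eq0_normc/eqP; rewrite -sqrf_eq0 eq_le sqr_ge0 andbT.
rewrite (le_trans _ h)// -lee_fin fineK ?normsq_fin//; exact: le_normsq.
Qed.

End Ell2.

(** * Uniqueness of the absolute value of D *)

Section Basis.
Variable R : realType.
Notation H := (spinor_space R).
Notation normc := Normc.normc.
Implicit Types (t : bool * label) (u v w : H).

Definition bvec t : H :=
  let: (l, m1, m2, j) := label_val t.2 in ket t.1 l m1 m2 j.

Lemma ell2P u v : (forall t, u t = v t) -> u = v.
Proof. by move=> uv; apply: val_inj; exact/funext. Qed.

Lemma ell2D u v t : (u + v) t = u t + v t. Proof. by []. Qed.
Lemma ell2N u t : (- u) t = - u t. Proof. by []. Qed.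
Lemma ell2B u v t : (u - v) t = u t - v t. Proof. by []. Qed.
Lemma ell2Z (c : R[i]) u t : (c *: u) t = c * u t. Proof. by []. Qed.
Lemma ell20 t : (0 : H) t = 0. Proof. by []. Qed.

Lemma bvecE t t' : bvec t t' = (t' == t)%:R.
Proof.
rewrite /bvec; case E : (label_val t.2) => [[[l m1] m2] j].
rewrite [LHS]/(ket_fun _ _ _ _ _ _) /ket_fun -E; case: t t' E => [s k] [s' k'] _ /=.
by rewrite xpair_eqE -val_eqE.
Qed.

Lemma inner_bvec t v (c : R[i]) : inner (c *: bvec t) v = c^* * v t.
Proof.
rewrite /inner (@complex_sum_only _ _ t) => [|t' /negbTE tt']; rewrite ell2Z bvecE.
  by rewrite eqxx mulr1.
by rewrite tt' mulr0 conjC0 mul0r.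
Qed.

Lemma inner_bvec1 t v : inner (bvec t) v = v t.
Proof. by rewrite -[bvec t]scale1r inner_bvec conjC1 mul1r. Qed.

Lemma Dirac_eigenvalueE k : exists2 c : R, 0 < c & Dirac_eigenvalue k = Complex c 0.
Proof.
rewrite /Dirac_eigenvalue; case: k => [[[[l m1] m2] j]] /= /and5P[h _ _ _ _].
exists (ratr (l + 3 / 2)).
  by rewrite ltr0q; move: h => /(@natr_ge0 rat _); lra.
by rewrite -(fmorph_rat (real_complex R)).
Qed.

Lemma Dirac_diag_bvec e t : Dirac_diag e (bvec t)
  (Dirac_eigenvalue t.2 *: bvec (e (+) t.1, t.2)).
Proof.
case: t => s k; have := @Dirac_diag_ket R e s k; rewrite /bvec /=.
by case: (label_val k) => [[[l m1] m2] j].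
Qed.

(* For a basis vector e with D^2 e = c^2 e, the vector z = |D| e - c e satisfies
   |D| z = - c z, hence z = 0 by positivity. *)
Lemma absolute_value_Dirac_unique (absD : graph R (bool * label)%type) :
  absolute_value Dirac absD -> absD = Dirac_diag false.
Proof.
case=> sa pos sq.
(* A self-adjoint graph coincides with its adjoint, whose defining condition is linear; the
   linearity of [absD] comes from this. *)
have lin v w v' w' (c : R) : absD v w -> absD v' w' ->
    absD (v + Complex c 0 *: v') (w + Complex c 0 *: w').
  move=> /sa h /sa h'; apply/sa => x y xy.
  by rewrite !innerDr !innerZr (h _ _ xy) (h' _ _ xy).
have key t : absD (bvec t) (Dirac_eigenvalue t.2 *: bvec t).
  have [c c0 cE] := Dirac_eigenvalueE t.2.
  have : graph_comp absD absD (bvec t)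
      (Dirac_eigenvalue t.2 *: (Dirac_eigenvalue t.2 *: bvec t)).
    apply/sq; exists (Dirac_eigenvalue t.2 *: bvec (true (+) t.1, t.2)).
      exact: (@Dirac_diag_bvec true).
    apply/(@Dirac_diag_self_adjoint _ true) => s k.
    have := @Dirac_diag_bvec true (true (+) t.1, t.2) s k.
    rewrite !ell2Z => E; rewrite [RHS]mulrCA -E /= negbK -[(t.1, t.2)]surjective_pairing.
    by [].
  rewrite cE => -[u h1 h2].
  suff <- : u = Complex c 0 *: bvec t by [].
  have z0 := inner_self_le0 c0 _ (pos _ _ (lin _ _ _ _ (- c) h2 h1)).
  apply: ell2P => t'; apply/eqP; rewrite -subr_eq0; apply/eqP.
  have N : Complex (- c) 0 = - Complex c 0 by apply/eqP; rewrite eq_complex /= oppr0 !eqxx.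
  rewrite -[RHS](z0 _ t') => [|t0]; rewrite !ell2D !ell2Z N; ring.
(* Self-adjointness, tested on the eigenvectors found in [key], reads off each coordinate of w. *)
have sub v w : absD v w -> Dirac_diag false v w.
  move=> h s k; have [c c0 cE] := Dirac_eigenvalueE k.
  have := sa v w; case=> /(_ h) /(_ _ _ (key (s, k))) + _.
  rewrite inner_bvec inner_bvec1 /= cE => <-; congr (_ * _).
  by apply/eqP; rewrite eq_complex /= oppr0 !eqxx.
(* Self-adjoint graphs are maximal: the symmetry of [Dirac_diag] puts its graph into the adjoint of
   the smaller graph [absD], which is [absD] itself. *)
apply/funext => v; apply/funext => w; apply/propext; split; first exact: sub.
move=> h; apply/sa => x y /sub xy.
by apply: (@Dirac_diag_self_adjoint _ false _ _).1.
Qed.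

End Basis.

(** * Weighted shifts on labels *)

Notation pt := {ffun 'I_4 -> int}.

Definition i0 : 'I_4 := Ordinal (isT : (0 < 4)%N).
Definition i1 : 'I_4 := Ordinal (isT : (1 < 4)%N).
Definition i2 : 'I_4 := Ordinal (isT : (2 < 4)%N).
Definition i3 : 'I_4 := Ordinal (isT : (3 < 4)%N).

Lemma ord4P (P : 'I_4 -> Prop) : P i0 -> P i1 -> P i2 -> P i3 -> forall i, P i.
Proof.
move=> h0 h1 h2 h3 [[|[|[|[|//]]]] hi].
- by rewrite (_ : Ordinal hi = i0)//; exact: val_inj.
- by rewrite (_ : Ordinal hi = i1)//; exact: val_inj.
- by rewrite (_ : Ordinal hi = i2)//; exact: val_inj.
- by rewrite (_ : Ordinal hi = i3)//; exact: val_inj.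
Qed.

(* A point lists (d, a, b, c) = (l + 1/2 - j + m2, j + m1, j - m1,
   l + 1/2 - j - m2): labels are the points with natural coordinates and odd
   a + b and c + d, and J reverses the order of the coordinates. *)
Definition unpos (p : pt) : rat * rat * rat * rat :=
  ((((p i0)%:~R + (p i1)%:~R + (p i2)%:~R + (p i3)%:~R - 1) / 2,
    ((p i1)%:~R - (p i2)%:~R) / 2), ((p i0)%:~R - (p i3)%:~R) / 2,
    ((p i1)%:~R + (p i2)%:~R) / 2).

Definition good (p : pt) : bool :=
  [&& [forall i, 0 <= p i], ((p i0 + p i3) %% 2)%Z == 1 &
      ((p i1 + p i2) %% 2)%Z == 1].

(** Shifts of this kind preserve the parity conditions on labels, so only the signs of the
    coordinates decide whether the target is a label. *)
Definition even_pt (p : pt) : bool :=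
  (((p i0 + p i3) %% 2)%Z == 0) && (((p i1 + p i2) %% 2)%Z == 0).

Lemma ratz_inj (x y : int) : x%:~R = y%:~R :> rat -> x = y.
Proof. by move/eqP; rewrite eqr_int => /eqP. Qed.

Lemma unpos_inj : injective unpos.
Proof.
move=> p p' [] h1 h2 h3 h4; apply/ffunP.
by apply: ord4P; apply: ratz_inj; lra.
Qed.

Lemma unpos_surj (l m1 m2 j : rat) : is_label l m1 m2 j ->
  exists2 p, good p & unpos p = (l, m1, m2, j).
Proof.
case/and5P => /natrP[n1 h1] /natrP[n2 h2] jl /natrP[n3 h3] /natrP[n4 h4].
have [a [b [ha hb]]] : exists a b : int, a%:~R = j + m1 /\ b%:~R = j - m1.
  have [m0|m0] := leP 0 m1; move: h3.
    rewrite ger0_norm// => h3; exists ((n2 * 2 + 1)%:Z - n3%:Z), n3%:Z.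
    by rewrite !rmorphB /= -!pmulrn natrD natrM; split; lra.
  rewrite ltr0_norm// => h3; exists n3%:Z, ((n2 * 2 + 1)%:Z - n3%:Z).
  by rewrite !rmorphB /= -!pmulrn natrD natrM; split; lra.
have [d [c [hd hc]]] : exists d c : int,
    d%:~R = l + 2^-1 - j + m2 /\ c%:~R = l + 2^-1 - j - m2.
  have [m0|m0] := leP 0 m2; move: h4.
    rewrite ger0_norm// => h4.
    exists (n1%:Z * 2 - n2%:Z * 2 + 1 - n4%:Z), n4%:Z.
    by rewrite !(rmorphB, rmorphD, rmorphM) /= -!pmulrn; split; lra.
  rewrite ltr0_norm// => h4.
  exists n4%:Z, (n1%:Z * 2 - n2%:Z * 2 + 1 - n4%:Z).
  by rewrite !(rmorphB, rmorphD, rmorphM) /= -!pmulrn; split; lra.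
exists [ffun i : 'I_4 => nth 0 [:: d; a; b; c] i]; last first.
  rewrite /unpos !ffunE /= ha hb hc hd.
  by congr (_, _, _, _); lra.
rewrite /good !ffunE /=.
have ab : a + b = n2%:Z * 2 + 1.
  apply: ratz_inj; rewrite !(rmorphD, rmorphM) /= -!pmulrn; lra.
have dc : d + c = (n1%:Z - n2%:Z) * 2 + 1.
  apply: ratz_inj; rewrite !(rmorphB, rmorphD, rmorphM) /= -!pmulrn; lra.
have n30 := ler0n rat n3; have n40 := ler0n rat n4.
have := ler_norm m1; have := ler_norm (- m1); rewrite normrN => hm1 hm1'.
have := ler_norm m2; have := ler_norm (- m2); rewrite normrN => hm2 hm2'.
have [pd pa pb pc] : [/\ 0 <= d%:~R :> rat, 0 <= a%:~R :> rat, 0 <= b%:~R :> rat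
    & 0 <= c%:~R :> rat] by rewrite ha hb hc hd; split; lra.
move: pd pa pb pc; rewrite !ler0z => pd pa pb pc.
by apply/and3P; split; [apply/forallP; apply: ord4P; rewrite ffunE|lia|lia].
Qed.

Lemma good_unpos p : good p ->
  let: (l, m1, m2, j) := unpos p in is_label l m1 m2 j.
Proof.
case/and3P => /forallP h0 h1 h2.
move: (h0 i0) (h0 i1) (h0 i2) (h0 i3) h1 h2; rewrite /unpos.
case: (p i0) => // d _; case: (p i1) => // a _; case: (p i2) => // b _.
case: (p i3) => // c _ h1 h2; rewrite -!pmulrn.
have [x hx] : exists x, (d + c = x * 2 + 1)%N by exists ((d + c) %/ 2)%N; lia.
have [y hy] : exists y, (a + b = y * 2 + 1)%N by exists ((a + b) %/ 2)%N; lia.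
have := congr1 (fun n => n%:R : rat) hx; have := congr1 (fun n => n%:R : rat) hy.
rewrite !natrD !natrM => {}hy {}hx.
have x0 := ler0n rat x.
rewrite /is_label; apply/and5P; split.
- by apply/natrP; exists (x + y)%N; rewrite natrD; lra.
- by apply/natrP; exists y; lra.
- lra.
- apply/natrP; have [ab|ab] := leP (b%:R : rat) a%:R.
    by exists b; rewrite ger0_norm; lra.
  by exists a; rewrite ltr0_norm; lra.
- apply/natrP; have [ab|ab] := leP (c%:R : rat) d%:R.
    by exists c; rewrite ger0_norm; lra.
  by exists d; rewrite ltr0_norm; lra.
Qed.

Lemma pos_subproof (k : label) : exists p, good p /\ unpos p = label_val k.
Proof.
by case: k => [[[[l m1] m2] j]] /= /unpos_surj[p hp pE]; exists p.
Qed.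

Definition pos (k : label) : pt := projT1 (cid (pos_subproof k)).

Lemma good_pos k : good (pos k).
Proof. by rewrite /pos; case: cid => p /= []. Qed.

Lemma unpos_pos k : unpos (pos k) = label_val k.
Proof. by rewrite /pos; case: cid => p /= []. Qed.

Lemma pos_inj : injective pos.
Proof.
by move=> k k' h; apply: val_inj; rewrite /= -!unpos_pos h.
Qed.

Lemma goodP p : reflect (exists k, p = pos k) (good p).
Proof.
apply: (iffP idP) => [/good_unpos h|[k ->]]; last exact: good_pos.
by exists (@Label (unpos p) h); apply: unpos_inj; rewrite unpos_pos.
Qed.

Lemma good_add p s : even_pt s -> good p ->
  good (p + s) = [forall i, 0 <= (p + s) i].
Proof.
rewrite /good /even_pt !ffunE => /andP[s1 s2] /and3P[_ p1 p2].
have -> : ((p i0 + s i0 + (p i3 + s i3)) %% 2)%Z == 1 by lia.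
have -> : ((p i1 + s i1 + (p i2 + s i2)) %% 2)%Z == 1 by lia.
by rewrite !andbT.
Qed.

(** * Finite sums of weighted shifts *)

Section Bands.
Variable R : realType.
Notation H := (spinor_space R).
Notation C := R[i].
Notation V := (bool * label -> C).
Notation normc := Normc.normc.
Implicit Types (v w : V) (s : bool) (p : pt) (k : label).

(** Vectors are extended by zero to all of Z^4, so that terms outside the index set drop out by
    themselves. *)
Definition ext v s p : C :=
  if (insub (unpos p) : option label) is Some k then v (s, k) else 0.

Lemma ext_pos v s k : ext v s (pos k) = v (s, k).
Proof. by rewrite /ext unpos_pos valK. Qed.

Lemma ext_bad v s p : ~~ good p -> ext v s p = 0.
Proof.
rewrite /ext; case: insubP => // k _ kE /goodP[]; exists k.
by apply: unpos_inj; rewrite unpos_pos.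
Qed.

Lemma ext_linear (c : C) v w s p :
  ext (fun t => c * v t + w t) s p = c * ext v s p + ext w s p.
Proof. by rewrite /ext; case: insub => //; rewrite mulr0 addr0. Qed.

(* Weighted shifts; the weights are indexed by the target of the shift. *)
Record term := Term {
  tflip : bool;
  tshift : pt;
  tcoef : bool -> pt -> C }.
Implicit Types (x y : term) (P Q Z : term -> Prop) (A B : V -> V).

Definition act x : V -> V := fun v t =>
  tcoef x t.1 (pos t.2) * ext v (tflip x (+) t.1) (pos t.2 + tshift x).

(** Finite sums of shifts up to pointwise equality, acting on arbitrary families rather than
    square-summable ones: sums and products then raise no question of convergence. *)
Inductive band P : (V -> V) -> Prop :=
| band_nil A : (forall v t, A v t = 0) -> band P A
| band_cons x A B : P x -> band P A ->
    (forall v t, B v t = act x v t + A v t) -> band P B.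

Lemma eq_band P A B : (forall v t, A v t = B v t) -> band P A -> band P B.
Proof.
move=> AB bA; case: bA B AB => [A' h|x A' B' h1 h2 h3] B AB.
  by apply: band_nil => v t; rewrite -AB.
by apply: (band_cons h1 h2) => v t; rewrite -AB.
Qed.

Lemma band1 P x A : P x -> (forall v t, A v t = act x v t) -> band P A.
Proof.
move=> Px Ax; apply: (band_cons Px (@band_nil P (fun _ _ => 0) _)) => // v t.
by rewrite addr0.
Qed.

Lemma band_add P A B : band P A -> band P B ->
  band P (fun v t => A v t + B v t).
Proof.
move=> bA bB; elim: bA => [A' h|x A' B' h1 h2 h3 h4].
  by apply: eq_band bB => v t; rewrite h add0r.
by apply: (band_cons h1 h3) => v t; rewrite h4 addrA.
Qed.

Lemma band_sub P Q A : (forall x, P x -> band Q (act x)) -> band P A -> band Q A.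
Proof.
move=> PQ; elim=> [A' h|x A' B' /PQ h1 h2 h3 h4]; first exact: band_nil.
by apply: eq_band (band_add h1 h3) => v t; rewrite h4.
Qed.

Lemma band_subset P Q A : (forall x, P x -> Q x) -> band P A -> band Q A.
Proof. by move=> PQ; apply: band_sub => x /PQ h; exact: (band1 h). Qed.

Lemma act_linear x (c : C) v w t :
  act x (fun t => c * v t + w t) t = c * act x v t + act x w t.
Proof. by rewrite /act ext_linear mulrDr mulrCA. Qed.

Lemma actD x v w t : act x (fun t => v t + w t) t = act x v t + act x w t.
Proof.
rewrite -[X in X + _]mul1r -act_linear; congr act; apply/funext => t'.
by rewrite mul1r.
Qed.

Lemma act0 x t : act x (fun=> 0) t = 0.
Proof. by rewrite /act /ext; case: insub; rewrite ?mulr0. Qed.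

Lemma band_linear P A : band P A -> forall (c : C) v w t,
  A (fun t => c * v t + w t) t = c * A v t + A w t.
Proof.
elim=> [A' h c v w t|x A' B' _ _ IH h c v w t]; first by rewrite !h mulr0 addr0.
by rewrite !h IH act_linear; ring.
Qed.

Lemma bandD P A v w t : band P A -> A (fun t => v t + w t) t = A v t + A w t.
Proof.
move=> /band_linear/(_ 1 v w t); rewrite mul1r => <-; congr A.
by apply/funext => t'; rewrite mul1r.
Qed.

Lemma band_comp P Q Z A B :
  (forall x y, P x -> Q y -> band Z (fun v => act x (act y v))) ->
  band P A -> band Q B -> band Z (fun v => A (B v)).
Proof.
move=> PQ bA bB; elim: bA => [A' h|x A' B' Px _ IH h].
  by apply: band_nil => v t; rewrite h.
apply: (@eq_band _ (fun v t => act x (B v) t + A' (B v) t)).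
  by move=> v t; rewrite h.
apply: band_add => //; elim: bB => [B1 h1|y B1 B2 Qy _ IH2 h1].
  apply: band_nil => v t; rewrite -[RHS](act0 x t); congr act.
  exact/funext.
apply: eq_band (band_add (PQ _ _ Px Qy) IH2) => v t.
by rewrite -actD; congr act; apply/funext => t'; rewrite h1.
Qed.

Lemma band_comm P Q Z A B :
  (forall x y, P x -> Q y ->
     band Z (fun v t => act x (act y v) t - act y (act x v) t)) ->
  band P A -> band Q B -> band Z (fun v t => A (B v) t - B (A v) t).
Proof.
move=> PQ bA bB; elim: bA => [A' h|x A' B' Px _ IH h].
  apply: band_nil => v t; rewrite h sub0r (_ : A' v = fun=> 0); last exact/funext.
  have := bandD (fun=> 0) (fun=> 0) t bB.
  rewrite (_ : (fun _ => 0 + 0) = fun=> 0); last by apply/funext => ?; rewrite addr0.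
  by move/eqP; rewrite -subr_eq subrr eq_sym => /eqP ->; rewrite oppr0.
have hv v : B' v = fun t => act x v t + A' v t by apply/funext => t; rewrite h.
apply: (@eq_band _ (fun v t => (act x (B v) t - B (act x v) t) +
                                (A' (B v) t - B (A' v) t))).
  by move=> v t; rewrite h hv (bandD _ _ _ bB); ring.
apply: band_add => //; elim: bB => [B1 h1|y B1 B2 Qy _ IH2 h1].
  apply: band_nil => v t; rewrite h1 (_ : B1 v = fun=> 0) ?act0 ?subrr//.
  exact/funext.
apply: eq_band (band_add (PQ _ _ Px Qy) IH2) => v t.
have -> : B2 v = fun t => act y v t + B1 v t by apply/funext => t'; rewrite h1.
by rewrite actD !h1; ring.
Qed.

End Bands.

(** * Bounded and smoothing operators *)

Section Realization.
Variable R : realType.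
Notation H := (spinor_space R).
Notation C := R[i].
Notation V := (bool * label -> C).
Notation normc := Normc.normc.
Implicit Types (v w : V) (s e : bool) (p : pt) (k : label).
Implicit Types (x y : term R) (P Q Z : term R -> Prop) (A B : V -> V).

Lemma normc_real (c : R) : normc (Complex c 0) = `|c|.
Proof. by rewrite /= expr0n /= addr0 sqrtr_sqr. Qed.

Lemma normc_conj (z : C) : normc z^* = normc z.
Proof. by case: z => a b /=; rewrite sqrrN. Qed.

Lemma normcN (z : C) : normc (- z) = normc z.
Proof. by case: z => a b /=; rewrite !sqrrN. Qed.

Lemma normcB (z z' : C) : normc (z - z') <= normc z + normc z'.
Proof. by rewrite -(normcN z') le_normcD. Qed.

Definition bdd x := exists c, forall s p, normc (tcoef x s p) <= c.

Definition size_pt p : nat := \sum_i `|p i|%N.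

(** Rapid decay rather than an exponential bound of fixed rate, because it is stable under
    multiplication by powers of the eigenvalues of |D|. *)
Definition rapid x := forall n, exists c, forall s p,
  normc (tcoef x s p) * (size_pt p).+1%:R ^+ n <= c.

Lemma rapid_bdd x : rapid x -> bdd x.
Proof. by move=> /(_ 0%N) [c h]; exists c => s p; have := h s p; rewrite mulr1. Qed.

(** A shift is injective on the labels where it is defined; reindexing by its image bounds the sum
    by a part of c^2 ||v||^2. *)
Lemma normsq_act x : bdd x ->
  exists2 M : R, 0 <= M & forall v, (normsq (act x v) <= M%:E * normsq v)%E.
Proof.
case=> c hc; exists (c ^+ 2); first exact: sqr_ge0.
move=> v; pose D := [set t : bool * label | good (pos t.2 + tshift x)].
pose g (t : bool * label) := (tflip x (+) t.1,
  odflt t.2 (insub (unpos (pos t.2 + tshift x)) : option label)).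
have gD t : D t -> pos (g t).2 = pos t.2 + tshift x.
  rewrite /D /g /= => /goodP[k E]; by rewrite E unpos_pos valK.
pose h t := c ^+ 2 * normc (v t) ^+ 2.
have h0 t : (0 <= (h t)%:E)%E by rewrite lee_fin mulr_ge0 ?sqr_ge0.
have -> : ((c ^+ 2)%:E * normsq v = \esum_(t in [set: bool * label]) (h t)%:E)%E.
  by rewrite /normsq -ge0_esumZ ?sqr_ge0// => t; rewrite sqr_ge0.
apply: (@le_trans _ _ (\esum_(t in g @` D) (h t)%:E)%E); last first.
  by rewrite esum_mkcond; apply: le_esum => t _; case: ifP.
rewrite esum_image; last first.
  move=> t t' /set_mem tD /set_mem tD' E; move: (congr1 (fun t => pos t.2) E) (congr1 fst E).
  rewrite /= !gD// => /addIr/pos_inj e2 /addbI e1.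
  by case: t t' e1 e2 {E tD tD'} => [? ?] [? ?] /= -> ->.
rewrite /normsq [leRHS]esum_mkcond; apply: le_esum => t _.
rewrite /act Normc.normcM exprMn; case: ifPn => [/set_mem tD|/negP tD].
  rewrite -gD// ext_pos lee_fin /h -/(g t).
  by rewrite ler_wpM2r ?sqr_ge0// lerXn2r ?nnegrE ?normc_ge0// (le_trans _ (hc t.1 (pos t.2)))// normc_ge0.
rewrite ext_bad ?Normc.normc0 ?expr0n ?mulr0//.
by apply/negP => h'; apply: tD; exact: mem_set.
Qed.

Lemma normsq_band A : band bdd A ->
  exists2 M : R, 0 <= M & forall v, (normsq (A v) <= M%:E * normsq v)%E.
Proof.
elim=> [A' h|x A' B /normsq_act[M1 M10 h1] _ [M2 M20 h2] h].
  exists 0 => // v; rewrite mul0e /normsq esum1// => t _.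
  by rewrite h Normc.normc0 expr0n.
(* From |x + y|^2 <= 2 |x|^2 + 2 |y|^2. *)
exists ((M1 + M1) + (M2 + M2)) => [|v]; first by rewrite !addr_ge0.
have n0 := normsq_ge0 v.
rewrite EFinD ge0_muleDl ?lee_fin ?addr_ge0//.
rewrite !EFinD !ge0_muleDl ?lee_fin//.
apply: (@le_trans _ _ ((normsq (act x v) + normsq (act x v)) +
   (normsq (A' v) + normsq (A' v)))%E); last by rewrite !leeD.
rewrite /normsq -!esumD; do ?by move=> *; rewrite ?adde_ge0 ?lee_fin ?sqr_ge0.
apply: le_esum => t _; rewrite -!EFinD lee_fin h.
have : normc (act x v t + A' v t) ^+ 2 <=
       (normc (act x v t) + normc (A' v t)) ^+ 2.
  by rewrite lerXn2r ?nnegrE ?addr_ge0 ?normc_ge0 ?le_normcD.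
have := sqr_ge0 (normc (act x v t) - normc (A' v t)).
move: (normc _) (normc _) (normc _) => a b c; lra.
Qed.

Lemma band_ell2 A : band bdd A -> exists S : H -> H, forall (v : H) t, S v t = A v t.
Proof.
move=> /normsq_band[M M0 h].
have ss (v : H) : A v \in square_summable.
  apply/asboolP; apply: le_lt_trans (h v) _.
  by rewrite lte_mul_pinfty ?lee_fin// ltey_eq normsq_fin.
by exists (fun v : H => Ell2 (ss v)).
Qed.

Lemma band_bounded A (S : H -> H) : band bdd A ->
  (forall (v : H) t, S v t = A v t) -> bounded_operator S.
Proof.
move=> bA SA; split=> [c u v|].
  apply: ell2P => t; rewrite ell2D ell2Z !SA -(band_linear bA); congr A.
have [M M0 h] := normsq_band bA; exists (Num.sqrt M) => v.
rewrite /l2norm -sqrtrM// ler_wsqrtr//.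
rewrite -[M]/(fine M%:E) -fineM ?normsq_fin// fine_le ?normsq_fin//.
  by rewrite fin_numM ?normsq_fin.
rewrite (@eq_esum _ _ _ _ (fun t => (normc (A v t) ^+ 2)%:E)); first exact: h.
by move=> t _; rewrite SA.
Qed.

(** The eigenvalue l + 3/2, as the coordinates of a label add up to 2l + 1; defined on all of Z^4
    since shifted points need not be labels. *)
Definition ev p : C := (p i0 + p i1 + p i2 + p i3)%:~R / 2 + 1.

Lemma Dirac_eigenvalue_pos k : Dirac_eigenvalue k = ev (pos k).
Proof.
rewrite /Dirac_eigenvalue -unpos_pos /unpos /ev.
set p := pos k; rewrite !(rmorphD, rmorphB, fmorph_div, ratr_int, rmorph1) /=.
by field.
Qed.

Lemma evD p p' : ev (p + p') - ev p = (p' i0 + p' i1 + p' i2 + p' i3)%:~R / 2.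
Proof. by rewrite /ev !ffunE !rmorphD /=; field. Qed.

Lemma normc_int (n : int) : normc (n%:~R : C) = `|n|%N%:R.
Proof.
have -> : n%:~R = Complex (n%:~R : R) 0 by rewrite -(rmorph_int (real_complex R)).
by rewrite normc_real -intr_norm; case: n => [n|n].
Qed.

Lemma normc_half (n : int) : normc (n%:~R / 2 : C) = `|n|%N%:R / 2.
Proof. by rewrite Normc.normcM normc_int Normc.normcV (normc_int 2). Qed.

Lemma size_ptE p : size_pt p = (`|p i0| + `|p i1| + `|p i2| + `|p i3|)%N.
Proof.
rewrite /size_pt !big_ord_recr big_ord0 /= add0n.
by congr (_ + _ + _ + _)%N; congr (absz (p _)); exact: val_inj.
Qed.

Lemma normc_ev p : normc (ev p) <= (size_pt p).+1%:R.
Proof.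
rewrite /ev -(addn1 (size_pt p)) natrD; apply: le_trans (le_normcD _ _) _.
rewrite Normc.normc1 lerD2r normc_half size_ptE.
set m := absz _; have : (m <= `|p i0| + `|p i1| + `|p i2| + `|p i3|)%N by lia.
rewrite -(ler_nat R); move: (_ + _)%N => n; have := ler0n R m; lra.
Qed.

(** The commutator with |D| for [e = false], and with D, which also exchanges the chiralities, for
    [e = true]. *)
Definition dterm e x : term R := Term (e (+) tflip x) (tshift x)
  (fun s p => ev p * tcoef x (e (+) s) p - ev (p + tshift x) * tcoef x s p).

Lemma ext_Dirac e (v w : H) s p : Dirac_diag e v w ->
  ext w s p = ev p * ext v (e (+) s) p.
Proof.
move=> vw; have [/goodP[k ->]|h] := boolP (good p).
  by rewrite !ext_pos vw Dirac_eigenvalue_pos.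
by rewrite !ext_bad ?mulr0.
Qed.

Lemma act_Dirac e x (v w : H) s k : Dirac_diag e v w ->
  ev (pos k) * act x v (e (+) s, k) = act (dterm e x) v (s, k) + act x w (s, k).
Proof.
move=> vw; rewrite /act /= (ext_Dirac _ _ vw).
rewrite -addbA (addbCA e); ring.
Qed.

Lemma band_Dirac e P Q A : (forall x, P x -> Q (dterm e x)) -> band P A ->
  exists2 A', band Q A' & forall (v w : H) s k, Dirac_diag e v w ->
    ev (pos k) * A v (e (+) s, k) = A' v (s, k) + A w (s, k).
Proof.
move=> PQ; elim=> [A0 h|x A0 B Px _ [A' h1 h2] h].
  exists (fun _ _ => 0); first exact: band_nil.
  by move=> v w s k _; rewrite !h mulr0 addr0.
exists (fun v t => act (dterm e x) v t + A' v t).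
  by apply: band_cons (PQ _ Px) h1 _.
by move=> v w s k vw; rewrite !h mulrDr (act_Dirac _ _ _ vw) (h2 _ _ _ _ vw); ring.
Qed.

(** The domain of D consists of the vectors whose prescribed coordinates come from a vector, so the
    last hypothesis also shows that S preserves it. *)
Lemma band_bounded_commutator e A A' (S S' : H -> H) : band bdd A' ->
  (forall (v : H) t, S v t = A v t) -> (forall (v : H) t, S' v t = A' v t) ->
  (forall (v w : H) s k, Dirac_diag e v w ->
    ev (pos k) * A v (e (+) s, k) = A' v (s, k) + A w (s, k)) ->
  bounded_commutator (Dirac_diag e) S S'.
Proof.
move=> bA' SA SA' h; split; first exact: band_bounded SA'.
move=> v w vw s k; rewrite ell2D SA' !SA Dirac_eigenvalue_pos.
by rewrite -(h _ _ _ _ vw).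
Qed.

Lemma bdd_dterm x : bdd x -> bdd (dterm false x).
Proof.
case=> c hc; pose n : int := tshift x i0 + tshift x i1 + tshift x i2 + tshift x i3.
exists (`|n|%N%:R / 2 * c) => s p /=.
rewrite -mulrBl Normc.normcM -opprB normcN evD normc_half.
by rewrite ler_wpM2l// mulr_ge0 ?invr_ge0 ?ler0n.
Qed.

Lemma band_dom_delta n A (S : H -> H) : band bdd A ->
  (forall (v : H) t, S v t = A v t) -> dom_delta (Dirac_diag false) n S.
Proof.
elim: n A S => [|n IH] A S bA SA /=; first exact: band_bounded SA.
split; first exact: band_bounded SA.
have [A' bA' h] := band_Dirac bdd_dterm bA.
have [S' SA'] := band_ell2 bA'.
by exists S'; [exact: band_bounded_commutator h|exact: IH SA'].
Qed.

Lemma rapid_ev n x : rapid x ->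
  rapid (Term (tflip x) (tshift x) (fun s p => ev p ^+ n * tcoef x s p)).
Proof.
move=> rx m; have [c hc] := rx (n + m)%N; exists c => s p /=.
apply: le_trans (hc s p).
rewrite Normc.normcM exprD mulrA ler_wpM2r ?exprn_ge0 ?ler0n//.
rewrite mulrC ler_wpM2l ?normc_ge0//.
have -> : normc (ev p ^+ n) = normc (ev p) ^+ n.
  elim: n {hc} => [|n IH]; first by rewrite !expr0 Normc.normc1.
  by rewrite !exprS Normc.normcM IH.
by rewrite lerXn2r ?nnegrE ?normc_ge0 ?ler0n ?normc_ev.
Qed.

(** Weights are indexed by targets, so |D|^n on the left multiplies each of them by the n-th power
    of the eigenvalue at the same point. Rapid decay absorbs this, and [OP0] only asks for bounded
    weights. *)
Lemma band_smoothing A (S : H -> H) : band rapid A ->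
  (forall (v : H) t, S v t = A v t) -> smoothing (Dirac_diag false) S.
Proof.
move=> bA SA; split.
  exact: band_bounded (band_subset rapid_bdd bA) SA.
have key n : exists2 B, band rapid B &
    forall v t, B v t = ev (pos t.2) ^+ n * A v t.
  exists (fun v t => ev (pos t.2) ^+ n * A v t) => //.
  elim: bA => [A' h|x A' B Px _ IH h].
    by apply: band_nil => v t; rewrite h mulr0.
  apply: band_cons (rapid_ev n Px) IH _ => v t.
  by rewrite h mulrDr /act /= mulrA.
have rea n : exists2 T : H -> H, (forall (v : H) t, T v t = ev (pos t.2) ^+ n * A v t) &
    OP0 (Dirac_diag false) T.
  have [B bB BA] := key n; have bB' := band_subset rapid_bdd bB.
  have [T TB] := band_ell2 bB'; exists T; first by move=> v t; rewrite TB BA.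
  by move=> m; exact: band_dom_delta TB.
move=> n; have [T TA T0] := rea n; exists T => //.
elim: n T TA {T0} => [|n IH] T TA v.
  by apply: ell2P => t; rewrite TA SA mul1r.
have [T' T'A _] := rea n; exists (T' v); first exact: IH.
by move=> s k; rewrite TA T'A Dirac_eigenvalue_pos exprS mulrA.
Qed.

End Realization.

(** * Symbols *)

Definition wt (r : 'I_4 -> 'I_4) (k : nat) (p : pt) : nat := \sum_(i | (r i < k)%N) `|p i|%N.

Lemma absz_shift (a b : int) : (`|a| <= `|(a + b)%R| + `|b|)%N.
Proof. lia. Qed.

Lemma wt_shift r k (p p' : pt) : (wt r k p <= wt r k (p + p')%R + wt r k p')%N.
Proof. by rewrite /wt -big_split /=; apply: leq_sum => i _; rewrite ffunE absz_shift. Qed.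

Lemma size_shift (p p' : pt) : (size_pt p <= size_pt (p + p')%R + size_pt p')%N.
Proof.
by rewrite /size_pt -big_split /=; apply: leq_sum => i _; rewrite ffunE absz_shift.
Qed.

Lemma even_ptD (p p' : pt) : even_pt p -> even_pt p' -> even_pt (p + p').
Proof.
have even_add (a b c d : int) : ((a + b) %% 2)%Z == 0 -> ((c + d) %% 2)%Z == 0 ->
  ((a + c + (b + d)) %% 2)%Z == 0 by lia.
by rewrite /even_pt !ffunE => /andP[? ?] /andP[? ?]; rewrite !even_add.
Qed.

(** * Products of two shifts *)

Section Composition.
Variable R : realType.
Notation C := R[i].
Notation V := (bool * label -> C).
Notation normc := Normc.normc.
Implicit Types (v : V) (s : bool) (p : pt) (x y : term R).

Lemma ext_act y v s p : ext (act y v) s p =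
  (good p)%:R * tcoef y s p * ext v (tflip y (+) s) (p + tshift y).
Proof.
have [/goodP[k ->]|h] := boolP (good p); last by rewrite ext_bad// !mul0r.
by rewrite ext_pos mul1r.
Qed.

(** The factor [good (p + tshift x)] kills the paths through points that are not labels; every
    boundary effect below comes from it. *)
Definition comp_term x y : term R := Term (tflip y (+) tflip x) (tshift x + tshift y)
  (fun s p => tcoef x s p * (good (p + tshift x))%:R *
              tcoef y (tflip x (+) s) (p + tshift x)).

Lemma act_comp x y v t : act x (act y v) t = act (comp_term x y) v t.
Proof. by rewrite {1}/act ext_act /act /= addrA addbA !mulrA. Qed.

Lemma normc_bool (b : bool) : normc (b%:R : C) = b%:R.
Proof. by case: b; rewrite ?Normc.normc1 ?Normc.normc0. Qed.

Lemma bool_le1 (b : bool) : b%:R <= 1 :> R.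
Proof. by case: b; rewrite ?ler01. Qed.

Lemma normc_comp x y s p : normc (tcoef (comp_term x y) s p) <=
  normc (tcoef x s p) * normc (tcoef y (tflip x (+) s) (p + tshift x)).
Proof.
rewrite /= !Normc.normcM normc_bool ler_wpM2r ?normc_ge0//.
by rewrite ler_piMr ?normc_ge0 ?bool_le1.
Qed.

Lemma rapid_comp_l x y : rapid x -> bdd y -> rapid (comp_term x y).
Proof.
move=> rx [c hc] n; have [c' hc'] := rx n; exists (c' * `|c|) => s p.
apply: (@le_trans _ _ (normc (tcoef x s p) * `|c| * (size_pt p).+1%:R ^+ n)).
  rewrite ler_wpM2r ?exprn_ge0 ?ler0n//; apply: le_trans (normc_comp x y s p) _.
  by rewrite ler_wpM2l ?normc_ge0//; apply: le_trans (hc _ _) (ler_norm _).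
by rewrite mulrAC ler_wpM2r.
Qed.

Lemma rapid_comp_r x y : bdd x -> rapid y -> rapid (comp_term x y).
Proof.
move=> [c hc] ry n; have [c' hc'] := ry n.
set a : R := (size_pt (tshift x)).+1%:R ^+ n.
have a0 : 0 <= a by rewrite exprn_ge0 ?ler0n.
exists (`|c| * (c' * a)) => s p.
set y' := tcoef y (tflip x (+) s) (p + tshift x).
apply: (@le_trans _ _ (`|c| * (normc y' * (size_pt p).+1%:R ^+ n))).
  rewrite mulrA ler_wpM2r ?exprn_ge0 ?ler0n//; apply: le_trans (normc_comp x y s p) _.
  by rewrite ler_wpM2r ?normc_ge0//; apply: le_trans (hc _ _) (ler_norm _).
rewrite ler_wpM2l//; apply: le_trans (ler_wpM2r a0 (hc' (tflip x (+) s) (p + tshift x))).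
rewrite -mulrA ler_wpM2l ?normc_ge0// /a -exprMn lerXn2r ?nnegrE ?mulr_ge0 ?ler0n//.
rewrite -natrM ler_nat; have := size_shift p (tshift x); nia.
Qed.

End Composition.

(** * Symbols of finite level and their products *)

Section Symbols.
Variables (R : realType) (q : R).
Hypothesis hq : 0 < q < 1.
Notation H := (spinor_space R).
Notation C := R[i].
Notation V := (bool * label -> C).
Notation normc := Normc.normc.
Implicit Types (v w : V) (s e : bool) (p : pt) (k : nat).
Implicit Types (x y : term R) (P Q Z : term R -> Prop) (A B : V -> V).
Implicit Types (r : 'I_4 -> 'I_4).

Let q0 : 0 < q. Proof. by case/andP: hq. Qed.
Let q1 : q < 1. Proof. by case/andP: hq. Qed.

(** With z = y^2, one factor y^m absorbs one factor m + 1, because (m + 1) y^m <= 1 + y + ... + y^m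
    <= 1 / (1 - y); the other factor y^m is left to the induction. *)
Lemma poly_exp_bounded (z : R) n : 0 < z < 1 ->
  exists c, forall m : nat, z ^+ m * m.+1%:R ^+ n <= c.
Proof.
elim: n z => [|n IH] z /andP[z0 z1].
  by exists 1 => m; rewrite mulr1 exprn_ile1// ltW.
set y := Num.sqrt z.
have y0 : 0 < y by rewrite sqrtr_gt0.
have yz : z = y ^+ 2 by rewrite sqr_sqrtr// ltW.
have y1 : y < 1 by rewrite -(@ltr_pXn2r _ 2) ?nnegrE ?ltW// expr1n -yz.
have [c hc] : exists c, forall m : nat, y ^+ m * m.+1%:R ^+ n <= c by apply: IH; rewrite y0.
have lin m : y ^+ m * m.+1%:R <= (1 - y)^-1.
  rewrite -[leRHS]mul1r ler_pdivlMr ?subr_gt0//.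
  have -> : y ^+ m * m.+1%:R = \sum_(i < m.+1) y ^+ m.
    by rewrite sumr_const card_ord mulr_natr.
  apply: (@le_trans _ _ ((\sum_(i < m.+1) y ^+ i) * (1 - y))).
    rewrite ler_wpM2r ?subr_ge0 ?(ltW y1)//; apply: ler_sum => i _.
    by apply: ler_wiXn2l; rewrite ?(ltW y0) ?(ltW y1)// -ltnS ltn_ord.
  rewrite mulrC -[1 - y]opprB mulNr -subrX1 opprB.
  by rewrite gerBl exprn_ge0 ?(ltW y0).
exists ((1 - y)^-1 * c) => m.
rewrite yz -exprM mulnC exprM expr2 exprS -mulrA.
rewrite (_ : _ * _ = (y ^+ m * m.+1%:R) * (y ^+ m * m.+1%:R ^+ n)); last by ring.
by apply: ler_pM => //; rewrite mulr_ge0 ?exprn_ge0 ?ler0n ?(ltW y0).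
Qed.

(* [r] orders the four coordinates: (d, a, b, c) for the algebra and, reversed,
   for its conjugate by J. A symbol of level k involves the first k coordinates,
   is of order q to the power of their sum, and shifts the first k + 1. *)
Definition pure r k x : Prop :=
  [/\ forall i, (k < r i)%N -> tshift x i = 0, even_pt (tshift x),
      forall s s' p p', (forall i, (r i < k)%N -> p i = p' i) ->
        tcoef x s p = tcoef x s' p' &
      exists c, forall s p, normc (tcoef x s p) <= c * q ^+ wt r k p].

Definition symbol r x : Prop := rapid x \/ exists k, pure r k x.

Lemma qX_ge0 n : 0 <= q ^+ n. Proof. by rewrite exprn_ge0 ?ltW. Qed.
Lemma qX_gt0 n : 0 < q ^+ n. Proof. by rewrite exprn_gt0. Qed.
Lemma qX_le1 n : q ^+ n <= 1. Proof. by rewrite exprn_ile1 ?ltW. Qed.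
Lemma qX_le n m : (m <= n)%N -> q ^+ n <= q ^+ m.
Proof. by move=> ?; rewrite ler_wiXn2l ?ltW. Qed.

Lemma qX_shift n m a : (n <= m + a)%N -> q ^+ m <= (q ^+ a)^-1 * q ^+ n.
Proof.
by move=> h; rewrite mulrC ler_pdivlMr ?qX_gt0// -exprD qX_le.
Qed.

Lemma pure_bound r k x : pure r k x ->
  exists2 c, 0 <= c & forall s p, normc (tcoef x s p) <= c * q ^+ wt r k p.
Proof.
case=> _ _ _ [c hc]; exists c => //.
have := le_trans (normc_ge0 _) (hc true 0); rewrite pmulr_lge0//; exact: qX_gt0.
Qed.

Lemma rapid_of_exp x : (exists c, forall s p, normc (tcoef x s p) <= c * q ^+ size_pt p) ->
  rapid x.
Proof.
case=> c hc n; have [c' hc'] := poly_exp_bounded n hq.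
exists (`|c| * c') => s p.
apply: (@le_trans _ _ (`|c| * (q ^+ size_pt p * (size_pt p).+1%:R ^+ n))).
  rewrite mulrA ler_wpM2r ?exprn_ge0 ?ler0n//; apply: le_trans (hc _ _) _.
  by rewrite ler_wpM2r ?qX_ge0// ler_norm.
by rewrite ler_wpM2l.
Qed.

Lemma symbol_bdd r x : symbol r x -> bdd x.
Proof.
case=> [/rapid_bdd//|[k /pure_bound[c c0 hc]]]; exists c => s p.
by apply: le_trans (hc s p) _; rewrite ler_piMr ?qX_le1.
Qed.

(* Whether the point through which a product passes is a label is not a
   condition on the first max(k, k') coordinates only: the next coordinate
   matters near its boundary, where it is bounded. *)
Lemma pure_comp r k k' x y : injective r -> pure r k x -> pure r k' y ->
  band (fun z => exists n, pure r n z) (fun v => act x (act y v)).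
Proof.
move=> r_inj px py; have [cx cx0 hx] := pure_bound px; have [cy cy0 hy] := pure_bound py.
case: px py => sx ex dx _ [sy ey dy _].
pose K := maxn k k'; pose sg := tshift x.
(* [B'] is the exact condition on the middle point, since x moves no coordinate after number K; [B]
   is its part on the first K coordinates. The product is the term cut by [B] minus a correction
   where [B] holds and [B'] fails; [D] keeps this correction near the boundary off the labels
   too. *)
pose B p := [forall i, (r i < K)%N ==> (0 <= (p + sg) i)].
pose B' p := [forall i, (r i < K.+1)%N ==> (0 <= (p + sg) i)].
pose D p := [forall i, (r i < K.+1)%N ==> (0 <= p i)].
pose f s p := tcoef x s p * tcoef y (tflip x (+) s) (p + sg).
pose mk (b : pt -> bool) : term R := Term (tflip y (+) tflip x) (sg + tshift y)
  (fun s p => f s p * (b p)%:R).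
(* The factor of the larger level provides the whole decay; the other one is merely bounded. *)
have fb : exists2 c, 0 <= c & forall s p, normc (f s p) <= c * q ^+ wt r K p.
  exists (cx * cy * (q ^+ wt r k' sg)^-1).
    by rewrite !mulr_ge0 ?invr_ge0 ?qX_ge0.
  move=> s p; rewrite Normc.normcM.
  have h1 := hx s p; have h2 := hy (tflip x (+) s) (p + sg).
  apply: le_trans (ler_pM _ _ h1 h2) _; rewrite ?normc_ge0//.
  rewrite mulrACA -!mulrA; do 2 (rewrite ler_wpM2l//).
  have [kk|kk] := leqP k' k.
    rewrite /K (maxn_idPl kk) mulrC ler_pM ?qX_ge0//.
    by rewrite (le_trans (qX_le1 _))// invf_ge1 ?qX_gt0 ?qX_le1.
  rewrite /K (maxn_idPr (ltnW kk)) -[leRHS]mul1r ler_pM ?qX_ge0 ?qX_le1//.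
  exact/qX_shift/wt_shift.
have fd s s' p p' : (forall i, (r i < K)%N -> p i = p' i) -> f s p = f s' p'.
  move=> E; rewrite /f (dx s s' p p') 1?(dy (tflip x (+) s) (tflip x (+) s') (p + sg) (p' + sg))//.
    by move=> i ri; rewrite !ffunE E// leq_max ri orbT.
  by move=> i ri; rewrite E// leq_max ri.
have sK i : (K < r i)%N -> sg i = 0.
  by rewrite gtn_max => /andP[h _]; exact: sx.
have shK i : (K < r i)%N -> (sg + tshift y) i = 0.
  by move=> ri; rewrite ffunE sK// add0r sy//; move: ri; rewrite gtn_max => /andP[].
have eqB (b : pt -> pt) n p p' : (forall i, (r i < n)%N -> b p i = b p' i) ->
    [forall i, (r i < n)%N ==> (0 <= b p i)] = [forall i, (r i < n)%N ==> (0 <= b p' i)].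
  move=> E; apply: eq_forallb => i; have [ri|//] := boolP (r i < n)%N.
  by rewrite E.
have pB : pure r K (mk B).
  split=> //=; first exact: even_ptD.
    move=> s s' p p' E; rewrite (fd s s' p p')//; congr (_ * (nat_of_bool _)%:R).
    by apply: (eqB (fun p => p + sg)) => i ri; rewrite !ffunE E.
  have [c c0 hc] := fb; exists c => s p; rewrite Normc.normcM normc_bool.
  by apply: le_trans (hc s p); rewrite ler_piMr ?normc_ge0 ?bool_le1.
have pB' : pure r K.+1 (mk (fun p => [&& D p, B p & ~~ B' p])).
  split=> /=.
  - by move=> i ri; apply: shK; exact: ltnW.
  - exact: even_ptD.
  - move=> s s' p p' E; rewrite (fd s s' p p'); last by move=> i ri; apply: E; exact: ltnW.
    congr (_ * (nat_of_bool _)%:R); congr [&& _, _ & ~~ _].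
    + exact: (eqB id).
    + by apply: (eqB (fun p => p + sg)) => i ri; rewrite !ffunE E// ltnW.
    + by apply: (eqB (fun p => p + sg)) => i ri; rewrite !ffunE E.
  have [c c0 hc] := fb; exists (c * (q ^+ wt r K.+1 sg)^-1) => s p.
  rewrite Normc.normcM normc_bool; case: and3P; last first.
    by rewrite mulr0 !mulr_ge0 ?invr_ge0 ?qX_ge0.
  rewrite mulr1 => -[/forallP hD /forallP hB hN].
  move: hN; rewrite negb_forall => /existsP[j].
  rewrite negb_imply -ltNge => /andP[rj sj].
  apply: le_trans (hc s p) _; rewrite -mulrA ler_wpM2l//; apply: qX_shift.
  (* [B] excludes the earlier coordinates, so the sign fails in coordinate number K. There 0 <= p j
     < - sg j, and the missing factor q^(p j) costs only a constant. *)
  have rjK : r j = K :> nat.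
    apply/eqP; rewrite eqn_leq -ltnS rj leqNgt; apply/negP => ri'.
    by move: (hB j); rewrite ri' /= leNgt sj.
  have := hD j; rewrite rj /= => pj0.
  rewrite /wt big_mkcond [X in (_ <= X + _)%N]big_mkcond.
  rewrite [X in (_ <= _ + X)%N]big_mkcond -big_split /=.
  apply: leq_sum => i' _; rewrite ltnS (leq_eqVlt (r i')).
  have [e|ne /=] := eqVneq (r i' : nat) K.
    2: by case: (r i' < K)%N => //=; rewrite leq_addr.
  have -> : i' = j by apply/r_inj/val_inj; rewrite /= rjK.
  move: sj pj0; rewrite rjK ltnn ffunE; move: (p j) (sg j) => a b /=; lia.
pose opp x : term R := Term (tflip x) (tshift x) (fun s p => - tcoef x s p).
apply: (@eq_band _ _ (fun v t => act (mk B) v t +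
    act (opp (mk (fun p => [&& D p, B p & ~~ B' p]))) v t)); last first.
  apply: band_add; apply: band1 => //; first by exists K.
  exists K.+1; case: pB' => [a1 a2 a3 [c hc]]; split=> //=.
    by move=> s s' p p' E; congr (- _); exact: a3.
  by exists c => s p; rewrite normcN; exact: hc.
move=> v [s k0]; rewrite act_comp /act /= -mulrDl addrA; congr (_ * _).
rewrite -mulrBr mulrAC -/sg -/(f s (pos k0)); congr (_ * _).
have gp := good_pos k0; have /and3P[/forallP p0 _ _] := gp.
have -> : good (pos k0 + sg) = B' (pos k0).
  rewrite good_add//; apply: eq_forallb => i.
  have [//|ri] := boolP (r i < K.+1)%N; rewrite /= ffunE sK ?addr0 ?p0//.
  by rewrite ltnNge.
have -> : D (pos k0) by apply/forallP => i; rewrite p0 implybT.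
have : B' (pos k0) -> B (pos k0).
  move=> /forallP h; apply/forallP => i; apply/implyP => ri.
  by have := h i; rewrite (leq_trans ri).
by case: (B' _); case: (B _) => //= h; rewrite ?subr0 ?subrr//; have := h isT.
Qed.

Lemma symbol_comp r x y : injective r -> symbol r x -> symbol r y ->
  band (symbol r) (fun v => act x (act y v)).
Proof.
move=> ri sx sy; have bx := symbol_bdd sx; have by' := symbol_bdd sy.
case: sx => [rx|[k px]].
  apply: (@band1 _ _ (comp_term x y)) => [|v t]; last exact: act_comp.
  by left; exact: rapid_comp_l.
case: sy => [ry|[k' py]].
  apply: (@band1 _ _ (comp_term x y)) => [|v t]; last exact: act_comp.
  by left; exact: rapid_comp_r.
by apply: band_subset (pure_comp ri px py) => z; right.
Qed.

End Symbols.

(** * Commutators of symbols for opposite orders *)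

Lemma absz_cross (a b c : int) : 0 <= a -> a + b < 0 -> 0 <= a + (b + c) ->
  [/\ b != 0, c != 0 & (`|a| <= `|b| + `|c|)%N].
Proof. by move=> ? ? ?; split; [apply/eqP; lia|apply/eqP; lia|lia]. Qed.

Section Commutation.
Variables (R : realType) (q : R).
Hypothesis hq : 0 < q < 1.
Notation H := (spinor_space R).
Notation C := R[i].
Notation V := (bool * label -> C).
Notation normc := Normc.normc.
Implicit Types (v w : V) (s e : bool) (p : pt) (k : nat).
Implicit Types (x y : term R) (P Q Z : term R -> Prop) (A B : V -> V).

Definition opp_term x : term R :=
  Term (tflip x) (tshift x) (fun s p => - tcoef x s p).

Lemma act_opp x v t : act (opp_term x) v t = - act x v t.
Proof. by rewrite /act /= mulNr. Qed.

Lemma rapid_opp x : rapid x -> rapid (opp_term x).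
Proof. by move=> rx n; have [c hc] := rx n; exists c => s p; rewrite normcN. Qed.

(* If k + k' >= 4, both products are already of order q^(a + b + c + d).
   Otherwise neither shift affects the other symbol, and the products differ
   only where a coordinate moved by both shifts is bounded. *)
Lemma commute_pure k k' x y : pure q id k x -> pure q (@rev_ord 4) k' y ->
  exists c, forall s p, good p -> good (p + (tshift x + tshift y)) ->
    normc (tcoef (comp_term x y) s p - tcoef (comp_term y x) s p) <=
    c * q ^+ size_pt p.
Proof.
move=> px py; have [cx cx0 hx] := pure_bound hq px.
have [cy cy0 hy] := pure_bound hq py.
case: px py => sx ex dx _ [sy ey dy _].
have revE (j : 'I_4) : rev_ord j = (3 - j)%N :> nat by rewrite /= subSS.
set sg := tshift x in sx ex *; set ta := tshift y in sy ey *.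
(* The inverse power of q pays for weights taken at shifted points and for a coordinate bounded by
   the two shifts. *)
pose M := cx * cy / q ^+ (size_pt sg + size_pt ta).
have M0 : 0 <= M by rewrite !mulr_ge0 ?invr_ge0 ?qX_ge0.
have wts r j p : (wt r j p <= size_pt p)%N.
  by rewrite /wt big_mkcond; apply: leq_sum => i _; case: ifP.
(* The first k and the last k' coordinates cover all four. *)
have wtl p : (4 <= k + k')%N -> (size_pt p <= wt id k p + wt (@rev_ord 4) k' p)%N.
  move=> kk; rewrite /size_pt /wt [X in (_ <= X + _)%N]big_mkcond.
  rewrite [X in (_ <= _ + X)%N]big_mkcond -big_split /=; apply: leq_sum => j _.
  rewrite subSS; have := ltn_ord j; case: (leqP k j) => kj; last by rewrite leq_addr.
  case: (leqP k' (3 - j)) => // kj' jl; exfalso; clear -kk kj kj' jl; lia.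
have small s p : (4 <= k + k')%N ->
    normc (tcoef (comp_term x y) s p - tcoef (comp_term y x) s p) <=
    (M + M) * q ^+ size_pt p.
  move=> kk; apply: le_trans (normcB _ _) _; rewrite mulrDl.
  apply: lerD; apply: le_trans (normc_comp _ _ _ _) _.
    apply: le_trans (ler_pM _ _ (hx _ _) (hy _ _)) _; rewrite ?normc_ge0//.
    rewrite mulrACA -exprD -[leRHS]mulrA ler_wpM2l ?mulr_ge0//.
    apply: (qX_shift hq); have := wtl p kk.
    have := wt_shift (@rev_ord 4) k' p sg; have := wts (@rev_ord 4) k' sg.
    rewrite -/sg; lia.
  apply: le_trans (ler_pM _ _ (hy _ _) (hx _ _)) _; rewrite ?normc_ge0//.
  rewrite mulrACA -exprD [cy * cx]mulrC -[leRHS]mulrA ler_wpM2l ?mulr_ge0//.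
  apply: (qX_shift hq); have := wtl p kk.
  have := wt_shift id k p ta; have := wts id k ta.
  rewrite -/ta; lia.
have [kk|kk] := leqP 4 (k + k'); first by exists (M + M) => s p _ _; exact: small.
exists M => s p gp gst.
(* Now k <= 3 - k': x moves coordinates of index at most k, whereas the weight of y reads those of
   index above 3 - k', and symmetrically. Both products thus carry the same weight at p and differ
   only in the condition on the middle point. *)
have -> : tcoef (comp_term x y) s p = tcoef x s p * tcoef y s p * (good (p + sg))%:R.
  rewrite /= mulrAC (dy (tflip x (+) s) s (p + sg) p)// => i.
  by rewrite revE => ri; rewrite ffunE sx ?addr0//=; clear -kk ri; lia.
have -> : tcoef (comp_term y x) s p = tcoef x s p * tcoef y s p * (good (p + ta))%:R.
  rewrite /= mulrAC (dx (tflip y (+) s) s (p + ta) p)//; first by ring.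
  by move=> i /= ri; rewrite ffunE sy ?addr0// revE; clear -kk ri; lia.
rewrite -mulrBr.
have [-> |ne] := eqVneq (good (p + sg)) (good (p + ta)).
  by rewrite subrr mulr0 Normc.normc0 mulr_ge0 ?qX_ge0.
(* If only one path is admissible, some coordinate leaves the labels under one shift and returns
   under the other. It is moved by both, so j <= k and 3 - j <= k', which forces j = k and k + k' =
   3. The two weights then decay in the three other coordinates, and this one is bounded. *)
have [j [jk jk' jp]] : exists j : 'I_4,
    [/\ k = j, (k + k' = 3)%N & (`|p j| <= `|sg j| + `|ta j|)%N].
  have crit j : sg j != 0 -> ta j != 0 -> k = j /\ (k + k' = 3)%N.
    move=> sj tj; have jk : (j <= k)%N by rewrite leqNgt; apply: contra_neqN sj => /sx.
    have jk' : (3 - j <= k')%N.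
      by rewrite leqNgt -revE; apply: contra_neqN tj => /sy.
    by have := ltn_ord j; clear -jk jk' kk; lia.
  have /and3P[/forallP p0 _ _] := gp; have /and3P[/forallP pst _ _] := gst.
  have [g|g] := boolP (good (p + sg)).
    move: ne; rewrite g eq_sym eqb_id good_add// negb_forall => /existsP[j].
    rewrite -ltNge => hj; have := pst j; move: hj; rewrite !ffunE => h1.
    rewrite [sg j + _]addrC => /(absz_cross (p0 j) h1)[tj sj jj].
    by have [e1 e2] := crit j sj tj; exists j; split; rewrite // addnC.
  move: g; rewrite good_add// negb_forall => /existsP[j].
  rewrite -ltNge => hj; have := pst j; move: hj; rewrite !ffunE => h1.
  move=> /(absz_cross (p0 j) h1)[sj tj jj].
  by have [e1 e2] := crit j sj tj; exists j; split.
rewrite Normc.normcM; apply: (@le_trans _ _ (normc (tcoef x s p * tcoef y s p))).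
  rewrite ler_piMr ?normc_ge0//.
  by case: (good (p + sg)); case: (good (p + ta));
    rewrite ?subrr ?subr0 ?sub0r ?normcN ?Normc.normc1 ?Normc.normc0.
rewrite Normc.normcM; apply: le_trans (ler_pM _ _ (hx _ _) (hy _ _)) _; rewrite ?normc_ge0//.
rewrite mulrACA -exprD -[leRHS]mulrA ler_wpM2l ?mulr_ge0//.
apply: (qX_shift hq).
rewrite /size_pt /wt [X in (_ <= X + _ + _)%N]big_mkcond.
rewrite [X in (_ <= _ + X + _)%N]big_mkcond -!big_split /=; apply: leq_sum => i _.
have [->|ij] := eqVneq i j; first by apply: leq_trans jp _; rewrite leq_addl.
rewrite subSS; have := ltn_ord i; case: (ltnP i k) => ki; first by move=> _; rewrite -addnA leq_addr.
case: (ltnP (3 - i) k') => ki'; first by move=> _; rewrite add0n leq_addr.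
move=> il; exfalso; move/eqP: ij; apply; apply: val_inj => /=.
by clear -jk jk' il ki ki'; lia.
Qed.

Lemma symbol_commute x y : symbol q id x -> symbol q (@rev_ord 4) y ->
  band (@rapid R) (fun v t => act x (act y v) t - act y (act x v) t).
Proof.
move=> sx sy; have bx := symbol_bdd hq sx; have by' := symbol_bdd hq sy.
have key : rapid (comp_term x y) -> rapid (comp_term y x) ->
    band (@rapid R) (fun v t => act x (act y v) t - act y (act x v) t).
  move=> r1 r2; apply: (@eq_band _ _ (fun v t => act (comp_term x y) v t +
      act (opp_term (comp_term y x)) v t)).
    by move=> v t; rewrite act_opp !act_comp.
  by apply: band_add; [exact: (band1 r1)|exact: (band1 (rapid_opp r2))].
case: sx => [rx|[k px]]; first exact: key (rapid_comp_l rx by') (rapid_comp_r by' rx).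
case: sy => [ry|[k' py]]; first exact: key (rapid_comp_r bx ry) (rapid_comp_l ry bx).
have [c hc] := commute_pure px py.
(* The bound of [commute_pure] holds between labels only; the extra indicator leaves the action
   unchanged. *)
pose z := Term (tflip y (+) tflip x) (tshift x + tshift y) (fun s p =>
  (good p && good (p + (tshift x + tshift y)))%:R *
  (tcoef (comp_term x y) s p - tcoef (comp_term y x) s p)).
apply: (@band1 _ _ z) => [|v t].
  apply: (rapid_of_exp hq); exists `|c| => s p; rewrite Normc.normcM normc_bool.
  case: andP => [[g1 g2]|_]; last by rewrite mul0r mulr_ge0 ?qX_ge0.
  rewrite mul1r; apply: le_trans (hc _ _ g1 g2) _.
  by rewrite ler_wpM2r ?qX_ge0// ler_norm.
rewrite !act_comp; have -> : act (comp_term y x) v t = tcoef (comp_term y x) t.1 (pos t.2) *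
    ext v (tflip y (+) tflip x (+) t.1) (pos t.2 + (tshift x + tshift y)).
  by rewrite /act [tflip (comp_term _ _)]addbC [tshift (comp_term _ _)]addrC.
rewrite -mulrBl /act /= good_pos /=.
have [g|g] := boolP (good (pos t.2 + (tshift x + tshift y))); first by rewrite mul1r.
by rewrite ext_bad// !mulr0.
Qed.

End Commutation.

(** * The real structure *)

Definition rev_pt (p : pt) : pt := [ffun i => p (rev_ord i)].

Lemma rev_ptK : involutive rev_pt.
Proof. by move=> p; apply/ffunP => i; rewrite !ffunE rev_ordK. Qed.

Lemma rev_ptD p p' : rev_pt (p + p') = rev_pt p + rev_pt p'.
Proof. by apply/ffunP => i; rewrite !ffunE. Qed.

Lemma rev_ptE (p : pt) : (rev_pt p i0 = p i3) * (rev_pt p i1 = p i2) *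
  (rev_pt p i2 = p i1) * (rev_pt p i3 = p i0).
Proof. by rewrite !ffunE; do !split; congr (p _); exact: val_inj. Qed.

Lemma good_rev p : good (rev_pt p) = good p.
Proof.
have H p' : good p' -> good (rev_pt p').
  case/and3P => /forallP h0 h1 h2; rewrite /good !rev_ptE.
  rewrite [p' i3 + _]addrC h1 [p' i2 + _]addrC h2 !andbT.
  by apply/forallP => j; rewrite ffunE.
by apply/idP/idP; [move/H; rewrite rev_ptK|exact: H].
Qed.

Lemma rev_label_subproof k : exists k', pos k' = rev_pt (pos k).
Proof.
have : good (rev_pt (pos k)) by rewrite good_rev good_pos.
by case/goodP => k' ->; exists k'.
Qed.

Definition rev_label k : label := projT1 (cid (rev_label_subproof k)).

Lemma pos_rev_label k : pos (rev_label k) = rev_pt (pos k).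
Proof. by rewrite /rev_label; case: cid. Qed.

Lemma rev_labelK : involutive rev_label.
Proof. by move=> k; apply: pos_inj; rewrite !pos_rev_label rev_ptK. Qed.

Section RealStructure.
Variables (R : realType) (q : R).
Notation H := (spinor_space R).
Notation C := R[i].
Notation V := (bool * label -> C).
Notation normc := Normc.normc.
Implicit Types (v w : V) (s e : bool) (p : pt) (k : label).
Implicit Types (x y : term R) (P Q Z : term R -> Prop) (A B : V -> V).

(** The phase i^(2l+1) (-1)^(j+m1) of J, with integer exponents so that it is a character of Z^4. *)
Definition phase p : C :=
  'i ^ (p i0 + p i1 + p i2 + p i3) * (-1) ^ p i1.

Lemma normc_exprz (z : C) (n : int) : normc z = 1 -> normc (z ^ n) = 1.
Proof.
have E m : normc z = 1 -> normc (z ^+ m) = 1.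
  by move=> z1; elim: m => [|m IH]; rewrite ?Normc.normc1// exprS Normc.normcM z1 IH mulr1.
move=> /E {}E; case: n => n; first exact: E.
by rewrite NegzE -exprnN Normc.normcV E invr1.
Qed.

Lemma normc_phase p : normc (phase p) = 1.
Proof.
have n1 : normc (-1 : C) = 1 by rewrite normcN Normc.normc1.
rewrite Normc.normcM !normc_exprz ?mulr1//.
apply/eqP; rewrite -sqrp_eq1 ?normc_ge0//.
by rewrite expr2 -Normc.normcM -expr2 sqrCi n1.
Qed.

Lemma phaseD p p' : phase (p + p') = phase p * phase p'.
Proof.
have ine0 : 'i != 0 :> C by rewrite neq0Ci.
have mne0 : -1 != 0 :> C by rewrite oppr_eq0 oner_eq0.
have E (a b c d a' b' c' d' : int) :
  a + a' + (b + b') + (c + c') + (d + d') = (a + b + c + d) + (a' + b' + c' + d') by ring.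
rewrite /phase !ffunE.
rewrite E.
rewrite (expfzDr _ _ ine0).
rewrite (expfzDr _ _ mne0).
by rewrite mulrACA.
Qed.

Lemma mul_conjc (z : C) : normc z = 1 -> z * z^* = 1.
Proof.
move=> z1; rewrite -normCK (_ : `|z| = 1) ?expr1n//.
by rewrite [LHS]/(real_complex R (normc z)) z1.
Qed.

(** Reversal exchanges a and b, whose sum is odd on labels. This sign amounts to J^2 = -1. *)
Lemma phase_rev p : good p -> phase (rev_pt p) = - phase p.
Proof.
case/and3P => _ _ h; rewrite /phase !rev_ptE -mulrN.
congr ('i ^ _ * _); first by lia.
have ev2 (n : int) : (-1 : C) ^ (n * 2) = 1 by rewrite mulrC -exprz_exp (_ : (-1 : C) ^ 2 = 1) ?exp1rz// -exprnP sqrrN expr1n.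
have mne0 : -1 != 0 :> C by rewrite oppr_eq0 oner_eq0.
have -> : p i2 = p i1 + 1 + ((p i2 - p i1 - 1) %/ 2)%Z * 2.
  by move: (p i1) (p i2) h => a b h; lia.
by rewrite !expfzDr// ev2 mulr1 expr1z mulrN1.
Qed.

Definition Jop v : V := fun t =>
  phase (pos (rev_label t.2)) * (v (t.1, rev_label t.2))^*.

Lemma ext_Jop v s p : ext (Jop v) s p = phase (rev_pt p) * (ext v s (rev_pt p))^*.
Proof.
have [/goodP[k ->]|g] := boolP (good p).
  by rewrite ext_pos -pos_rev_label ext_pos.
by rewrite !ext_bad ?good_rev// conjC0 mulr0.
Qed.

(** The sign is that of J^2 = -1; as [phase] is a character, only the phase of the shift survives
    the conjugation. *)
Definition Jterm x : term R := Term (tflip x) (rev_pt (tshift x)) (fun s p =>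
  - (phase (rev_pt (tshift x)))^* * (tcoef x s (rev_pt p))^*).

Lemma act_Jterm x v t : Jop (act x (Jop v)) t = act (Jterm x) v t.
Proof.
case: t => s k; rewrite /Jop /act /= ext_Jop !pos_rev_label.
rewrite 2!rmorphM /= conjCK rev_ptD rev_ptK phaseD rmorphM /= phase_rev ?good_pos//.
have := mul_conjc (normc_phase (pos k)).
set a := phase (pos k); set b := _^*; move=> h.
set c := (phase _)^*; set d := (tcoef _ _ _)^*.
by rewrite -[d in RHS]mul1r -h; ring.
Qed.

Lemma JopD v w t : Jop (fun t => v t + w t) t = Jop v t + Jop w t.
Proof. by rewrite /Jop rmorphD mulrDr. Qed.

Lemma band_J P Q A : (forall x, P x -> Q (Jterm x)) -> band P A ->
  band Q (fun v => Jop (A (Jop v))).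
Proof.
move=> PQ; elim=> [A' h|x A' B Px _ IH h].
  by apply: band_nil => v t; rewrite /Jop h conjC0 mulr0.
apply: band_cons (PQ _ Px) IH _ => v t; rewrite -act_Jterm -JopD.
by congr (Jop _ t); apply/funext => t'; rewrite h.
Qed.

Lemma wt_rev j p : wt id j (rev_pt p) = wt (@rev_ord 4) j p.
Proof.
rewrite /wt (reindex_inj (@rev_ord_inj 4)) /=.
by apply: eq_bigr => i _; rewrite ffunE rev_ordK.
Qed.

Lemma size_rev p : size_pt (rev_pt p) = size_pt p.
Proof. by rewrite !size_ptE !rev_ptE; lia. Qed.

Lemma symbol_J x : symbol q id x -> symbol q (@rev_ord 4) (Jterm x).
Proof.
have nJ s p : normc (tcoef (Jterm x) s p) = normc (tcoef x s (rev_pt p)).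
  by rewrite Normc.normcM normcN !normc_conj normc_phase mul1r.
case=> [rx|[k [sx ex dx [c hc]]]]; [left|right].
  by move=> n; have [c hc] := rx n; exists c => s p; rewrite nJ -size_rev.
exists k; split.
- by move=> j jk; rewrite ffunE sx.
- by move: ex; rewrite /even_pt !rev_ptE [_ i3 + _]addrC [_ i2 + _]addrC.
- move=> s s' p p' E; rewrite /= (dx s s' (rev_pt p) (rev_pt p'))// => j jk.
  by rewrite !ffunE E// rev_ordK.
- by exists c => s p; rewrite nJ -wt_rev.
Qed.

Variable J : H -> H.
Hypothesis hJ : real_structure J.

Lemma J_bvec s k : J (bvec R (s, k)) =
  phase (pos k) *: bvec R (s, rev_label k).
Proof.
have [_ Jket] := hJ; rewrite /bvec /=.
case E : (label_val k) => [[[l m1] m2] j].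
have lk : is_label l m1 m2 j by move: (labelP k); rewrite E.
rewrite Jket//; have := unpos_pos k; rewrite E /unpos => -[hl hm1 hm2 hj].
have := unpos_pos (rev_label k); rewrite pos_rev_label /unpos !rev_ptE => <-.
have /and3P[/forallP p0 _ _] := good_pos k.
congr (_ *: _).
  rewrite /phase; have := p0 i0; have := p0 i1; have := p0 i2; have := p0 i3.
  move: hl hm1 hm2 hj {p0}.
  case: (pos k i0) => // d; case: (pos k i1) => // a.
  case: (pos k i2) => // b; case: (pos k i3) => // c hl hm1 hm2 hj _ _ _ _.
  have -> : 2 * l + 1 = (d + a + b + c)%:R by rewrite !natrD -hl -!pmulrn; field.
  have -> : j + m1 = a%:R by rewrite -hm1 -hj -!pmulrn; field.
  by rewrite !Num.Theory.natrK.
have rev_sum (a b c d : rat) : d + c + b + a = a + b + c + d by ring.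
rewrite -hl -hm1 -hm2 -hj -!mulNr !opprB.
move: ((pos k i0)%:~R : rat) ((pos k i1)%:~R : rat) ((pos k i2)%:~R : rat) ((pos k i3)%:~R : rat).
by move=> d a b c; rewrite (rev_sum d a b c) (addrC b a).
Qed.

Lemma J_isometry (v : H) : normsq (J v) = normsq v.
Proof.
have [[_ iso] _] := hJ; have := congr1 (fun z => z ^+ 2) (iso v).
rewrite /l2norm !sqr_sqrtr ?fine_ge0 ?normsq_ge0//.
by move=> /(congr1 (@EFin R)); rewrite -!/(normsq _) !fineK ?normsq_fin.
Qed.

(* J is given on basis vectors only. If v' has no component along e, comparing
   the norms of v' + c e and of its image for a suitable c shows that J v' has
   no component along J e. *)
Lemma JE (v : H) t : J v t = Jop v t.
Proof.
case: t => s k; have [[anti _] _] := hJ.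
set k' := rev_label k; pose v' : H := v - v (s, k') *: bvec R (s, k').
have v'0 : v' (s, k') = 0.
  by rewrite /v' ell2B ell2Z bvecE eqxx mulr1 subrr.
have vE : v = v (s, k') *: bvec R (s, k') + v' by rewrite addrC subrK.
clearbody v'.
have Jadd (c : C) : J (c *: bvec R (s, k') + v') =
    (c^* * phase (pos k')) *: bvec R (s, k) + J v'.
  by rewrite anti J_bvec rev_labelK scalerA.
have bE s' k1 : bvec R (s', k1) (s', k1) = 1 by rewrite bvecE eqxx.
suff x0 : J v' (s, k) = 0.
  rewrite {1}vE Jadd ell2D x0 addr0 ell2Z bE mulr1 /Jop /=; exact: mulrC.
set z := J v' (s, k).
have ph := mul_conjc (normc_phase (pos k')).
(* With this c the image of c e is z J e up to phase, which doubles the component z of J v': the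
   squared norm of the image grows by 4|z|^2 - |z|^2, that of v' by |z|^2 only. *)
pose c := z^* * phase (pos k').
have cz : c^* * phase (pos k') = z.
  by rewrite /c rmorphM /= conjCK -mulrA [_^* * _]mulrC ph mulr1.
have nc : normc c = normc z by rewrite Normc.normcM normc_conj normc_phase mulr1.
have off (d : C) (w : H) s' k1 t : t != (s', k1) ->
    (d *: bvec R (s', k1) + w) t = w t.
  by move=> /negbTE tn; rewrite ell2D ell2Z bvecE tn mulr0 add0r.
have := @normsq_update _ _ (c *: bvec R (s, k') + v' : H) v' (s, k') (off _ _ _ _).
have := @normsq_update _ _ ((c^* * phase (pos k')) *: bvec R (s, k) + J v' : H) (J v') (s, k) (off _ _ _ _).
rewrite -Jadd !J_isometry Jadd !ell2D !ell2Z !bE !mulr1 v'0 addr0 cz -/z Normc.normc0 expr0n adde0 nc.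
rewrite -(fineK (normsq_fin (_ + _))) -(fineK (normsq_fin v')) -!EFinD.
move=> [h2] [h1]; apply: Normc.eq0_normc.
have n2 : normc (z + z) = 2 * normc z.
  have -> : z + z = 2%:~R * z by ring.
  by rewrite Normc.normcM normc_int.
move: h2; rewrite n2 exprMn => h2; apply/eqP; rewrite -sqrf_eq0; apply/eqP; lra.
Qed.

End RealStructure.

(** * The algebra of symbols *)

Section Adjoint.
Variables (R : realType) (q : R).
Hypothesis hq : 0 < q < 1.
Notation H := (spinor_space R).
Notation C := R[i].
Notation V := (bool * label -> C).
Notation normc := Normc.normc.
Implicit Types (s e : bool) (p : pt) (k : label) (t : bool * label).
Implicit Types (x y : term R) (P Q Z : term R -> Prop) (A B : V -> V).

Definition adj_term x : term R := Term (tflip x) (- tshift x)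
  (fun s p => (tcoef x (tflip x (+) s) (p - tshift x))^*).

Lemma act_bvec x t :
  (exists2 t', forall v, act (adj_term x) v t =
       (tcoef x t'.1 (pos t'.2))^* * v t' &
     forall u, act x (bvec R t) u = tcoef x t'.1 (pos t'.2) * bvec R t' u) \/
  (forall v, act (adj_term x) v t = 0) /\ forall u, act x (bvec R t) u = 0.
Proof.
case: t => s k; have [/goodP[k' kE]|g] := boolP (good (pos k - tshift x)).
  left; exists (tflip x (+) s, k').
    by move=> v; rewrite /act /= kE ext_pos.
  move=> [s' k1]; rewrite /act bvecE xpair_eqE /=.
  have [->|ne] := eqVneq k1 k'.
    rewrite -kE subrK ext_pos bvecE xpair_eqE eqxx !andbT.
    by have [->|] := eqVneq s' (tflip x (+) s); [rewrite addKb eqxx|case: (tflip x) s s' => [] [] []; rewrite ?mulr0].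
  rewrite andbF mulr0; have [/goodP[k2 k2E]|g] := boolP (good (pos k1 + tshift x)).
    rewrite k2E ext_pos bvecE xpair_eqE; case: (eqVneq k2 k) => [k2k|_]; last by rewrite andbF mulr0.
    by move: ne; rewrite -(inj_eq pos_inj) -kE -k2k -k2E addrK eqxx.
  by rewrite ext_bad ?mulr0.
right; split; first by move=> v; rewrite /act /= ext_bad ?mulr0.
move=> [s' k1]; rewrite /act /=.
have [/goodP[k2 k2E]|g2] := boolP (good (pos k1 + tshift x)); last by rewrite ext_bad ?mulr0.
rewrite k2E ext_pos bvecE xpair_eqE; case: (eqVneq k2 k) => [k2k|_]; last by rewrite andbF mulr0.
by move: g; rewrite -k2k -k2E addrK good_pos.
Qed.

(** The coordinate of T v at t is the inner product of S e_t and v, and S e_t is a finite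
    combination of basis vectors, one for each shift. *)
Lemma band_adjoint P Q A (S T : H -> H) :
  (forall x, P x -> Q (adj_term x)) -> band P A ->
  (forall (v : H) t, S v t = A v t) ->
  (forall u v, inner (S u) v = inner u (T v)) ->
  exists2 B, band Q B & forall (v : H) t, T v t = B v t.
Proof.
move=> PQ bA SA ST.
(* The induction runs over partial sums, which are only maps on families; so S e_t is replaced by
   any vector w with the coordinates of [A (bvec R t)]. *)
have [B bB hB] : exists2 B, band Q B &
    forall (w v : H) t, (forall u, w u = A (bvec R t) u) -> inner w v = B v t.
  elim: bA => [A' h|x A' B Px _ [B' bB' hB'] h].
    exists (fun _ _ => 0); first exact: band_nil.
    move=> w v t wA; rewrite (_ : w = 0 *: bvec R t) ?inner_bvec ?conjC0 ?mul0r//.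
    by apply: ell2P => u; rewrite wA h ell2Z mul0r.
  exists (fun v t => act (adj_term x) v t + B' v t).
    exact: band_cons (PQ _ Px) bB' _.
  move=> w v t wA; have [[t' h1 h2]|[h1 h2]] := act_bvec x t; rewrite h1.
    set c := tcoef _ _ _; pose w' : H := w - c *: bvec R t'.
    have -> : w = c *: bvec R t' + w' by rewrite addrC subrK.
    rewrite innerDl inner_bvec; congr (_ + _); apply: hB' => u.
    by rewrite /w' ell2B ell2Z wA h h2 -/c addrC addKr.
  by rewrite add0r; apply: hB' => u; rewrite wA h h2 add0r.
exists B => // v t; rewrite -inner_bvec1 -ST; apply: hB => u; exact: SA.
Qed.

Lemma size_ptN p : size_pt (- p) = size_pt p.
Proof. by apply: eq_bigr => i _; rewrite ffunE abszN. Qed.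

Lemma symbol_adj r x : symbol q r x -> symbol q r (adj_term x).
Proof.
case=> [rx|[k [sx ex dx [c hc]]]]; [left|right].
  move=> n; have [c hc] := rx n.
  exists (c * (size_pt (tshift x)).+1%:R ^+ n) => s p; rewrite normc_conj.
  apply: le_trans (ler_wpM2r _ (hc (tflip x (+) s) (p - tshift x))); last first.
    by rewrite exprn_ge0 ?ler0n.
  rewrite -mulrA ler_wpM2l ?normc_ge0// -exprMn lerXn2r ?nnegrE ?mulr_ge0 ?ler0n//.
  rewrite -natrM ler_nat; have := size_shift p (- tshift x); rewrite size_ptN.
  by clear; nia.
exists k; split => /=.
- by move=> i ki; rewrite ffunE sx// oppr0.
- have ev (a b : int) : ((a + b) %% 2)%Z == 0 -> ((- a + - b) %% 2)%Z == 0 by lia.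
  by move: ex; rewrite /even_pt !ffunE => /andP[? ?]; rewrite !ev.
- move=> s s' p p' E; congr (_^*); apply: dx => i ik; rewrite !ffunE E//.
- have c0 : 0 <= c.
    have := le_trans (normc_ge0 _) (hc true 0); rewrite pmulr_lge0//; exact: qX_gt0.
  exists (c * (q ^+ wt r k (- tshift x))^-1) => s p; rewrite normc_conj.
  apply: le_trans (hc _ _) _; rewrite -mulrA ler_wpM2l//.
  by apply: (qX_shift hq); exact: wt_shift.
Qed.

Definition scale_term (c : C) x : term R :=
  Term (tflip x) (tshift x) (fun s p => c * tcoef x s p).

Lemma symbol_scale r c x : symbol q r x -> symbol q r (scale_term c x).
Proof.
case=> [rx|[k [sx ex dx [d hd]]]]; [left|right].
  move=> n; have [d hd] := rx n; exists (normc c * d) => s p.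
  by rewrite Normc.normcM -mulrA ler_wpM2l ?normc_ge0.
exists k; split => //=; first by move=> s s' p p' E; congr (_ * _); exact: dx.
exists (normc c * d) => s p.
by rewrite Normc.normcM -mulrA ler_wpM2l ?normc_ge0.
Qed.

Lemma band_scale P c A : (forall x, P x -> P (scale_term c x)) -> band P A ->
  band P (fun v t => c * A v t).
Proof.
move=> Pc; elim=> [A' h|x A' B Px _ IH h].
  by apply: band_nil => v t; rewrite h mulr0.
apply: band_cons (Pc _ Px) IH _ => v t.
by rewrite h mulrDr /act /= mulrA.
Qed.

(** Pure weights do not see the chirality, so the flip in D leaves only the constant by which the
    shift changes l. For rapid weights nothing cancels, but their decay absorbs the linear growth of
    the eigenvalue. *)
Lemma symbol_dterm r x : symbol q r x -> symbol q r (dterm true x).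
Proof.
case=> [rx|[k [sx ex dx [c hc]]]]; [left|right].
  move=> n; have [c hc] := rx n.+1.
  exists (c + (size_pt (tshift x)).+1%:R * c) => s p.
  apply: le_trans (ler_wpM2r _ (normcB _ _)) _; first by rewrite exprn_ge0 ?ler0n.
  have S0 (m : nat) : 0 <= m%:R :> R by rewrite ler0n.
  have e1 := normc_ev R p; have e2 := normc_ev R (p + tshift x).
  have e3 : (size_pt (p + tshift x)).+1%:R <=
      (size_pt p).+1%:R * (size_pt (tshift x)).+1%:R :> R.
    rewrite -natrM ler_nat; have := size_shift (p + tshift x) (- tshift x).
    by rewrite addrK size_ptN; clear; nia.
  rewrite mulrDl; apply: lerD.
    apply: le_trans (hc (true (+) s) p); rewrite Normc.normcM exprS mulrA.
    by rewrite ler_wpM2r ?exprn_ge0// mulrC ler_wpM2l ?normc_ge0.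
  apply: le_trans (ler_wpM2l (S0 _) (hc s p)); rewrite Normc.normcM exprS.
  rewrite [leRHS](_ : _ = normc (tcoef x s p) * ((size_pt p).+1%:R *
    (size_pt (tshift x)).+1%:R) * (size_pt p).+1%:R ^+ n); last by ring.
  rewrite ler_wpM2r ?exprn_ge0// mulrC ler_wpM2l ?normc_ge0//.
  exact: le_trans e2 _.
pose n : int := tshift x i0 + tshift x i1 + tshift x i2 + tshift x i3.
have evB p : ev R p - ev R (p + tshift x) = - (n%:~R / 2).
  by rewrite -opprB evD.
exists k; split => //=.
  move=> s s' p p' E; rewrite (dx (~~ s) s p p)// (dx (~~ s') s' p' p')//.
  by rewrite -!mulrBl !evB; congr (_ * _); exact: dx.
exists (`|n|%N%:R / 2 * c) => s p; rewrite (dx (~~ s) s p p)// -mulrBl Normc.normcM.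
by rewrite evB normcN normc_half -[leRHS]mulrA ler_wpM2l.
Qed.

End Adjoint.

(** * Symbols of the represented algebra and the resulting commutators *)

Section Algebra.
Variables (R : realType) (q : R) (hq : 0 < q < 1).
Notation H := (spinor_space R).
Variables (A : algType R[i]) (star : A -> A) (x : 'I_3 -> A)
  (pi : A -> H -> H).
Hypothesis star_ax : star_axioms star.
Hypothesis rep : star_representation star pi.
Hypothesis gen : forall P : A -> Prop,
    P 1 -> (forall i, P (x i)) ->
    (forall (c : R[i]) a b, P a -> P b -> P (c *: a + b)) ->
    (forall a b, P a -> P b -> P (a * b)) ->
    (forall a, P a -> P (star a)) -> forall a, P a.

Definition has_symbol (S : H -> H) :=
  exists2 B, band (symbol q id) B & forall (v : H) t, S v t = B v t.

(** Stated for the adjoints: the given coefficients of x_i are indexed by the source of a shift,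
    which is the target of the adjoint shift. *)
Hypothesis gens : forall i, has_symbol (pi (star (x i))).

Lemma has_symbol1 : has_symbol (pi 1).
Proof.
pose one := Term false 0 (fun (_ : bool) (_ : pt) => 1 : R[i]).
exists (act one).
  apply: (@band1 _ _ one) => //; right; exists 0%N; split=> //.
  - by move=> i _; rewrite ffunE.
  - by rewrite /even_pt !ffunE.
  - exists 1 => s p; rewrite Normc.normc1 mul1r /wt big_pred0 ?expr0//.
by move=> v [s k]; rewrite (rep1 rep) /act /= addr0 mul1r ext_pos.
Qed.

Lemma has_symbol_adj (S T : H -> H) : has_symbol S ->
  (forall u v, inner (S u) v = inner u (T v)) -> has_symbol T.
Proof.
case=> B bB SB ST; have [B' bB' TB] := band_adjoint (@symbol_adj _ _ hq id) bB SB ST.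
by exists B'.
Qed.

Lemma representation_symbol a : has_symbol (pi a).
Proof.
(* The adjoint is carried along, so that closure under [star] is a mere exchange. *)
suff [] : has_symbol (pi a) /\ has_symbol (pi (star a)) by [].
have star1 : star 1 = 1.
  have := starM star_ax (star 1) 1; rewrite mulr1 (starK star_ax) mulr1.
  by [].
elim/gen: a => [|i|c a b [a1 a2] [b1 b2]|a b [a1 a2] [b1 b2]|a [a1 a2]].
- by rewrite star1; split; exact: has_symbol1.
- split=> //; apply: has_symbol_adj (gens i) _ => u v; exact: (rep_star rep).
- have lin (k : R[i]) a' b' : has_symbol (pi a') -> has_symbol (pi b') ->
      has_symbol (pi (k *: a' + b')).
    move=> [B bB hB] [B' bB' hB']; exists (fun v t => k * B v t + B' v t).
      have h y : symbol q id y -> symbol q id (scale_term k y) by exact: symbol_scale.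
      exact: band_add (band_scale h bB) bB'.
    by move=> v t; rewrite (repZD rep) ell2D ell2Z hB hB'.
  by rewrite (starZD star_ax); split; exact: lin.
- have mul a' b' : has_symbol (pi a') -> has_symbol (pi b') -> has_symbol (pi (a' * b')).
    move=> [B bB hB] [B' bB' hB']; exists (fun v => B (B' v)).
      have h y z : symbol q id y -> symbol q id z ->
        band (symbol q id) (fun v => act y (act z v)) by exact: symbol_comp.
      exact: band_comp h bB bB'.
    move=> v t; rewrite (repM rep) hB; congr (B _ t); apply/funext => t'.
    exact: hB'.
  by rewrite (starM star_ax); split; exact: mul.
- by rewrite (starK star_ax).
Qed.

Variable J : H -> H.
Hypothesis hJ : real_structure J.

Lemma commutator_smoothing (S : H -> H) b : has_symbol S ->
  smoothing (Dirac_diag false) (commutator S (fun v => J (pi b (J v)))).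
Proof.
case=> B bB SB; have [B' bB' hB'] := representation_symbol b.
have bJ := band_J (@symbol_J _ q) bB'.
pose K := band_comm (symbol_commute hq) bB bJ.
apply: (band_smoothing K) => v t; rewrite /commutator ell2B SB.
have JJ (w : H) : J (pi b (J w)) = Jop (B' (Jop w)) :> (bool * label -> R[i]).
  apply/funext => t'; rewrite (JE hJ); congr (Jop _ t'); apply/funext => t1.
  by rewrite hB'; congr (B' _ t1); apply/funext => t2; exact: JE.
by rewrite JJ JJ; congr (_ - Jop (B' (Jop _)) t); apply/funext => t'; exact: SB.
Qed.

Lemma symbol_conclusion a b : let JbJ := fun v => J (pi b (J v)) in
  smoothing (Dirac_diag false) (commutator (pi a) JbJ) /\
  exists Da : H -> H,
    bounded_commutator Dirac (pi a) Da /\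
    smoothing (Dirac_diag false) (commutator Da JbJ).
Proof.
move=> JbJ; have sa := representation_symbol a.
split; first exact: commutator_smoothing.
case: sa => B bB hB.
have [B' bB' h] := band_Dirac (@symbol_dterm _ q id) bB.
have bdB' := band_subset (@symbol_bdd _ _ hq id) bB'.
have [Da DaB] := band_ell2 bdB'; exists Da; split.
  exact: band_bounded_commutator h.
by apply: commutator_smoothing; exists B'.
Qed.

End Algebra.

(** * Coefficients of the generators *)

Section QNumbers.
Variables (R : realType) (q : R).
Hypothesis hq : 0 < q < 1.
Implicit Types (x y z e : rat) (m n r : nat).

Let q0 : 0 < q. Proof. by case/andP: hq. Qed.
Let q1 : q < 1. Proof. by case/andP: hq. Qed.

Lemma qpowD x y : qpow q (x + y) = qpow q x * qpow q y.
Proof. by rewrite /qpow rmorphD /= powRD//; apply/implyP => _; rewrite gt_eqF. Qed.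

Lemma qpow_gt0 x : 0 < qpow q x. Proof. exact: powR_gt0. Qed.

Lemma qpowN x : qpow q (- x) = (qpow q x)^-1.
Proof. by rewrite /qpow rmorphN /= powRN. Qed.

Lemma qpow_nat n : qpow q n%:R = q ^+ n.
Proof. by rewrite /qpow ratr_nat powR_mulrn// ltW. Qed.

(** From [n] = q^(-n) (1 - q^(2n)) / (q^(-1) - q): numerators and denominators of the coefficients
    become powers of q times [sq], [iq], which tend to 1, and powers of [kq]. *)
Definition sq n : R := Num.sqrt (1 - q ^+ (2 * n)).
Definition iq n : R := (1 - q ^+ (2 * n))^-1.
Definition kq : R := q^-1 - q.

Lemma kq_gt0 : 0 < kq.
Proof. by rewrite /kq subr_gt0 (lt_trans q1)// invf_gt1. Qed.

Lemma qnum_nat n : qnum q n%:R = (q ^+ n)^-1 * (1 - q ^+ (2 * n)) / kq.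
Proof.
rewrite /qnum qpowN qpow_nat /kq -[q - q^-1]opprB invrN mulrN -mulNr opprB.
congr (_ / _); rewrite mulrBr mulr1 mulnC exprM expr2 mulKf//.
by rewrite expf_neq0// gt_eqF.
Qed.

Lemma one_sub_ge0 n : 0 <= 1 - q ^+ (2 * n).
Proof. by rewrite subr_ge0 exprn_ile1// ltW. Qed.

Lemma sqrt_qnum m n : Num.sqrt (qnum q m%:R * qnum q n%:R) =
  qpow q (- (m%:R + n%:R) / 2) * sq m * sq n / kq.
Proof.
have E : (q ^+ m)^-1 * (q ^+ n)^-1 = qpow q (- (m%:R + n%:R) / 2) ^+ 2.
  rewrite expr2 -qpowD -splitr opprD qpowD !qpowN !qpow_nat.
  by [].
rewrite !qnum_nat.
rewrite (_ : _ * _ = (qpow q (- (m%:R + n%:R) / 2) / kq) ^+ 2 *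
  ((1 - q ^+ (2 * m)) * (1 - q ^+ (2 * n)))); last first.
  by rewrite exprMn -E exprVn expr2 invfM; ring.
rewrite sqrtrM ?sqr_ge0// sqrtr_sqr ger0_norm; last first.
  by rewrite divr_ge0// ltW// ?qpow_gt0 ?kq_gt0.
by rewrite sqrtrM ?one_sub_ge0// /sq; ring.
Qed.

Lemma inv_qnum n : (qnum q n%:R)^-1 = q ^+ n * kq * iq n.
Proof. by rewrite qnum_nat !invfM !invrK /iq mulrAC. Qed.

(** The common normal form of the coefficients: the powers of q^(-1) - q cancel, and e' collects the
    powers of q. *)
Lemma coef_shape e x y z m n r e' : x = m%:R -> y = n%:R -> z = r%:R ->
  e - (x + y) / 2 + z = e' ->
  qpow q e * Num.sqrt (qnum q x * qnum q y) / qnum q z =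
  qpow q e' * sq m * sq n * iq r.
Proof.
move=> -> -> -> <-; rewrite sqrt_qnum inv_qnum !qpowD -mulNr qpow_nat.
by field; rewrite gt_eqF// kq_gt0.
Qed.

Lemma sq_le1 n : sq n <= 1.
Proof.
by rewrite -[leRHS]sqrtr1 ler_wsqrtr// gerBl exprn_ge0// ltW.
Qed.

Lemma sq_ge0 n : 0 <= sq n. Proof. exact: sqrtr_ge0. Qed.

Lemma sq_near1 n : `|sq n - 1| <= q ^+ n.
Proof.
rewrite distrC ger0_norm ?subr_ge0 ?sq_le1//.
have h : (1 - sq n) * (1 + sq n) = q ^+ n * q ^+ n.
  rewrite -subr_sqr expr1n sqr_sqrtr ?one_sub_ge0//.
  by rewrite opprB addrC subrK -exprD mul2n -addnn.
have : (1 - sq n) * 1 <= (1 - sq n) * (1 + sq n).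
  by rewrite ler_wpM2l ?subr_ge0 ?sq_le1// lerDl sq_ge0.
rewrite h mulr1 => /le_trans; apply.
by rewrite ler_piMr ?exprn_ge0 ?exprn_ile1// ltW.
Qed.

Lemma iq_near1 n : `|iq n - 1| <= (1 - q ^+ 2)^-1 * q ^+ n.
Proof.
have e1 : 0 < 1 - q ^+ 2 by rewrite subr_gt0 exprn_ilt1// ltW.
case: n => [|n].
  (* At n = 0 the inverse takes its default value 0, at distance 1 from 1. *)
  rewrite /iq muln0 expr0 subrr invr0 sub0r normrN normr1 mulr1.
  by rewrite invf_ge1// gerBl exprn_ge0// ltW.
have e2 : 0 < 1 - q ^+ (2 * n.+1) by rewrite subr_gt0 exprn_ilt1// ltW.
have -> : iq n.+1 - 1 = q ^+ (2 * n.+1) * iq n.+1.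
  by rewrite /iq; field; rewrite gt_eqF.
rewrite ger0_norm ?mulr_ge0 ?exprn_ge0 ?invr_ge0 ?(ltW e2) ?(ltW q0)// mulrC.
apply: ler_pM; rewrite ?invr_ge0 ?exprn_ge0 ?(ltW e2) ?(ltW q0)//.
  rewrite lef_pV2 ?posrE// lerD2l lerN2; apply: ler_wiXn2l; rewrite ?(ltW q0) ?(ltW q1)//.
  by rewrite mulnS leq_addr.
by apply: ler_wiXn2l; rewrite ?(ltW q0) ?(ltW q1)// mul2n -addnn leq_addr.
Qed.

End QNumbers.

(** * The coefficients in natural coordinates *)

Section Coefficients.
Variables (R : realType) (q : R).
Hypothesis hq : 0 < q < 1.
Local Notation sq := (sq q).
Local Notation iq := (iq q).

Lemma eps_half l j m2 n : l + 2^-1 - j - m2 = n%:R * 2 -> eps l j m2 = 2^-1.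
Proof. by rewrite /eps => ->; rewrite mulfK// natr_nat. Qed.

Lemma eps_half_neg l j m2 n : l + 2^-1 - j - m2 = n%:R * 2 - 1 ->
  eps l j m2 = - 2^-1.
Proof.
rewrite /eps => ->; case: ifPn => // /natrP[m hm].
have : (n * 2)%:R = (m * 2 + 1)%:R :> rat.
  rewrite natrD !natrM -hm; move: (n%:R : rat) => z; lra.
by move/eqP; rewrite eqr_nat => /eqP; lia.
Qed.

(** As d + c is odd, o is the parity of d and the opposite of that of c. Then eps = o - 1/2, and the
    arguments of the q-numbers turn into integers, linear in k, k', a, b and o for each value of
    o. *)
Variables (k k' a b : nat) (o : bool) (l m1 m2 j : rat).
Let d := (k * 2 + o)%N.
Let c := (k' * 2 + ~~ o)%N.
Let N := (d + a + b + c)%N.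
Hypothesis hl : l = (k%:R * 2 + a%:R + b%:R + k'%:R * 2) / 2.
Hypothesis hm1 : m1 = (a%:R - b%:R) / 2.
Hypothesis hm2 : m2 = (k%:R * 2 + o%:R - (k'%:R * 2 + (~~ o)%:R)) / 2.
Hypothesis hj : j = (a%:R + b%:R) / 2.

Lemma eps_label : eps l j m2 = o%:R - 2^-1.
Proof.
rewrite hl hm2 hj; case: (o).
  by rewrite (@eps_half _ _ _ k')//=; field.
by rewrite (@eps_half_neg _ _ _ k'.+1)//= -[k'.+1]addn1 natrD; field.
Qed.

Local Ltac linear_rat :=
  rewrite ?natrD ?natrM; case: (o) => /=; rewrite ?natrD ?natrM; lra.

Lemma qpow0 : qpow q 0 = 1.
Proof. by rewrite /qpow rmorph0 powRr0. Qed.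

Lemma coefDp_nat : coefDp q l j m2 =
  sq (k * 2 + 2) * sq (d + a + b + 2 + o) * iq (N + 3).
Proof.
rewrite /coefDp eps_label (@coef_shape _ _ hq _ _ _ _ (d + a + b + 2 + o)
  (k * 2 + 2) (N + 3) 0) /N /d /c ?hl ?hm2 ?hj; do ?[linear_rat].
by rewrite qpow0 mul1r [sq _ * sq _]mulrC.
Qed.

Lemma coefDm_nat : coefDm q l j m2 =
  - (q ^+ (2 * d + a + b + 2) * sq (k' * 2) * sq (c + a + b + ~~ o) * iq (N + 1)).
Proof.
rewrite /coefDm eps_label mulNr mulNr (@coef_shape _ _ hq _ _ _ _ (k' * 2)
  (c + a + b + ~~ o) (N + 1) (2 * d + a + b + 2)%:R)
  /N /d /c ?hl ?hm2 ?hj; do ?[linear_rat].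
by rewrite (qpow_nat hq).
Qed.

Lemma coefCp_nat : coefCp q l j m2 = - (q ^+ (k * 2) *
  sq (d + a + b + 2 + o) * sq (c + a + b + 2 + ~~ o) * iq (N + 3)).
Proof.
rewrite /coefCp eps_label mulNr mulNr (@coef_shape _ _ hq _ _ _ _
  (d + a + b + 2 + o) (c + a + b + 2 + ~~ o) (N + 3) (k * 2)%:R)
  /N /d /c ?hl ?hm2 ?hj; do ?[linear_rat].
by rewrite (qpow_nat hq).
Qed.

Lemma coefCm_nat : coefCm q l j m2 = - (q ^+ (d + a + b + o) *
  sq (k * 2) * sq (k' * 2) * iq (N + 1)).
Proof.
rewrite /coefCm eps_label mulNr mulNr (@coef_shape _ _ hq _ _ _ _
  (k * 2) (k' * 2) (N + 1) (d + a + b + o)%:R)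
  /N /d /c ?hl ?hm2 ?hj; do ?[linear_rat].
by rewrite (qpow_nat hq).
Qed.

Lemma eps_label_diag s : eps (l + s) (j + s) m2 = o%:R - 2^-1.
Proof. by rewrite -eps_label /eps; congr (if _ / 2 \is a _ then _ else _); ring. Qed.

Lemma eps_label_anti : eps (l + 1) (j - 1) m2 = o%:R - 2^-1.
Proof.
rewrite hl hm2 hj; case: (o).
  by rewrite (@eps_half _ _ _ k'.+1)//= -[k'.+1]addn1 natrD; field.
by rewrite (@eps_half_neg _ _ _ k'.+2)//= -[k'.+2]addn2 natrD; field.
Qed.

Lemma eps_label_l : eps (l - 1) j m2 = (~~ o)%:R - 2^-1.
Proof.
rewrite hl hm2 hj; case: (o).
  by rewrite (@eps_half_neg _ _ _ k')//=; field.
by rewrite (@eps_half _ _ _ k')//=; field.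
Qed.

Lemma eps_label_j : eps l (j - 1) m2 = (~~ o)%:R - 2^-1.
Proof.
rewrite hl hm2 hj; case: (o).
  by rewrite (@eps_half_neg _ _ _ k'.+1)//= -[k'.+1]addn1 natrD; field.
by rewrite (@eps_half _ _ _ k'.+1)//= -[k'.+1]addn1 natrD; field.
Qed.

Lemma coefCm_anti_nat : coefCm q (l + 1) (j - 1) m2 = - (q ^+ (d + a + b + o) *
  sq (k * 2 + 2) * sq (k' * 2 + 2) * iq (N + 3)).
Proof.
rewrite /coefCm eps_label_anti mulNr mulNr (@coef_shape _ _ hq _ _ _ _
  (k * 2 + 2) (k' * 2 + 2) (N + 3) (d + a + b + o)%:R)
  /N /d /c ?hl ?hm2 ?hj; do ?[linear_rat].
by rewrite (qpow_nat hq).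
Qed.

Lemma coefCp_diag_nat : coefCp q (l - 1) (j - 1) m2 = - (q ^+ (k * 2) *
  sq (d + a + b + o) * sq (c + a + b + ~~ o) * iq (N + 1)).
Proof.
rewrite /coefCp eps_label_diag mulNr mulNr (@coef_shape _ _ hq _ _ _ _
  (d + a + b + o) (c + a + b + ~~ o) (N + 1) (k * 2)%:R)
  /N /d /c ?hl ?hm2 ?hj; do ?[linear_rat].
by rewrite (qpow_nat hq).
Qed.

Lemma coefHp_nat : coefHp q l j m2 =
  if o then q ^+ (d + a + b + 1) * sq (c + a + b + 2) * sq (d + 1) * iq (N + 3)
  else q ^+ d * sq (c + 1) * sq (d + a + b + 2) * iq (N + 3).
Proof.
rewrite /coefHp eps_label /N /d /c hl hm2 hj; case: (o) => /=.
  rewrite (@coef_shape _ _ hq _ _ _ _ (k' * 2 + 0 + a + b + 2) (k * 2 + 1 + 1)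
    (k * 2 + 1 + a + b + (k' * 2 + 0) + 3) (k * 2 + 1 + a + b + 1)%:R);
    do ?[by rewrite ?natrD ?natrM; lra].
  by rewrite (qpow_nat hq).
rewrite (@coef_shape _ _ hq _ _ _ _ (k' * 2 + 1 + 1) (k * 2 + 0 + a + b + 2)
  (k * 2 + 0 + a + b + (k' * 2 + 1) + 3) (k * 2 + 0)%:R);
  do ?[by rewrite ?natrD ?natrM; lra].
by rewrite (qpow_nat hq).
Qed.

Lemma coefHp_l_nat : coefHp q (l - 1) j m2 =
  if o then q ^+ (k * 2) * sq c * sq (d + a + b + 1) * iq (N + 1)
  else q ^+ (d + a + b) * sq (c + a + b + 1) * sq d * iq (N + 1).
Proof.
rewrite /coefHp eps_label_l /N /d /c hl hm2 hj; case: (o) => /=.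
  rewrite (@coef_shape _ _ hq _ _ _ _ (k' * 2 + 0) (k * 2 + 1 + a + b + 1)
    (k * 2 + 1 + a + b + (k' * 2 + 0) + 1) (k * 2)%:R);
    do ?[by rewrite ?natrD ?natrM; lra].
  by rewrite (qpow_nat hq).
rewrite (@coef_shape _ _ hq _ _ _ _ (k' * 2 + 1 + a + b + 1) (k * 2 + 0)
  (k * 2 + 0 + a + b + (k' * 2 + 1) + 1) (k * 2 + 0 + a + b)%:R);
  do ?[by rewrite ?natrD ?natrM; lra].
by rewrite (qpow_nat hq).
Qed.

Lemma coefAp_nat : coefAp q j m1 =
  q ^+ a * sq (a + 1) * sq (b + 1) * iq (a + b + 2).
Proof.
rewrite /coefAp (@coef_shape _ _ hq _ _ _ _ (a + 1) (b + 1) (a + b + 2) a%:R)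
  ?hm1 ?hj; do ?[by rewrite ?natrD; lra].
by rewrite (qpow_nat hq).
Qed.

Lemma coefAp_pred_nat : coefAp q (j - 1) m1 =
  qpow q (-1) * q ^+ a * sq a * sq b * iq (a + b).
Proof.
rewrite /coefAp (@coef_shape _ _ hq _ _ _ _ a b (a + b) (-1 + a%:R))
  ?hm1 ?hj; do ?[by rewrite ?natrD; lra].
by rewrite (qpowD hq) (qpow_nat hq).
Qed.

Lemma coefBp_nat : coefBp q j m1 = sq (a + 1) * sq (a + 2) * iq (a + b + 2).
Proof.
rewrite /coefBp (@coef_shape _ _ hq _ _ _ _ (a + 1) (a + 2) (a + b + 2) 0)
  ?hm1 ?hj; do ?[by rewrite ?natrD; lra].
by rewrite qpow0 mul1r.
Qed.

Lemma coefBm_nat : coefBm q j m1 =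
  - (q ^+ (2 * a + 1) * sq b * sq b.-1 * iq (a + b)).
Proof.
(* At b = 0 the truncated [b.-1] differs from b - 1, but the factor [b] = 0 annihilates both
   sides. *)
rewrite /coefBm mulNr mulNr; have [b0|b0] := posnP b.
  have -> : j - m1 = 0%:R by rewrite hj hm1 b0; lra.
  have qn0 : qnum q 0%:R = 0 by rewrite qnum_nat// muln0 subrr mulr0 mul0r.
  by rewrite qn0 mul0r sqrtr0 b0 /sq muln0 subrr sqrtr0 !mulr0 !mul0r.
have bE : b%:R = b.-1%:R + 1 :> rat by rewrite -[in LHS](prednK b0) -addn1 natrD.
rewrite (@coef_shape _ _ hq _ _ _ _ b b.-1 (a + b) (2 * a + 1)%:R)
  ?hm1 ?hj; do ?[by rewrite ?natrD ?natrM bE; lra].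
by rewrite (qpow_nat hq).
Qed.

Definition iq_max : R := 1 + (1 - q ^+ 2)^-1.

Lemma iq_maxP n : `|iq n| <= iq_max.
Proof.
have h := iq_near1 hq n; rewrite -[iq n](subrK 1).
apply: le_trans (ler_normD _ _) _; rewrite normr1 addrC lerD2l.
apply: le_trans h _; rewrite ler_piMr ?qX_le1//.
by rewrite invr_ge0 subr_ge0 (qX_le1 hq).
Qed.

Lemma sq_norm n : `|sq n| <= 1.
Proof. by rewrite ger0_norm ?(sq_le1 hq) ?sq_ge0. Qed.

Definition tq n : R := 1 - q ^+ (2 * n).

Lemma tq_norm n : `|tq n| <= 1.
Proof.
by rewrite ger0_norm ?one_sub_ge0// gerBl (qX_ge0 hq).
Qed.

Let q_neq0 : q != 0. Proof. by case/andP: hq => /gt_eqF ->. Qed.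
Let kq_neq0 : kq q != 0. Proof. by rewrite gt_eqF// kq_gt0. Qed.

Lemma quot_shape x1 x2 y1 y2 r : (x1 + x2 + r = y1 + y2)%N ->
  qnum q x1%:R * qnum q x2%:R / (qnum q y1%:R * qnum q y2%:R) =
  q ^+ r * tq x1 * tq x2 * iq y1 * iq y2.
Proof.
move=> E; rewrite invfM !inv_qnum// !qnum_nat// -/(tq x1) -/(tq x2).
have -> : q ^+ y1 * kq q * iq y1 * (q ^+ y2 * kq q * iq y2) =
    q ^+ (x1 + x2 + r) * kq q ^+ 2 * iq y1 * iq y2 by rewrite E exprD; ring.
by rewrite !exprD; field; rewrite kq_neq0 !expf_neq0.
Qed.

(** The point is the factor q^(a + b) in front; its cofactor is bounded and depends on a and b
    only. *)
Lemma coefA0_nat : coefA0 q j m1 = q ^+ (a + b) *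
  (qpow q (-2) * kq q * q ^+ 2 * iq (a + b) * iq (a + b + 2) *
   (q ^+ (2 * a + 1) * qnum q 2 * tq b - tq (a + b))).
Proof.
rewrite /coefA0.
have -> : j + m1 + 1 = (a + 1)%:R by rewrite hj hm1 natrD; lra.
have -> : j - m1 = b%:R by rewrite hj hm1; lra.
have -> : 2 * j = (a + b)%:R by rewrite hj natrD; lra.
have -> : (a + b)%:R + 2 = (a + b + 2)%:R :> rat by rewrite !natrD.
rewrite invfM !inv_qnum// (qpow_nat hq) (qnum_nat hq b) (qnum_nat hq (a + b)).
rewrite -/(tq b) -/(tq (a + b)) mul2n -addnn !exprD.
by field; rewrite kq_neq0 !expf_neq0.
Qed.

Lemma coefB0_nat : coefB0 q j m1 = q ^+ (a + b) *
  ((1 + q ^+ 2) * qpow q (-1) * q ^+ (a + 2) * kq q *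
   sq b * sq (a + 1) * iq (a + b) * iq (a + b + 2)).
Proof.
rewrite /coefB0.
have -> : 2 * j + 2 = (a + b + 2)%:R by rewrite hj !natrD; lra.
have E (x y z u v : R) : x * y * z / (u * v) = x * (y * z / u) * v^-1.
  by rewrite invfM !mulrA.
rewrite E (@coef_shape _ _ hq _ _ _ _ b (a + 1) (a + b) (-1 + a%:R));
  do ?[by rewrite ?natrD ?hm1 ?hj; lra].
rewrite inv_qnum// (qpowD hq) (qpow_nat hq) !exprD; ring.
Qed.

(** One constant for C^0 and D^0: the prefactor is [2] or [-2], the remaining exponent of q is at
    least -2, and there are two factors [iq]. *)
Definition tail_cst : R :=
  (`|qnum q 2| + `|qnum q (-2)|) * qpow q (-2) * kq q * iq_max ^+ 2.

Lemma qpowN2_ge1 : 1 <= qpow q (-2).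
Proof.
have -> : qpow q (-2) = (q ^+ 2)^-1 by rewrite qpowN -(qpow_nat hq).
by rewrite invf_ge1 ?qX_gt0 ?qX_le1.
Qed.

Lemma tail_bound (A B : R) n1 n2 r1 r2 M : `|A| <= `|qnum q 2| + `|qnum q (-2)| ->
  0 <= B <= qpow q (-2) -> (N <= M)%N ->
  `|A * (B * sq n1 * sq n2 * iq r1) * (q ^+ M * kq q * iq r2)| <=
  tail_cst * q ^+ N.
Proof.
move=> hA /andP[B0 hB] NM; rewrite !normrM (ger0_norm B0).
rewrite (ger0_norm (qX_ge0 hq M)) (ger0_norm (ltW (kq_gt0 hq))).
have -> : tail_cst * q ^+ N = (`|qnum q 2| + `|qnum q (-2)|) *
    (qpow q (-2) * 1 * 1 * iq_max) * (q ^+ N * kq q * iq_max).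
  by rewrite /tail_cst; ring.
have [k0 qN] := (ltW (kq_gt0 hq), qX_ge0 hq).
have B2 : 0 <= qpow q (-2) by apply: ltW; exact: qpow_gt0.
have [[[s1 s2] s3] s4] := (sq_norm n1, sq_norm n2, iq_maxP r1, iq_maxP r2).
have qNM := qX_le hq NM.
by do !(apply: ler_pM => //); rewrite ?mulr_ge0.
Qed.

Lemma coef_shape2 e x y z z' m n r r' e' :
  x = m%:R -> y = n%:R -> z = r%:R -> z' = r'%:R -> e - (x + y) / 2 + z = e' ->
  qpow q e * Num.sqrt (qnum q x * qnum q y) / (qnum q z * qnum q z') =
  qpow q e' * sq m * sq n * iq r * (q ^+ r' * kq q * iq r').
Proof.
move=> hx hy hz -> he; rewrite -(coef_shape hq hx hy hz he).
by rewrite invfM (inv_qnum hq r') !mulrA.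
Qed.

Lemma qpow_bound n : 0 <= qpow q n%:R <= qpow q (-2).
Proof.
rewrite (qpow_nat hq) (qX_ge0 hq) (le_trans (qX_le1 hq n))//.
exact: qpowN2_ge1.
Qed.

Lemma mulr_group (x y z u : R) : x * y * z / u = x * (y * z / u).
Proof. by rewrite !mulrA. Qed.

Lemma coefC0_bound : `|coefC0 q l j m2| <= tail_cst * q ^+ N.
Proof.
rewrite /coefC0 eps_label mulr_group.
case E : (o).
  rewrite (@coef_shape2 _ _ _ _ _ (c + a + b + 2) c (N + 1) (N + 3) (2 * d + a + b)%:R);
    do ?[by rewrite /N /d /c hl ?hm2 ?hj E /= ?natrD ?natrM; lra].
  rewrite mulrA; apply: tail_bound (qpow_bound _) _; last by rewrite leq_addr.
  by rewrite (_ : 4 * _ = 2) ?lerDl//=; lra.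
rewrite (@coef_shape2 _ _ _ _ _ (d + a + b + 2) d (N + 1) (N + 3) (-2));
  do ?[by rewrite /N /d /c hl ?hm2 ?hj E /= ?natrD ?natrM; lra].
rewrite mulrA; apply: tail_bound; last by rewrite leq_addr.
  by rewrite (_ : 4 * _ = -2) ?lerDr//=; lra.
by rewrite lexx ltW ?qpow_gt0.
Qed.

Lemma coefC0_pred_bound : `|coefC0 q l (j - 1) m2| <= tail_cst * q ^+ N.
Proof.
rewrite /coefC0 eps_label_j mulr_group.
case E : (o).
  rewrite (@coef_shape2 _ _ _ _ _ (d + a + b + 1) (d + 1) (N + 1) (N + 3) (-2));
    do ?[by rewrite /N /d /c hl ?hm2 ?hj E /= ?natrD ?natrM; lra].
  rewrite mulrA; apply: tail_bound; last by rewrite leq_addr.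
    by rewrite (_ : 4 * _ = -2) ?lerDr//=; lra.
  by rewrite lexx ltW ?qpow_gt0.
rewrite (@coef_shape2 _ _ _ _ _ (c + a + b + 1) (c + 1) (N + 1) (N + 3) (2 * d + a + b)%:R);
  do ?[by rewrite /N /d /c hl ?hm2 ?hj E /= ?natrD ?natrM; lra].
rewrite mulrA; apply: tail_bound (qpow_bound _) _; last by rewrite leq_addr.
by rewrite (_ : 4 * _ = 2) ?lerDl//=; lra.
Qed.

Lemma coefD0_bound : `|coefD0 q l j m2| <= tail_cst * q ^+ N.
Proof.
rewrite /coefD0 eps_label mulr_group.
case E : (o).
  rewrite (@coef_shape2 _ _ _ _ _ c (d + 1) (N + 1) (N + 3) (d + a + b + 1)%:R);
    do ?[by rewrite /N /d /c hl ?hm2 ?hj E /= ?natrD ?natrM; lra].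
  by rewrite mulrA; apply: tail_bound (qpow_bound _) _; rewrite ?lerDl ?leq_addr.
rewrite (@coef_shape2 _ _ _ _ _ (c + a + b + 1) (d + a + b + 2) (N + 1) (N + 3) d%:R);
  do ?[by rewrite /N /d /c hl ?hm2 ?hj E /= ?natrD ?natrM; lra].
by rewrite mulrA; apply: tail_bound (qpow_bound _) _; rewrite ?lerDl ?leq_addr.
Qed.

Definition H0_cst : R := (1 + qpow q (-2)) * iq_max ^+ 2.

Lemma quot_bound x1 x2 y1 y2 r : (x1 + x2 + r = y1 + y2)%N -> (d + c <= r)%N ->
  `|qnum q x1%:R * qnum q x2%:R / (qnum q y1%:R * qnum q y2%:R)| <=
  iq_max ^+ 2 * q ^+ (d + c).
Proof.
move=> /quot_shape-> dr; rewrite !normrM (ger0_norm (qX_ge0 hq r)).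
have -> : iq_max ^+ 2 * q ^+ (d + c) = q ^+ (d + c) * 1 * 1 * iq_max * iq_max by ring.
have [[[s1 s2] s3] s4] := (tq_norm x1, tq_norm x2, iq_maxP y1, iq_maxP y2).
have qdr := qX_le hq dr; have q0 := qX_ge0 hq r.
by do !(apply: ler_pM => //); rewrite ?mulr_ge0.
Qed.

(** H^0 decays in d + c only; the missing q^(a + b) comes from A^0 or B^0, by which it is always
    multiplied. *)
Lemma coefH0_bound : `|coefH0 q l j m2| <= H0_cst * q ^+ (d + c).
Proof.
have key x1 x2 x3 x4 r r' : (x1 + x2 + r = (N + 1) + (N + 3))%N ->
    (x3 + x4 + r' = (N + 1) + (N + 3))%N -> (d + c <= r)%N -> (d + c <= r')%N ->
  `|(qnum q x1%:R * qnum q x2%:R - qpow q (-2) * (qnum q x3%:R * qnum q x4%:R)) /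
     (qnum q (N + 1)%:R * qnum q (N + 3)%:R)| <= H0_cst * q ^+ (d + c).
  move=> E E' dr dr'; rewrite mulrBl -[qpow _ _ * _ / _]mulrA.
  apply: le_trans (ler_normB _ _) _; rewrite /H0_cst mulrDl mul1r mulrDl.
  apply: lerD; first exact: quot_bound dr.
  rewrite normrM ger0_norm ?(ltW (qpow_gt0 hq _))// -[leRHS]mulrA.
  by rewrite ler_wpM2l ?(ltW (qpow_gt0 hq _))//; exact: quot_bound dr'.
rewrite /coefH0 eps_label.
have -> : 2 * l + 2 = (N + 1)%:R by rewrite /N /d /c hl; linear_rat.
have -> : 2 * l + 4 = (N + 3)%:R by rewrite /N /d /c hl; linear_rat.
case E : (o).
  rewrite (_ : l - _ - m2 + 1 = c%:R); last by rewrite /c hl hm2 hj E /= ?natrD ?natrM; lra.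
  rewrite (_ : l - _ + m2 + 2 = (d + 1)%:R); last by rewrite /d hl hm2 hj E /= ?natrD ?natrM; lra.
  rewrite (_ : l + _ - m2 + 2 = (c + a + b + 2)%:R); last by rewrite /c hl hm2 hj E /= ?natrD ?natrM; lra.
  rewrite (_ : l + _ + m2 + 1 = (d + a + b + 1)%:R); last by rewrite /d hl hm2 hj E /= ?natrD ?natrM; lra.
  apply: (key _ _ _ _ (d + c + 3 + 2 * a + 2 * b) (d + c + 1)); rewrite /N; lia.
rewrite (_ : l - _ - m2 + 1 = (c + a + b + 1)%:R); last by rewrite /c hl hm2 hj E /= ?natrD ?natrM; lra.
rewrite (_ : l - _ + m2 + 2 = (d + a + b + 2)%:R); last by rewrite /d hl hm2 hj E /= ?natrD ?natrM; lra.
rewrite (_ : l + _ - m2 + 2 = (c + 1)%:R); last by rewrite /c hl hm2 hj E /= ?natrD ?natrM; lra.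
rewrite (_ : l + _ + m2 + 1 = d%:R); last by rewrite /d hl hm2 hj E /= ?natrD ?natrM; lra.
apply: (key _ _ _ _ (d + c + 1) (d + c + 3 + 2 * a + 2 * b)); rewrite /N; lia.
Qed.

End Coefficients.

(** * Labels and parities in terms of points *)

Definition na (p : pt) (i : 'I_4) : nat := `|p i|%N.
Definition lp (p : pt) : rat := (unpos p).1.1.1.
Definition m1p (p : pt) : rat := (unpos p).1.1.2.
Definition m2p (p : pt) : rat := (unpos p).1.2.
Definition jp (p : pt) : rat := (unpos p).2.
(* In these coordinates eps = 1/2 exactly when d is odd, i.e. when c is even. *)
Definition od (p : pt) : bool := odd (na p i0).
Definition kd (p : pt) : nat := ((na p i0)./2 * 2)%N.
Definition kc (p : pt) : nat := ((na p i3)./2 * 2)%N.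

Lemma good_data p : good p -> exists k k' a b : nat, exists o : bool,
  [/\ [/\ na p i0 = (k * 2 + o)%N, na p i1 = a, na p i2 = b &
          na p i3 = (k' * 2 + ~~ o)%N],
      [/\ od p = o, kd p = (k * 2)%N & kc p = (k' * 2)%N] &
      [/\ lp p = (k%:R * 2 + a%:R + b%:R + k'%:R * 2) / 2,
          m1p p = (a%:R - b%:R) / 2,
          m2p p = (k%:R * 2 + o%:R - (k'%:R * 2 + (~~ o)%:R)) / 2 &
          jp p = (a%:R + b%:R) / 2]].
Proof.
case/and3P => /forallP h0 h1 h2; move: (h0 i0) (h0 i1) (h0 i2) (h0 i3) h1 h2.
rewrite /od /kd /kc /lp /m1p /m2p /jp /unpos /na /=.
case: (p i0) => // d _; case: (p i1) => // a _; case: (p i2) => // b _.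
case: (p i3) => // c _ h1 _; rewrite !absz_nat -!pmulrn.
exists d./2, c./2, a, b, (odd d).
have [ed ec] : d = (d./2 * 2 + odd d)%N /\ c = (c./2 * 2 + ~~ odd d)%N by lia.
have dR : d%:R = (d./2)%:R * 2 + (odd d)%:R :> rat by rewrite {1}ed natrD natrM.
have cR : c%:R = (c./2)%:R * 2 + (~~ odd d)%:R :> rat by rewrite {1}ec natrD natrM.
do ![split=> //]; rewrite dR cR //.
by case: (odd d) => /=; field.
Qed.

(** * Orders of magnitude and real weights *)

Section Bounds.
Variables (R : realType) (q : R).
Hypothesis hq : 0 < q < 1.
Implicit Types (p : pt) (f : pt -> nat) (g h : pt -> R) (F : bool -> pt -> R).
Local Notation sq := (sq q).
Local Notation iq := (iq q).

Definition bnd f g := exists2 c, 0 <= c & forall p, `|g p| <= c * q ^+ f p.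
Definition near1 f h := bnd f (fun p => h p - 1).
(** A bound on labels only. It is enough for rapid terms, which may be cut off outside the labels; a
    pure term may not, as its weight sees only some coordinates. *)
Definition bndg f F := exists2 c, 0 <= c &
  forall s p, good p -> `|F s p| <= c * q ^+ f p.

Lemma bnd_le f f' g : (forall p, f' p <= f p)%N -> bnd f g -> bnd f' g.
Proof.
move=> ff [c c0 hc]; exists c => // p; apply: le_trans (hc p) _.
by rewrite ler_wpM2l// (qX_le hq).
Qed.

Lemma bndM f f' g h : bnd f g -> bnd f' h ->
  bnd (fun p => f p + f' p)%N (fun p => g p * h p).
Proof.
move=> [c c0 hc] [c' c'0 hc']; exists (c * c'); first exact: mulr_ge0.
by move=> p; rewrite normrM exprD mulrACA; apply: ler_pM.
Qed.

Lemma bndMl f g h : bnd f g -> bnd (fun=> 0%N) h -> bnd f (fun p => g p * h p).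
Proof. by move=> h1 h2; apply: bnd_le (bndM h1 h2) => p; rewrite addn0. Qed.

Lemma bndD f g h : bnd f g -> bnd f h -> bnd f (fun p => g p + h p).
Proof.
move=> [c c0 hc] [c' c'0 hc']; exists (c + c'); first exact: addr_ge0.
by move=> p; rewrite mulrDl (le_trans (ler_normD _ _))// lerD.
Qed.

Lemma bndN f g : bnd f g -> bnd f (fun p => - g p).
Proof. by move=> [c c0 hc]; exists c => // p; rewrite normrN. Qed.

Lemma bnd_cst (x : R) : bnd (fun=> 0%N) (fun=> x).
Proof. by exists `|x| => // p; rewrite mulr1. Qed.

(** The slack r absorbs additive constants and rounding, as in d <= [kd] + 1. *)
Lemma bnd_exp r f m : (forall p, f p <= m p + r)%N -> bnd f (fun p => q ^+ m p).
Proof.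
move=> fm; exists (q ^+ r)^-1; first by rewrite invr_ge0 (qX_ge0 hq).
by move=> p; rewrite ger0_norm ?(qX_ge0 hq)//; exact: qX_shift.
Qed.

Lemma bnd_if (b : pt -> bool) f g h : bnd f g -> bnd f h ->
  bnd f (fun p => if b p then g p else h p).
Proof.
move=> [c c0 hc] [c' c'0 hc']; exists (c + c'); first exact: addr_ge0.
move=> p; case: (b p); rewrite mulrDl.
  by apply: le_trans (hc p) _; rewrite lerDl mulr_ge0 ?(qX_ge0 hq).
by apply: le_trans (hc' p) _; rewrite lerDr mulr_ge0 ?(qX_ge0 hq).
Qed.

Lemma near1_bnd f h : near1 f h -> bnd (fun=> 0%N) h.
Proof.
move=> hn; have := bndD (bnd_le _ hn) (bnd_cst 1) => /(_ (fun=> leq0n _)).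
by case=> c c0 hc; exists c => // p; have := hc p; rewrite subrK.
Qed.

Lemma near1M f h h' : near1 f h -> near1 f h' -> near1 f (fun p => h p * h' p).
Proof.
move=> h1 h2; have [c c0 hc] := bndD (bndMl h1 (near1_bnd h2)) h2.
exists c => // p; have := hc p; congr (`|_| <= _); ring.
Qed.

Lemma near1_sq r f m : (forall p, f p <= m p + r)%N -> near1 f (fun p => sq (m p)).
Proof.
move=> fm; have [c c0 hc] := bnd_exp fm; exists c => // p.
apply: le_trans (sq_near1 hq _) _; apply: le_trans (hc p).
exact: ler_norm.
Qed.

Lemma near1_iq r f m : (forall p, f p <= m p + r)%N -> near1 f (fun p => iq (m p)).
Proof.
move=> fm; have [c c0 hc] := bnd_exp fm; exists ((1 - q ^+ 2)^-1 * c).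
  by rewrite mulr_ge0// invr_ge0 subr_ge0 (qX_le1 hq).
move=> p; apply: le_trans (iq_near1 hq _) _; rewrite -mulrA ler_wpM2l//.
  by rewrite invr_ge0 subr_ge0 (qX_le1 hq).
by apply: le_trans (hc p); exact: ler_norm.
Qed.

Lemma near1_if (b : pt -> bool) f h h' : near1 f h -> near1 f h' ->
  near1 f (fun p => if b p then h p else h' p).
Proof.
move=> h1 h2; have [c c0 hc] := bnd_if b h1 h2; exists c => // p.
by have := hc p; case: (b p).
Qed.

Lemma bnd_sq m : bnd (fun=> 0%N) (fun p => sq (m p)).
Proof. by exists 1 => // p; rewrite mulr1 sq_norm. Qed.

Lemma bnd_iq m : bnd (fun=> 0%N) (fun p => iq (m p)).
Proof.
exists (iq_max q); last by move=> p; rewrite mulr1 iq_maxP.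
by apply: le_trans (iq_maxP hq 0).
Qed.

Lemma bndgM f f' F F' : bndg f F -> bndg f' F' ->
  bndg (fun p => f p + f' p)%N (fun s p => F s p * F' s p).
Proof.
move=> [c c0 hc] [c' c'0 hc']; exists (c * c'); first exact: mulr_ge0.
by move=> s p gp; rewrite normrM exprD mulrACA; apply: ler_pM; auto.
Qed.

Lemma bndg_le f f' F : (forall p, f' p <= f p)%N -> bndg f F -> bndg f' F.
Proof.
move=> ff [c c0 hc]; exists c => // s p gp; apply: le_trans (hc s p gp) _.
by rewrite ler_wpM2l// (qX_le hq).
Qed.

Lemma bnd_bndg f g F : bnd f g -> (forall s p, good p -> F s p = g p) -> bndg f F.
Proof. by move=> [c c0 hc] E; exists c => // s p gp; rewrite E. Qed.

Lemma bndg_sgn F f : bndg f F -> bndg f (fun s p => sgn R s * F s p).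
Proof.
move=> [c c0 hc]; exists c => // s p gp; rewrite normrM.
have -> : `|sgn R s| = 1 by case: s; rewrite /sgn ?normrN normr1.
by rewrite mul1r; exact: hc.
Qed.

Definition bandT (sg : pt) F := band (symbol q id) (fun v t =>
  Complex (F t.1 (pos t.2)) 0 * ext v t.1 (pos t.2 + sg)).

Lemma bandT_eq sg F F' : (forall s p, good p -> F s p = F' s p) ->
  bandT sg F -> bandT sg F'.
Proof. by move=> E; apply: eq_band => v t; rewrite E ?good_pos. Qed.

Lemma bandT_add sg F F' : bandT sg F -> bandT sg F' ->
  bandT sg (fun s p => F s p + F' s p).
Proof.
move=> b1 b2; apply: eq_band (band_add b1 b2) => v t.
by rewrite -mulrDl; congr (_ * _); apply/eqP; rewrite eq_complex /= addr0 !eqxx.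
Qed.

Lemma bandT_small sg F : bndg size_pt F -> bandT sg F.
Proof.
move=> [c c0 hc].
pose z : term R := Term false sg (fun s p => Complex (if good p then F s p else 0) 0).
apply: (@band1 _ _ z) => [|v t]; last by rewrite /act /= good_pos.
left; apply: (rapid_of_exp hq); exists c => s p; rewrite normc_real /=.
by case: ifP => [gp|_]; [exact: hc|rewrite normr0 mulr_ge0 ?(qX_ge0 hq)].
Qed.

Definition dep (k : nat) g := forall p p',
  (forall i : 'I_4, (i < k)%N -> p i = p' i) -> g p = g p'.

Lemma bandT_pure k (sg : pt) g : (forall i : 'I_4, (k < i)%N -> sg i = 0) ->
  even_pt sg -> dep k g -> bnd (wt id k) g -> bandT sg (fun _ => g).
Proof.
move=> s0 ev dg [c c0 hc].
apply: (@band1 _ _ (Term false sg (fun s p => Complex (g p) 0))) => //.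
right; exists k; split=> //; first by move=> s s' p p' /dg /= ->.
by exists c => s p; rewrite normc_real.
Qed.

(** One step of the telescoping: factors that read further coordinates are inserted at the price of
    an increment h - g, itself pure of level k. *)
Lemma bandT_step k (sg : pt) g h : (forall i : 'I_4, (k < i)%N -> sg i = 0) ->
  even_pt sg -> dep k g -> dep k h -> bnd (wt id k) (fun p => h p - g p) ->
  bandT sg (fun _ => g) -> bandT sg (fun _ => h).
Proof.
move=> s0 ev dg dh b bg; apply: (@bandT_eq _ (fun s p => g p + (h p - g p))).
  by move=> s p _; rewrite addrC subrK.
apply: bandT_add => //; apply: bandT_pure b => // p p' E.
by rewrite (dg p p')// (dh p p').
Qed.

Lemma wt1 p : wt id 1 p = na p i0.
Proof. by rewrite /wt big_mkcond !big_ord_recr big_ord0 /= !addn0; congr (absz (p _)); exact: val_inj. Qed.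
Lemma wt2 p : wt id 2 p = (na p i0 + na p i1)%N.
Proof. by rewrite /wt big_mkcond !big_ord_recr big_ord0 /= !addn0; congr (_ + _)%N; congr (absz (p _)); exact: val_inj. Qed.
Lemma wt3 p : wt id 3 p = (na p i0 + na p i1 + na p i2)%N.
Proof. by rewrite /wt big_mkcond !big_ord_recr big_ord0 /= !addn0; congr (_ + _ + _)%N; congr (absz (p _)); exact: val_inj. Qed.
Lemma wt_size p : size_pt p = (na p i0 + na p i1 + na p i2 + na p i3)%N.
Proof. exact: size_ptE. Qed.

Lemma bnd_step f f' f'' g h : bnd f g -> near1 f' h ->
  (forall p, f'' p <= f p + f' p)%N -> bnd f'' (fun p => g p * h p - g p).
Proof.
move=> bg nh ff; have [c c0 hc] := bnd_le ff (bndM bg nh).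
by exists c => // p; rewrite -[X in _ - X]mulr1 -mulrBr.
Qed.

End Bounds.

(** * Telescoping of coefficients by level *)

Section Levels.
Variables (R : realType) (q : R).
Hypothesis hq : 0 < q < 1.
Implicit Types (p : pt) (f : pt -> nat) (g h : pt -> R) (F : bool -> pt -> R).

Lemma bandT_tail (sg : pt) f f' g h F : bandT q sg (fun _ => g) -> bnd q f g ->
  near1 q f' h -> (forall p, size_pt p <= f p + f' p)%N ->
  (forall s p, good p -> F s p = g p * h p) -> bandT q sg F.
Proof.
move=> bg bf nh le E; apply: (@bandT_eq _ _ _ (fun s p => g p + (g p * h p - g p))).
  by move=> s p gp; rewrite E// addrC subrK.
apply: bandT_add => //; apply: (bandT_small hq).
by apply: bnd_bndg (bnd_step hq bf nh le) _.
Qed.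

Lemma depM k g h : dep k g -> dep k h -> dep k (fun p => g p * h p).
Proof. by move=> dg dh p p' E; rewrite (dg p p')// (dh p p'). Qed.

Lemma dep_le k k' g : (k <= k')%N -> dep k g -> dep k' g.
Proof. by move=> kk dg p p' E; apply: dg => i ik; apply: E; exact: leq_trans kk. Qed.

Lemma bandT_level3 (sg : pt) g h F : even_pt sg -> dep 3 g ->
  bnd q (wt id 3) g -> near1 q (na^~ i3) h ->
  (forall s p, good p -> F s p = g p * h p) -> bandT q sg F.
Proof.
move=> ev dg bg nh; apply: (bandT_tail _ bg nh).
  by apply: (bandT_pure (k := 3)) => // i; rewrite ltnNge -ltnS ltn_ord.
by move=> p; rewrite wt3 wt_size.
Qed.

(** Inserting h3 costs a term of order q^(d + a) q^b in (d, a, b), pure of level 3; inserting h4,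
    which may read all coordinates, costs a term of order q^(d + a + b + c), hence a rapid one. *)
Lemma bandT_level2 (sg : pt) g h3 h4 F : even_pt sg -> sg i3 = 0 -> dep 2 g ->
  bnd q (wt id 2) g -> dep 3 h3 -> near1 q (na^~ i2) h3 ->
  near1 q (fun p => na p i2 + na p i3)%N h4 ->
  (forall s p, good p -> F s p = g p * h3 p * h4 p) -> bandT q sg F.
Proof.
move=> ev s3 dg bg d3 n3 n4.
have supp (i : 'I_4) : (2 < i)%N -> sg i = 0 by move: i; apply: ord4P.
apply: (bandT_tail _ (bndMl hq bg (near1_bnd hq n3)) n4); last first.
- by move=> p; rewrite wt2 wt_size !addnA.

apply: (bandT_step (k := 3) _ _ _ _ _ (bandT_pure supp ev dg bg)) => //.
- by move=> i; rewrite ltnNge -ltnS ltn_ord.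
- exact: dep_le dg.
- by apply: depM => //; exact: dep_le dg.
- by apply: bnd_step bg n3 _ => // p; rewrite wt2 wt3.
Qed.

Lemma bandT_level1 (sg : pt) g h2 h3 h4 F : even_pt sg -> sg i2 = 0 -> sg i3 = 0 ->
  dep 1 g -> bnd q (wt id 1) g -> dep 2 h2 -> near1 q (na^~ i1) h2 ->
  dep 3 h3 -> near1 q (fun p => na p i1 + na p i2)%N h3 ->
  near1 q (fun p => na p i1 + na p i2 + na p i3)%N h4 ->
  (forall s p, good p -> F s p = g p * h2 p * h3 p * h4 p) -> bandT q sg F.
Proof.
move=> ev s2 s3 dg bg d2 n2 d3 n3 n4.
have supp1 (i : 'I_4) : (1 < i)%N -> sg i = 0 by move: i; apply: ord4P.
have supp2 (i : 'I_4) : (2 < i)%N -> sg i = 0 by move: i; apply: ord4P.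
have b2 := bndMl hq bg (near1_bnd hq n2).
apply: (bandT_tail _ (bndMl hq b2 (near1_bnd hq n3)) n4); last first.
  by move=> p; rewrite wt1 wt_size !addnA.
apply: (bandT_step (k := 3)) => //.
- by move=> i; rewrite ltnNge -ltnS ltn_ord.
- by apply: depM; [exact: dep_le dg|exact: dep_le d2].
- by apply: depM => //; apply: depM; [exact: dep_le dg|exact: dep_le d2].
- by apply: bnd_step b2 n3 _ => // p; rewrite wt1 wt3 addnA.
apply: (bandT_step (k := 2) _ _ _ _ _ (bandT_pure supp1 ev dg bg)) => //.
- exact: dep_le dg.
- by apply: depM => //; exact: dep_le dg.
- by apply: bnd_step bg n2 _ => // p; rewrite wt1 wt2.
Qed.

(** The leading weight is 1. No factor of D^+ reads exactly (d, a), so the telescoping passes from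
    level 1 to level 3. *)
Lemma bandT_level0 (sg : pt) h1 h3 h4 F : even_pt sg ->
  sg i1 = 0 -> sg i2 = 0 -> sg i3 = 0 ->
  dep 1 h1 -> near1 q (na^~ i0) h1 -> dep 3 h3 -> near1 q (wt id 3) h3 ->
  near1 q size_pt h4 ->
  (forall s p, good p -> F s p = h1 p * h3 p * h4 p) -> bandT q sg F.
Proof.
move=> ev s1 s2 s3 d1 n1 d3 n3 n4.
have supp0 (i : 'I_4) : (0 < i)%N -> sg i = 0 by move: i; apply: ord4P.
have supp1 (i : 'I_4) : (1 < i)%N -> sg i = 0 by move: i; apply: ord4P.
have b1 := near1_bnd hq n1; have b0 : bnd q (wt id 0) (fun=> 1).
  by apply: bnd_le (bnd_cst q 1) => // p; rewrite /wt big_pred0.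
apply: (bandT_tail _ (bndMl hq b1 (near1_bnd hq n3)) n4) => //.
apply: (bandT_step (k := 3)) => //.
- by move=> i; rewrite ltnNge -ltnS ltn_ord.
- exact: dep_le d1.
- by apply: depM => //; exact: dep_le d1.
- exact: bnd_step b1 n3 _.
apply: (bandT_step (k := 1) _ _ _ _ _ (bandT_pure supp0 ev _ b0)) => //.
have [c c0 hc] := n1; exists c => // p; by rewrite wt1.
Qed.

End Levels.

(** * The coefficients at the point of a label *)

Section CoefficientsAt.
Variables (R : realType) (q : R).
Hypothesis hq : 0 < q < 1.
Variable p : pt.
Hypothesis gp : good p.
Local Notation sq := (sq q).
Local Notation iq := (iq q).
Local Notation d := (na p i0).
Local Notation a := (na p i1).
Local Notation b := (na p i2).
Local Notation c := (na p i3).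
Local Notation N := (d + a + b + c)%N.

Lemma coefDp_at : coefDp q (lp p) (jp p) (m2p p) =
  sq (kd p + 2) * sq (d + a + b + 2 + od p) * iq (N + 3).
Proof.
have [k [k' [a' [b' [par [[h0 h1 h2 h3] [ho hk hc] [hl hm1 hm2 hj]]]]]]] := good_data gp.
by rewrite ?ho ?hk ?hc ?h0 ?h1 ?h2 ?h3; exact: (coefDp_nat hq hl hm2 hj).
Qed.

Lemma coefDm_at : coefDm q (lp p) (jp p) (m2p p) =
  - (q ^+ (2 * d + a + b + 2) * sq (kc p) * sq (c + a + b + ~~ od p) * iq (N + 1)).
Proof.
have [k [k' [a' [b' [par [[h0 h1 h2 h3] [ho hk hc] [hl hm1 hm2 hj]]]]]]] := good_data gp.
by rewrite ?ho ?hk ?hc ?h0 ?h1 ?h2 ?h3; exact: (coefDm_nat hq hl hm2 hj).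
Qed.

Lemma coefCp_at : coefCp q (lp p) (jp p) (m2p p) = - (q ^+ kd p *
  sq (d + a + b + 2 + od p) * sq (c + a + b + 2 + ~~ od p) * iq (N + 3)).
Proof.
have [k [k' [a' [b' [par [[h0 h1 h2 h3] [ho hk hc] [hl hm1 hm2 hj]]]]]]] := good_data gp.
by rewrite ?ho ?hk ?hc ?h0 ?h1 ?h2 ?h3; exact: (coefCp_nat hq hl hm2 hj).
Qed.

Lemma coefCm_at : coefCm q (lp p) (jp p) (m2p p) = - (q ^+ (d + a + b + od p) *
  sq (kd p) * sq (kc p) * iq (N + 1)).
Proof.
have [k [k' [a' [b' [par [[h0 h1 h2 h3] [ho hk hc] [hl hm1 hm2 hj]]]]]]] := good_data gp.
by rewrite ?ho ?hk ?hc ?h0 ?h1 ?h2 ?h3; exact: (coefCm_nat hq hl hm2 hj).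
Qed.

Lemma coefCm_anti_at : coefCm q (lp p + 1) (jp p - 1) (m2p p) =
  - (q ^+ (d + a + b + od p) * sq (kd p + 2) * sq (kc p + 2) * iq (N + 3)).
Proof.
have [k [k' [a' [b' [par [[h0 h1 h2 h3] [ho hk hc] [hl hm1 hm2 hj]]]]]]] := good_data gp.
by rewrite ?ho ?hk ?hc ?h0 ?h1 ?h2 ?h3; exact: (coefCm_anti_nat hq hl hm2 hj).
Qed.

Lemma coefCp_diag_at : coefCp q (lp p - 1) (jp p - 1) (m2p p) = - (q ^+ kd p *
  sq (d + a + b + od p) * sq (c + a + b + ~~ od p) * iq (N + 1)).
Proof.
have [k [k' [a' [b' [par [[h0 h1 h2 h3] [ho hk hc] [hl hm1 hm2 hj]]]]]]] := good_data gp.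
by rewrite ?ho ?hk ?hc ?h0 ?h1 ?h2 ?h3; exact: (coefCp_diag_nat hq hl hm2 hj).
Qed.

Lemma coefHp_at : coefHp q (lp p) (jp p) (m2p p) =
  if od p then q ^+ (d + a + b + 1) * sq (c + a + b + 2) * sq (d + 1) * iq (N + 3)
  else q ^+ d * sq (c + 1) * sq (d + a + b + 2) * iq (N + 3).
Proof.
have [k [k' [a' [b' [par [[h0 h1 h2 h3] [ho hk hc] [hl hm1 hm2 hj]]]]]]] := good_data gp.
by rewrite ?ho ?hk ?hc ?h0 ?h1 ?h2 ?h3; exact: (coefHp_nat hq hl hm2 hj).
Qed.

Lemma coefHp_l_at : coefHp q (lp p - 1) (jp p) (m2p p) =
  if od p then q ^+ kd p * sq c * sq (d + a + b + 1) * iq (N + 1)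
  else q ^+ (d + a + b) * sq (c + a + b + 1) * sq d * iq (N + 1).
Proof.
have [k [k' [a' [b' [par [[h0 h1 h2 h3] [ho hk hc] [hl hm1 hm2 hj]]]]]]] := good_data gp.
by rewrite ?ho ?hk ?hc ?h0 ?h1 ?h2 ?h3; exact: (coefHp_l_nat hq hl hm2 hj).
Qed.

Lemma coefAp_at : coefAp q (jp p) (m1p p) =
  q ^+ a * sq (a + 1) * sq (b + 1) * iq (a + b + 2).
Proof.
have [k [k' [a' [b' [par [[h0 h1 h2 h3] [ho hk hc] [hl hm1 hm2 hj]]]]]]] := good_data gp.
by rewrite ?ho ?hk ?hc ?h0 ?h1 ?h2 ?h3; exact: (coefAp_nat hq hm1 hj).
Qed.

Lemma coefAp_pred_at : coefAp q (jp p - 1) (m1p p) =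
  qpow q (-1) * q ^+ a * sq a * sq b * iq (a + b).
Proof.
have [k [k' [a' [b' [par [[h0 h1 h2 h3] [ho hk hc] [hl hm1 hm2 hj]]]]]]] := good_data gp.
by rewrite ?ho ?hk ?hc ?h0 ?h1 ?h2 ?h3; exact: (coefAp_pred_nat hq hm1 hj).
Qed.

Lemma coefA0_at : coefA0 q (jp p) (m1p p) = q ^+ (a + b) *
  (qpow q (-2) * kq q * q ^+ 2 * iq (a + b) * iq (a + b + 2) *
   (q ^+ (2 * a + 1) * qnum q 2 * tq q b - tq q (a + b))).
Proof.
have [k [k' [a' [b' [par [[h0 h1 h2 h3] [ho hk hc] [hl hm1 hm2 hj]]]]]]] := good_data gp.
by rewrite ?ho ?hk ?hc ?h0 ?h1 ?h2 ?h3; exact: (coefA0_nat hq hm1 hj).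
Qed.

Lemma coefBp_at : coefBp q (jp p) (m1p p) =
  sq (a + 1) * sq (a + 2) * iq (a + b + 2).
Proof.
have [k [k' [a' [b' [par [[h0 h1 h2 h3] [ho hk hc] [hl hm1 hm2 hj]]]]]]] := good_data gp.
by rewrite ?ho ?hk ?hc ?h0 ?h1 ?h2 ?h3; exact: (coefBp_nat hq hm1 hj).
Qed.

Lemma coefBm_at : coefBm q (jp p) (m1p p) =
  - (q ^+ (2 * a + 1) * sq b * sq b.-1 * iq (a + b)).
Proof.
have [k [k' [a' [b' [par [[h0 h1 h2 h3] [ho hk hc] [hl hm1 hm2 hj]]]]]]] := good_data gp.
by rewrite ?ho ?hk ?hc ?h0 ?h1 ?h2 ?h3; exact: (coefBm_nat hq hm1 hj).
Qed.

Lemma coefB0_at : coefB0 q (jp p) (m1p p) = q ^+ (a + b) *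
  ((1 + q ^+ 2) * qpow q (-1) * q ^+ (a + 2) * kq q *
   sq b * sq (a + 1) * iq (a + b) * iq (a + b + 2)).
Proof.
have [k [k' [a' [b' [par [[h0 h1 h2 h3] [ho hk hc] [hl hm1 hm2 hj]]]]]]] := good_data gp.
by rewrite ?ho ?hk ?hc ?h0 ?h1 ?h2 ?h3; exact: (coefB0_nat hq hm1 hj).
Qed.

Lemma coefC0_at : `|coefC0 q (lp p) (jp p) (m2p p)| <= tail_cst q * q ^+ N.
Proof.
have [k [k' [a' [b' [par [[h0 h1 h2 h3] [ho hk hc] [hl hm1 hm2 hj]]]]]]] := good_data gp.
by rewrite ?ho ?hk ?hc ?h0 ?h1 ?h2 ?h3; exact: (coefC0_bound hq hl hm2 hj).
Qed.

Lemma coefC0_pred_at : `|coefC0 q (lp p) (jp p - 1) (m2p p)| <= tail_cst q * q ^+ N.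
Proof.
have [k [k' [a' [b' [par [[h0 h1 h2 h3] [ho hk hc] [hl hm1 hm2 hj]]]]]]] := good_data gp.
by rewrite ?ho ?hk ?hc ?h0 ?h1 ?h2 ?h3; exact: (coefC0_pred_bound hq hl hm2 hj).
Qed.

Lemma coefD0_at : `|coefD0 q (lp p) (jp p) (m2p p)| <= tail_cst q * q ^+ N.
Proof.
have [k [k' [a' [b' [par [[h0 h1 h2 h3] [ho hk hc] [hl hm1 hm2 hj]]]]]]] := good_data gp.
by rewrite ?ho ?hk ?hc ?h0 ?h1 ?h2 ?h3; exact: (coefD0_bound hq hl hm2 hj).
Qed.

Lemma coefH0_at : `|coefH0 q (lp p) (jp p) (m2p p)| <= H0_cst q * q ^+ (d + c).
Proof.
have [k [k' [a' [b' [par [[h0 h1 h2 h3] [ho hk hc] [hl hm1 hm2 hj]]]]]]] := good_data gp.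
by rewrite ?ho ?hk ?hc ?h0 ?h1 ?h2 ?h3; exact: (coefH0_bound hq hl hm2 hj).
Qed.

End CoefficientsAt.

(** * The generators as lists of shifts *)

Definition sh (w x y z : int) : pt := [ffun i : 'I_4 => nth 0 [:: w; x; y; z] i].

Lemma unpos_sh (p : pt) w x y z : unpos (p + sh w x y z) =
  (lp p + (w + x + y + z)%:~R / 2, m1p p + (x - y)%:~R / 2,
   m2p p + (w - z)%:~R / 2, jp p + (x + y)%:~R / 2).
Proof.
have E (a b c d e f g h : rat) : a + e + (b + f) + (c + g) + (d + h) - 1 =
  a + b + c + d - 1 + (e + f + g + h) by ring.
have E2 (a b c d : rat) : a + b - (c + d) = a - c + (b - d) by ring.
rewrite /unpos /lp /m1p /m2p /jp /sh !ffunE /= !rmorphD !rmorphN /= E !E2 -!mulrDl.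
by rewrite (addrACA _ (x%:~R)).
Qed.

Section Generators.
Variables (R : realType) (q : R).
Hypothesis hq : 0 < q < 1.
Notation H := (spinor_space R).
Local Notation sq := (sq q).
Local Notation iq := (iq q).
Implicit Types (p : pt) (s : bool).

Definition ketp s p : H := let: (l, m1, m2, j) := unpos p in ket s l m1 m2 j.

Lemma ketpE s l m1 m2 j p : unpos p = (l, m1, m2, j) -> ket s l m1 m2 j = ketp s p.
Proof. by rewrite /ketp => ->. Qed.

Lemma ketp_pos s k : ketp s (pos k) = bvec R (s, k).
Proof. by rewrite /ketp unpos_pos. Qed.

Lemma inner_ketp (c : R) s p (v : H) :
  inner (Complex c 0 *: ketp s p) v = Complex c 0 * ext v s p.
Proof.
rewrite innerZl; congr (_ * _).
have [/goodP[k ->]|g] := boolP (good p).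
  by rewrite ketp_pos inner_bvec1 ext_pos.
rewrite ext_bad// (_ : ketp s p = Complex 0 0 *: ketp s p) ?innerZl ?mul0r//.
apply: ell2P => t; rewrite ell2Z mul0r /ketp.
case E : (unpos p) => [[[l m1] m2] j]; rewrite [LHS]/(ket_fun _ _ _ _ _ _) /ket_fun.
case: andP => // -[_ /eqP]; rewrite -E -unpos_pos => /unpos_inj pE.
by move: g; rewrite -pE good_pos.
Qed.

Definition ket_sum (L : seq (pt * (bool -> pt -> R))) s p : H :=
  \sum_(z <- L) Complex (z.2 s p) 0 *: ketp s (p + z.1).

(** T is known on basis vectors only. The coordinates of S v are the inner products of T e with v,
    so S is obtained on every vector without expanding it. *)
Lemma generator_symbol (S T : H -> H) (L : seq (pt * (bool -> pt -> R))) :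
  (forall u v, inner (T u) v = inner u (S v)) ->
  (forall s k, T (bvec R (s, k)) = ket_sum L s (pos k)) ->
  foldr (fun z P => bandT q z.1 z.2 /\ P) True L -> has_symbol q S.
Proof.
move=> TS Tk hL.
have [B bB hB] : exists2 B, band (symbol q id) B &
    forall (v : H) s k, inner (ket_sum L s (pos k)) v = B v (s, k).
  elim: L {Tk} hL => [_|z L IH [bz /IH[B bB hB]]].
    exists (fun _ _ => 0); first exact: band_nil.
    move=> v s k; rewrite /ket_sum big_nil (_ : 0 = Complex 0 0 *: bvec R (s, k)).
      by rewrite innerZl mul0r.
    by apply: ell2P => t; rewrite ell2Z mul0r.
  exists (fun v t => Complex (z.2 t.1 (pos t.2)) 0 * ext v t.1 (pos t.2 + z.1) + B v t).
    exact: band_add.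
  move=> v s k; rewrite /ket_sum big_cons innerDl inner_ketp; congr (_ + _).
  exact: hB.
exists B => // v [s k]; by rewrite -inner_bvec1 -TS Tk hB.
Qed.

Definition x0_terms : seq (pt * (bool -> pt -> R)) :=
 [:: (sh 0 1 1 0, fun _ p =>
        coefAp q (jp p) (m1p p) * coefCp q (lp p) (jp p) (m2p p));
     (sh (-1) 1 1 (-1), fun s p =>
        - (sgn R s * (coefAp q (jp p) (m1p p) * coefC0 q (lp p) (jp p) (m2p p))));
     (sh (-2) 1 1 (-2), fun _ p =>
        coefAp q (jp p) (m1p p) * coefCm q (lp p) (jp p) (m2p p));
     (sh 1 0 0 1, fun _ p =>
        coefA0 q (jp p) (m1p p) * coefHp q (lp p) (jp p) (m2p p));
     (sh 0 0 0 0, fun s p =>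
        sgn R s * (coefA0 q (jp p) (m1p p) * coefH0 q (lp p) (jp p) (m2p p)));
     (sh (-1) 0 0 (-1), fun _ p =>
        coefA0 q (jp p) (m1p p) * coefHp q (lp p - 1) (jp p) (m2p p));
     (sh 2 (-1) (-1) 2, fun _ p =>
        coefAp q (jp p - 1) (m1p p) * coefCm q (lp p + 1) (jp p - 1) (m2p p));
     (sh 1 (-1) (-1) 1, fun s p => - (sgn R s *
        (coefAp q (jp p - 1) (m1p p) * coefC0 q (lp p) (jp p - 1) (m2p p))));
     (sh 0 (-1) (-1) 0, fun _ p =>
        coefAp q (jp p - 1) (m1p p) * coefCp q (lp p - 1) (jp p - 1) (m2p p))].

Definition x1_terms : seq (pt * (bool -> pt -> R)) :=
 [:: (sh 0 2 0 0, fun _ p =>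
        coefBp q (jp p) (m1p p) * coefCp q (lp p) (jp p) (m2p p));
     (sh (-1) 2 0 (-1), fun s p =>
        - (sgn R s * (coefBp q (jp p) (m1p p) * coefC0 q (lp p) (jp p) (m2p p))));
     (sh (-2) 2 0 (-2), fun _ p =>
        coefBp q (jp p) (m1p p) * coefCm q (lp p) (jp p) (m2p p));
     (sh 1 1 (-1) 1, fun _ p =>
        coefB0 q (jp p) (m1p p) * coefHp q (lp p) (jp p) (m2p p));
     (sh 0 1 (-1) 0, fun s p =>
        sgn R s * (coefB0 q (jp p) (m1p p) * coefH0 q (lp p) (jp p) (m2p p)));
     (sh (-1) 1 (-1) (-1), fun _ p =>
        coefB0 q (jp p) (m1p p) * coefHp q (lp p - 1) (jp p) (m2p p));
     (sh 2 0 (-2) 2, fun _ p =>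
        coefBm q (jp p) (m1p p) * coefCm q (lp p + 1) (jp p - 1) (m2p p));
     (sh 1 0 (-2) 1, fun s p => - (sgn R s *
        (coefBm q (jp p) (m1p p) * coefC0 q (lp p) (jp p - 1) (m2p p))));
     (sh 0 0 (-2) 0, fun _ p =>
        coefBm q (jp p) (m1p p) * coefCp q (lp p - 1) (jp p - 1) (m2p p))].

Definition x2_terms : seq (pt * (bool -> pt -> R)) :=
 [:: (sh 2 0 0 0, fun _ p => coefDp q (lp p) (jp p) (m2p p));
     (sh 1 0 0 (-1), fun s p => sgn R s * coefD0 q (lp p) (jp p) (m2p p));
     (sh 0 0 0 (-2), fun _ p => coefDm q (lp p) (jp p) (m2p p))].

Let cM (x y : R) : Complex (x * y) 0 = Complex x 0 * Complex y 0.
Proof. exact: (rmorphM (real_complex R)). Qed.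

Let cN (x : R) : Complex (- x) 0 = - Complex x 0.
Proof. exact: (rmorphN (real_complex R)). Qed.

Lemma ketp_sh s p w x y z dl d1 d2 dj :
  w + x + y + z = dl * 2 -> x - y = d1 * 2 -> w - z = d2 * 2 -> x + y = dj * 2 ->
  ketp s (p + sh w x y z) =
  ket s (lp p + dl%:~R) (m1p p + d1%:~R) (m2p p + d2%:~R) (jp p + dj%:~R).
Proof.
have E (n : int) : (n * 2)%:~R / 2 = n%:~R :> rat by rewrite rmorphM /= mulfK.
by move=> h1 h2 h3 h4; rewrite /ketp unpos_sh h1 h2 h3 h4 !E.
Qed.

Let intE := (mulr1z, mulr0z, addr0, mulrN1z (1 : rat)).

Lemma x0_ketE s p : x0_ket q s (lp p) (m1p p) (m2p p) (jp p) = ket_sum x0_terms s p.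
Proof.
rewrite /x0_ket /real_complex_def /ket_sum /x0_terms !big_cons big_nil /=.
rewrite
  (ketp_sh s p (w := 0) (x := 1) (y := 1) (z := 0) (dl := 1) (d1 := 0) (d2 := 0) (dj := 1))//
  (ketp_sh s p (w := -1) (x := 1) (y := 1) (z := -1) (dl := 0) (d1 := 0) (d2 := 0) (dj := 1))//
  (ketp_sh s p (w := -2) (x := 1) (y := 1) (z := -2) (dl := -1) (d1 := 0) (d2 := 0) (dj := 1))//
  (ketp_sh s p (w := 1) (x := 0) (y := 0) (z := 1) (dl := 1) (d1 := 0) (d2 := 0) (dj := 0))//
  (ketp_sh s p (w := 0) (x := 0) (y := 0) (z := 0) (dl := 0) (d1 := 0) (d2 := 0) (dj := 0))//
  (ketp_sh s p (w := -1) (x := 0) (y := 0) (z := -1) (dl := -1) (d1 := 0) (d2 := 0) (dj := 0))//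
  (ketp_sh s p (w := 2) (x := -1) (y := -1) (z := 2) (dl := 1) (d1 := 0) (d2 := 0) (dj := -1))//
  (ketp_sh s p (w := 1) (x := -1) (y := -1) (z := 1) (dl := 0) (d1 := 0) (d2 := 0) (dj := -1))//
  (ketp_sh s p (w := 0) (x := -1) (y := -1) (z := 0) (dl := -1) (d1 := 0) (d2 := 0) (dj := -1))//
  !intE.
move: (coefAp q (jp p) (m1p p)) (coefA0 q (jp p) (m1p p)) (coefAp q (jp p - 1) (m1p p))
  (coefCp q (lp p) (jp p) (m2p p)) (coefC0 q (lp p) (jp p) (m2p p))
  (coefCm q (lp p) (jp p) (m2p p)) (coefHp q (lp p) (jp p) (m2p p))
  (coefH0 q (lp p) (jp p) (m2p p)) (coefHp q (lp p - 1) (jp p) (m2p p))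
  (coefCm q (lp p + 1) (jp p - 1) (m2p p)) (coefC0 q (lp p) (jp p - 1) (m2p p))
  (coefCp q (lp p - 1) (jp p - 1) (m2p p)) => A B C D E F G I J K L M.
apply: ell2P => t; rewrite !(ell2D, ell2B, ell2N, ell2Z, ell20) ?cN !cM; ring.
Qed.

Lemma x1_ketE s p : x1_ket q s (lp p) (m1p p) (m2p p) (jp p) = ket_sum x1_terms s p.
Proof.
rewrite /x1_ket /real_complex_def /ket_sum /x1_terms !big_cons big_nil /=.
rewrite
  (ketp_sh s p (w := 0) (x := 2) (y := 0) (z := 0) (dl := 1) (d1 := 1) (d2 := 0) (dj := 1))//
  (ketp_sh s p (w := -1) (x := 2) (y := 0) (z := -1) (dl := 0) (d1 := 1) (d2 := 0) (dj := 1))//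
  (ketp_sh s p (w := -2) (x := 2) (y := 0) (z := -2) (dl := -1) (d1 := 1) (d2 := 0) (dj := 1))//
  (ketp_sh s p (w := 1) (x := 1) (y := -1) (z := 1) (dl := 1) (d1 := 1) (d2 := 0) (dj := 0))//
  (ketp_sh s p (w := 0) (x := 1) (y := -1) (z := 0) (dl := 0) (d1 := 1) (d2 := 0) (dj := 0))//
  (ketp_sh s p (w := -1) (x := 1) (y := -1) (z := -1) (dl := -1) (d1 := 1) (d2 := 0) (dj := 0))//
  (ketp_sh s p (w := 2) (x := 0) (y := -2) (z := 2) (dl := 1) (d1 := 1) (d2 := 0) (dj := -1))//
  (ketp_sh s p (w := 1) (x := 0) (y := -2) (z := 1) (dl := 0) (d1 := 1) (d2 := 0) (dj := -1))//
  (ketp_sh s p (w := 0) (x := 0) (y := -2) (z := 0) (dl := -1) (d1 := 1) (d2 := 0) (dj := -1))//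
  !intE.
move: (coefBp q (jp p) (m1p p)) (coefB0 q (jp p) (m1p p)) (coefBm q (jp p) (m1p p))
  (coefCp q (lp p) (jp p) (m2p p)) (coefC0 q (lp p) (jp p) (m2p p))
  (coefCm q (lp p) (jp p) (m2p p)) (coefHp q (lp p) (jp p) (m2p p))
  (coefH0 q (lp p) (jp p) (m2p p)) (coefHp q (lp p - 1) (jp p) (m2p p))
  (coefCm q (lp p + 1) (jp p - 1) (m2p p)) (coefC0 q (lp p) (jp p - 1) (m2p p))
  (coefCp q (lp p - 1) (jp p - 1) (m2p p)) => A B C D E F G I J K L M.
apply: ell2P => t; rewrite !(ell2D, ell2B, ell2N, ell2Z, ell20) ?cN !cM; ring.
Qed.

Lemma x2_ketE s p : x2_ket q s (lp p) (m1p p) (m2p p) (jp p) = ket_sum x2_terms s p.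
Proof.
rewrite /x2_ket /real_complex_def /ket_sum /x2_terms !big_cons big_nil /=.
rewrite
  (ketp_sh s p (w := 2) (x := 0) (y := 0) (z := 0) (dl := 1) (d1 := 0) (d2 := 1) (dj := 0))//
  (ketp_sh s p (w := 1) (x := 0) (y := 0) (z := -1) (dl := 0) (d1 := 0) (d2 := 1) (dj := 0))//
  (ketp_sh s p (w := 0) (x := 0) (y := 0) (z := -2) (dl := -1) (d1 := 0) (d2 := 1) (dj := 0))//
  !intE.
move: (coefDp q (lp p) (jp p) (m2p p)) (coefD0 q (lp p) (jp p) (m2p p))
  (coefDm q (lp p) (jp p) (m2p p)) => A B C.
apply: ell2P => t; rewrite !(ell2D, ell2B, ell2N, ell2Z, ell20) ?cN !cM; ring.
Qed.

End Generators.

(** * The generators are sums of symbols *)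

Section GeneratorSymbols.
Variables (R : realType) (q : R).
Hypothesis hq : 0 < q < 1.
Implicit Types (p : pt) (s : bool) (sg : pt).
Local Notation sq := (sq q).
Local Notation iq := (iq q).
Local Notation d := (na^~ i0).
Local Notation a := (na^~ i1).
Local Notation b := (na^~ i2).
Local Notation c := (na^~ i3).

Local Ltac bnd0 := repeat first
  [ exact: bnd_sq | exact: bnd_iq | exact: bnd_cst | apply: bndMl => //
  | by apply: (bnd_exp hq (r := 0)) => p; rewrite leq0n ].

Local Ltac near_one := repeat first
  [ apply: near1M => // | apply: near1_if
  | by apply: (near1_sq hq (r := 1)) => p; rewrite ?wt3 ?wt_size /kd /kc; lia
  | by apply: (near1_iq hq (r := 1)) => p; rewrite ?wt3 ?wt_size /kd /kc; lia ].

Local Ltac depend := let E := fresh "E" in intros ? ? E; rewrite /od /kd /na !E//.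

Definition A0q p : R := qpow q (-2) * kq q * q ^+ 2 * iq (a p + b p) *
  iq (a p + b p + 2) * (q ^+ (2 * a p + 1) * qnum q 2 * tq q (b p) - tq q (a p + b p)).

Definition B0q p : R := (1 + q ^+ 2) * qpow q (-1) * q ^+ (a p + 2) * kq q *
  sq (b p) * sq (a p + 1) * iq (a p + b p) * iq (a p + b p + 2).

Lemma bnd_A0q : bnd q (fun=> 0%N) A0q.
Proof.
have bt m : bnd q (fun=> 0%N) (fun p => tq q (m p)).
  by exists 1 => // p; rewrite mulr1 tq_norm.
rewrite /A0q; apply: bndMl => //; first by bnd0.
by apply: bndD => //; [bnd0; exact: bt|apply: bndN; exact: bt].
Qed.

Lemma bnd_B0q : bnd q (fun=> 0%N) B0q.
Proof. by rewrite /B0q; bnd0. Qed.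

Lemma bnd_kd : bnd q d (fun p => q ^+ kd p).
Proof. by apply: (bnd_exp hq (r := 1)) => p; rewrite /kd; lia. Qed.

Lemma bndg_of (f : pt -> nat) (G : pt -> R) x :
  (forall p, good p -> `|G p| <= x * q ^+ f p) -> bndg q f (fun _ => G).
Proof.
move=> h; exists `|x| => // s p gp; apply: le_trans (h p gp) _.
by rewrite ler_wpM2r ?(qX_ge0 hq)// ler_norm.
Qed.

Lemma bndg_C0 : bndg q size_pt (fun _ p => coefC0 q (lp p) (jp p) (m2p p)).
Proof. by apply: bndg_of => p gp; rewrite wt_size; exact: coefC0_at. Qed.

Lemma bndg_C0_pred : bndg q size_pt (fun _ p => coefC0 q (lp p) (jp p - 1) (m2p p)).
Proof. by apply: bndg_of => p gp; rewrite wt_size; exact: coefC0_pred_at. Qed.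

Lemma bndg_D0 : bndg q size_pt (fun _ p => coefD0 q (lp p) (jp p) (m2p p)).
Proof. by apply: bndg_of => p gp; rewrite wt_size; exact: coefD0_at. Qed.

Lemma bndg_H0 : bndg q (fun p => d p + c p)%N
  (fun _ p => coefH0 q (lp p) (jp p) (m2p p)).
Proof. by apply: bndg_of => p gp; exact: coefH0_at. Qed.

Lemma small_sgn sg (f f' : pt -> nat) F F' : bndg q f F -> bndg q f' F' ->
  (forall p, size_pt p <= f p + f' p)%N ->
  bandT q sg (fun s p => sgn R s * (F s p * F' s p)).
Proof.
move=> h1 h2 le; apply: (bandT_small hq); apply: bndg_sgn.
exact: (bndg_le hq le (bndgM h1 h2)).
Qed.

Lemma bandT_opp sg F : bandT q sg F -> bandT q sg (fun s p => - F s p).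
Proof.
have h y : symbol q id y -> symbol q id (scale_term (-1) y) by exact: symbol_scale.
move=> bF; apply: eq_band (band_scale h bF) => v t.
rewrite mulN1r -mulNr; congr (_ * _).
by apply/eqP; rewrite eq_complex /= oppr0 !eqxx.
Qed.

(** Shared by x_0 and x_1, with X the bounded cofactor of A^0 or B^0: q^(a + b) from these and at
    least q^d from H^+ make level 3. *)
Lemma bandT_A0Hp sg X G : even_pt sg -> dep 3 X -> bnd q (fun=> 0%N) X ->
  (forall s p, good p -> G s p = q ^+ (a p + b p) * X p *
     coefHp q (lp p) (jp p) (m2p p)) -> bandT q sg G.
Proof.
move=> ev dX bX hG.
apply: (@bandT_level3 _ _ hq _ (fun p => q ^+ (a p + b p) *
    (if od p then q ^+ (d p + a p + b p + 1) * sq (d p + 1)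
     else q ^+ d p * sq (d p + a p + b p + 2)) * X p)
  (fun p => (if od p then sq (c p + a p + b p + 2) else sq (c p + 1)) *
     iq (d p + a p + b p + c p + 3))) => //.
- by apply: depM => //; depend.
- apply: bndMl => //.
  apply: (@bnd_le _ _ hq (fun p => (a p + b p) + d p)%N).
    by move=> p; rewrite wt3; lia.
  apply: bndM; first by apply: (bnd_exp hq (r := 0)) => p; lia.
  apply: bnd_if => //; apply: bndMl => //; first 1 last; do ?by bnd0.
  + by apply: (bnd_exp hq (r := 0)) => p; lia.
  + by apply: (bnd_exp hq (r := 0)) => p; lia.
- by near_one.
- by move=> s p gp; rewrite hG// coefHp_at//; case: (od p); ring.
Qed.

Lemma bandT_A0Hp_l sg X G : even_pt sg -> dep 3 X -> bnd q (fun=> 0%N) X ->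
  (forall s p, good p -> G s p = q ^+ (a p + b p) * X p *
     coefHp q (lp p - 1) (jp p) (m2p p)) -> bandT q sg G.
Proof.
move=> ev dX bX hG.
apply: (@bandT_level3 _ _ hq _ (fun p => q ^+ (a p + b p) *
    (if od p then q ^+ kd p * sq (d p + a p + b p + 1)
     else q ^+ (d p + a p + b p) * sq (d p)) * X p)
  (fun p => (if od p then sq (c p) else sq (c p + a p + b p + 1)) *
     iq (d p + a p + b p + c p + 1))) => //.
- by apply: depM => //; depend.
- apply: bndMl => //.
  apply: (@bnd_le _ _ hq (fun p => (a p + b p) + d p)%N).
    by move=> p; rewrite wt3; lia.
  apply: bndM; first by apply: (bnd_exp hq (r := 0)) => p; lia.
  apply: bnd_if => //; apply: bndMl => //; first 1 last; do ?by bnd0.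
  + by apply: (bnd_exp hq (r := 1)) => p; rewrite /kd; lia.
  + by apply: (bnd_exp hq (r := 1)) => p; rewrite /kd; lia.
- by near_one.
- by move=> s p gp; rewrite hG// coefHp_l_at//; case: (od p); ring.
Qed.

(** C^- alone is of order q^(d + a + b), so any bounded X depending on (d, a, b) leaves the level at
    3. *)
Lemma bandT_Cm sg X G : even_pt sg -> dep 3 X -> bnd q (fun=> 0%N) X ->
  (forall s p, good p -> G s p = X p * coefCm q (lp p) (jp p) (m2p p)) ->
  bandT q sg G.
Proof.
move=> ev dX bX hG.
apply: (@bandT_level3 _ _ hq _
  (fun p => q ^+ (d p + a p + b p + od p) * (-1 * sq (kd p) * X p))
  (fun p => sq (kc p) * iq (d p + a p + b p + c p + 1))) => //.
- by do 2 (apply: depM => //; first by depend).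
- apply: bndMl => //; last by bnd0.
  by apply: (bnd_exp hq (r := 0)) => p; rewrite wt3; lia.
- by near_one.
- by move=> s p gp; rewrite hG// coefCm_at//; ring.
Qed.

Lemma bandT_Cm_anti sg X G : even_pt sg -> dep 3 X -> bnd q (fun=> 0%N) X ->
  (forall s p, good p -> G s p = X p * coefCm q (lp p + 1) (jp p - 1) (m2p p)) ->
  bandT q sg G.
Proof.
move=> ev dX bX hG.
apply: (@bandT_level3 _ _ hq _
  (fun p => q ^+ (d p + a p + b p + od p) * (-1 * sq (kd p + 2) * X p))
  (fun p => sq (kc p + 2) * iq (d p + a p + b p + c p + 3))) => //.
- by do 2 (apply: depM => //; first by depend).
- apply: bndMl => //; last by bnd0.
  by apply: (bnd_exp hq (r := 0)) => p; rewrite wt3; lia.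
- by near_one.
- by move=> s p gp; rewrite hG// coefCm_anti_at//; ring.
Qed.

Lemma even_sh w x y z : (w + z) %% 2 == 0 :> int -> (x + y) %% 2 == 0 :> int ->
  even_pt (sh w x y z).
Proof. by rewrite /even_pt !ffunE /= => -> ->. Qed.

Lemma x0_symbols : foldr (fun z P => bandT q z.1 z.2 /\ P) True (x0_terms q).
Proof.
have A0E p : good p -> coefA0 q (jp p) (m1p p) = q ^+ (a p + b p) * A0q p.
  exact: coefA0_at.
pose Ap p : R := q ^+ a p * sq (a p + 1) * sq (b p + 1) * iq (a p + b p + 2).
pose Am p : R := qpow q (-1) * q ^+ a p * sq (a p) * sq (b p) * iq (a p + b p).
have bAp : bnd q (fun=> 0%N) Ap by rewrite /Ap; bnd0.
have bAm : bnd q (fun=> 0%N) Am by rewrite /Am; bnd0.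
have gAp : bndg q (fun=> 0%N) (fun _ p => coefAp q (jp p) (m1p p)).
  by apply: bnd_bndg bAp _ => s p gp; rewrite coefAp_at.
have gAm : bndg q (fun=> 0%N) (fun _ p => coefAp q (jp p - 1) (m1p p)).
  by apply: bnd_bndg bAm _ => s p gp; rewrite coefAp_pred_at.
have gA0 : bndg q (fun p => a p + b p)%N (fun _ p => coefA0 q (jp p) (m1p p)).
  apply: (bnd_bndg (g := fun p => q ^+ (a p + b p) * A0q p)) => [|s p gp].
    apply: bndMl => //; last exact: bnd_A0q.
    by apply: (bnd_exp hq (r := 0)) => p; lia.
  exact: A0E.
rewrite /x0_terms /=; do ![split].
(* A^+ C^+ is of order q^(d + a) and moves a and b: level 2. The last term, with j - 1, is alike. *)
- apply: (@bandT_level2 _ _ hq _ (fun p => q ^+ kd p * (q ^+ a p * (-1 * sq (a p + 1))))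
    (fun p => sq (b p + 1) * iq (a p + b p + 2) * sq (d p + a p + b p + 2 + od p))
    (fun p => sq (c p + a p + b p + 2 + ~~ od p) * iq (d p + a p + b p + c p + 3))).
  + exact: even_sh.
  + by rewrite ffunE.
  + by depend.
  + apply: (@bnd_le _ _ hq (fun p => d p + a p)%N); first by move=> p; rewrite wt2.
    apply: bndM; first exact: bnd_kd.
    apply: bndMl => //; last by bnd0.
    by apply: (bnd_exp hq (r := 0)) => p; lia.
  + by depend.
  + by near_one.
  + by near_one.
  + by move=> s p gp; rewrite coefAp_at// coefCp_at//; ring.
- apply: bandT_opp; exact: small_sgn gAp bndg_C0 _.
- apply: (bandT_Cm (X := Ap)) => // [|p p'|s p gp]; first exact: even_sh.
    by move=> E; rewrite /Ap /na !E.
  by rewrite coefAp_at.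
- apply: (bandT_A0Hp (X := A0q)) => // [| | |s p gp]; first exact: even_sh.
  + by rewrite /A0q; depend.
  + exact: bnd_A0q.
  + by rewrite A0E.
- by apply: small_sgn gA0 bndg_H0 _ => p; rewrite wt_size; lia.
- apply: (bandT_A0Hp_l (X := A0q)) => // [| | |s p gp]; first exact: even_sh.
  + by rewrite /A0q; depend.
  + exact: bnd_A0q.
  + by rewrite A0E.
- apply: (bandT_Cm_anti (X := Am)) => // [|p p'|s p gp]; first exact: even_sh.
    by move=> E; rewrite /Am /na !E.
  by rewrite coefAp_pred_at.
- apply: bandT_opp; exact: small_sgn gAm bndg_C0_pred _.
- apply: (@bandT_level2 _ _ hq _
    (fun p => q ^+ kd p * (q ^+ a p * (-1 * qpow q (-1) * sq (a p))))
    (fun p => sq (b p) * iq (a p + b p) * sq (d p + a p + b p + od p))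
    (fun p => sq (c p + a p + b p + ~~ od p) * iq (d p + a p + b p + c p + 1))).
  + exact: even_sh.
  + by rewrite ffunE.
  + by depend.
  + apply: (@bnd_le _ _ hq (fun p => d p + a p)%N); first by move=> p; rewrite wt2.
    apply: bndM; first exact: bnd_kd.
    apply: bndMl => //; last by bnd0.
    by apply: (bnd_exp hq (r := 0)) => p; lia.
  + by depend.
  + by near_one.
  + by near_one.
  + by move=> s p gp; rewrite coefAp_pred_at// coefCp_diag_at//; ring.
Qed.

Lemma x1_symbols : foldr (fun z P => bandT q z.1 z.2 /\ P) True (x1_terms q).
Proof.
have B0E p : good p -> coefB0 q (jp p) (m1p p) = q ^+ (a p + b p) * B0q p.
  exact: coefB0_at.
pose Bp p : R := sq (a p + 1) * sq (a p + 2) * iq (a p + b p + 2).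
pose Bm p : R := -1 * q ^+ (2 * a p + 1) * sq (b p) * sq (b p).-1 * iq (a p + b p).
have bBp : bnd q (fun=> 0%N) Bp by rewrite /Bp; bnd0.
have bBm : bnd q (fun=> 0%N) Bm by rewrite /Bm; bnd0.
have BmE p : good p -> coefBm q (jp p) (m1p p) = Bm p.
  by move=> gp; rewrite coefBm_at// /Bm; ring.
have gBp : bndg q (fun=> 0%N) (fun _ p => coefBp q (jp p) (m1p p)).
  by apply: bnd_bndg bBp _ => s p gp; rewrite coefBp_at.
have gBm : bndg q (fun=> 0%N) (fun _ p => coefBm q (jp p) (m1p p)).
  by apply: bnd_bndg bBm _ => s p gp; rewrite BmE.
have gB0 : bndg q (fun p => a p + b p)%N (fun _ p => coefB0 q (jp p) (m1p p)).
  apply: (bnd_bndg (g := fun p => q ^+ (a p + b p) * B0q p)) => [|s p gp].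
    apply: bndMl => //; last exact: bnd_B0q.
    by apply: (bnd_exp hq (r := 0)) => p; lia.
  exact: B0E.
rewrite /x1_terms /=; do ![split].
(* B^+ C^+ is of order q^d and moves a only: level 1. *)
- apply: (@bandT_level1 _ _ hq _ (fun p => q ^+ kd p * -1)
    (fun p => sq (a p + 1) * sq (a p + 2))
    (fun p => iq (a p + b p + 2) * sq (d p + a p + b p + 2 + od p))
    (fun p => sq (c p + a p + b p + 2 + ~~ od p) * iq (d p + a p + b p + c p + 3))).
  + exact: even_sh.
  + by rewrite ffunE.
  + by rewrite ffunE.
  + by depend.
  + apply: (@bnd_le _ _ hq d); first by move=> p; rewrite wt1.
    by apply: bndMl => //; [exact: bnd_kd|bnd0].
  + by depend.
  + by near_one.
  + by depend.
  + by near_one.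
  + by near_one.
  + by move=> s p gp; rewrite coefBp_at// coefCp_at//; ring.
- apply: bandT_opp; exact: small_sgn gBp bndg_C0 _.
- apply: (bandT_Cm (X := Bp)) => // [|p p'|s p gp]; first exact: even_sh.
    by move=> E; rewrite /Bp /na !E.
  by rewrite coefBp_at.
- apply: (bandT_A0Hp (X := B0q)) => // [| | |s p gp]; first exact: even_sh.
  + by rewrite /B0q; depend.
  + exact: bnd_B0q.
  + by rewrite B0E.
- by apply: small_sgn gB0 bndg_H0 _ => p; rewrite wt_size; lia.
- apply: (bandT_A0Hp_l (X := B0q)) => // [| | |s p gp]; first exact: even_sh.
  + by rewrite /B0q; depend.
  + exact: bnd_B0q.
  + by rewrite B0E.
- apply: (bandT_Cm_anti (X := Bm)) => // [|p p'|s p gp]; first exact: even_sh.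
    by move=> E; rewrite /Bm /na !E.
  by rewrite BmE.
- apply: bandT_opp; exact: small_sgn gBm bndg_C0_pred _.
(* B^- C^+ is of order q^(d + 2a) and moves b only; it is treated at level 2. *)
- apply: (@bandT_level2 _ _ hq _ (fun p => q ^+ kd p * q ^+ (2 * a p + 1))
    (fun p => sq (b p) * sq (b p).-1 * iq (a p + b p) * sq (d p + a p + b p + od p))
    (fun p => sq (c p + a p + b p + ~~ od p) * iq (d p + a p + b p + c p + 1))).
  + exact: even_sh.
  + by rewrite ffunE.
  + by depend.
  + apply: (@bnd_le _ _ hq (fun p => d p + a p)%N); first by move=> p; rewrite wt2.
    apply: bndM; first exact: bnd_kd.
    by apply: (bnd_exp hq (r := 0)) => p; lia.
  + by depend.
  + by near_one.
  + by near_one.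
  + by move=> s p gp; rewrite coefBm_at// coefCp_diag_at//; ring.
Qed.

Lemma x2_symbols : foldr (fun z P => bandT q z.1 z.2 /\ P) True (x2_terms q).
Proof.
rewrite /x2_terms /=; do ![split].
(* D^+ tends to 1 and moves d only: level 0. *)
- apply: (@bandT_level0 _ _ hq _ (fun p => sq (kd p + 2))
    (fun p => sq (d p + a p + b p + 2 + od p))
    (fun p => iq (d p + a p + b p + c p + 3))).
  + exact: even_sh.
  + by rewrite ffunE.
  + by rewrite ffunE.
  + by rewrite ffunE.
  + by depend.
  + by near_one.
  + by depend.
  + by near_one.
  + by near_one.
  + by move=> s p gp; rewrite coefDp_at//; ring.
- by apply: (bandT_small hq); apply: bndg_sgn; exact: bndg_D0.
(* D^- is of order q^(2d + a + b) and moves c, hence level 3. *)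
- apply: (@bandT_level3 _ _ hq _ (fun p => q ^+ (2 * d p + a p + b p + 2) * -1)
    (fun p => sq (kc p) * sq (c p + a p + b p + ~~ od p) *
              iq (d p + a p + b p + c p + 1))).
  + exact: even_sh.
  + by depend.
  + apply: bndMl => //; last by bnd0.
    by apply: (bnd_exp hq (r := 0)) => p; rewrite wt3; lia.
  + by near_one.
  + by move=> s p gp; rewrite coefDm_at//; ring.
Qed.

End GeneratorSymbols.

Theorem proposition4p18 (R : realType) (q : R) (hq : 0 < q < 1)
    (A : algType R[i]) (star : A -> A) (x : 'I_3 -> A)
    (hA : is_quantum_sphere q star x)
    (pi : A -> spinor_space R -> spinor_space R)
    (hpi : chiral_representation q star x pi)
    (absD : graph R (bool * label)%type) (habsD : absolute_value Dirac absD)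
    (J : spinor_space R -> spinor_space R) (hJ : real_structure J)
    (a b : A) :
  let JbJ := fun v => J (pi b (J v)) in
  smoothing absD (commutator (pi a) JbJ) /\
  exists Da : spinor_space R -> spinor_space R,
    bounded_commutator Dirac (pi a) Da /\
    smoothing absD (commutator Da JbJ).
Proof.
have [rep act_ket] := hpi; have [star_ax _ gen _] := hA.
(* From here on |D| is the explicit diagonal operator. *)
rewrite (absolute_value_Dirac_unique habsD).
have ax i u v : inner (pi (x i) u) v = inner u (pi (star (x i)) v).
  by rewrite -(rep_star rep) (starK star_ax).
have ket_pos s k : bvec R (s, k) = ket s (lp (pos k)) (m1p (pos k)) (m2p (pos k)) (jp (pos k)).
  rewrite -ketp_pos; apply/esym/ketpE; rewrite /lp /m1p /m2p /jp.
  by case: (unpos _) => [[[? ?] ?] ?].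
have lab k : is_label (lp (pos k)) (m1p (pos k)) (m2p (pos k)) (jp (pos k)).
  have := labelP k; rewrite -unpos_pos /lp /m1p /m2p /jp.
  by case: (unpos _) => [[[? ?] ?] ?].
apply: (symbol_conclusion hq star_ax rep gen _ hJ) => i.
have [->|[->|->]] : i = 0 \/ i = 1 \/ i = 2.
  case: i => [[|[|[|//]]] hi]; [left|right; left|right; right]; exact: val_inj.
- apply: generator_symbol (ax 0) _ (x0_symbols hq) => s k.
  by rewrite ket_pos -x0_ketE; have [-> _ _] := act_ket s _ _ _ _ (lab k).
- apply: generator_symbol (ax 1) _ (x1_symbols hq) => s k.
  by rewrite ket_pos -x1_ketE; have [_ -> _] := act_ket s _ _ _ _ (lab k).
- apply: generator_symbol (ax 2) _ (x2_symbols hq) => s k.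
  by rewrite ket_pos -x2_ketE; have [_ _ ->] := act_ket s _ _ _ _ (lab k).
Qed.
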